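(* Let $Z=(Z_t,\ t\ge 0)$ be a subordinator with no drift and with $\kappa:=\mathbb{E}Z_1\in(0,\infty)$, and let $\rho$ be the Lévy measure of $Z_1$. Let $f:\mathbb{R}_+\to\mathbb{R}_+$ be a fixed (Borel) function such that $I(t):=\int_0^t f(s)\,ds<\infty$ for every $t>0$; set $f(u)=0$ for $u<0$. Let $(\psi(t),\ t\ge 0)$ be the stochastic convolution process $$\psi(t):=\int_0^t f(t-s)\,dZ_s,\qquad t\ge 0,$$ and let $\nu$ be the Lévy measure of $\psi$. (a3) Given $a>0$ such that $I(a)>0$, let $r^{(a)}(t):=Vf(t-U_a)$, $t\ge 0$, where the random variable $U_a$ has density $s\mapsto f(a-s)/I(a)$ on $[0,a]$, $V$ has the law $\kappa^{-1}x\,\rho(dx)$ on $\mathbb{R}_+$, and $U_a$, $V$ and $(\psi(t),\ t\ge 0)$ are independent. Then $$\big(\psi(t)+Vf(t-U_a),\ t\ge 0\big)\ \overset{(\mathrm{law})}{=}\ (\psi(t),\ t\ge 0)\ \text{ under }\ \mathbb{E}\Big[\frac{\psi(a)}{\kappa I(a)};\ \cdot\ \Big].$$ (b3) Suppose that $\int_0^\infty e^{-\theta s}f(s)\,ds<\infty$ for some $\theta>0$. Let $Y$ be a random variable with the exponential law of mean $\theta^{-1}$, independent of $V$, where $V$ has law $\kappa^{-1}x\,\rho(dx)$. Then $$\nu(F)=\frac{\kappa}{\theta}\,\mathbb{E}\Big[V^{-1}e^{\theta Y}F\big(Vf(t-Y),\ t\ge 0\big)\Big]$$ for every measurable functional $F:\mathbb{R}_+^{[0,\infty)}\to\mathbb{R}_+$.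 Therefore $\nu$ is the law of the process $(Vf(t-Y),\ t\ge0)$ under the measure $\kappa\theta^{-1}V^{-1}e^{\theta Y}\,d\mathbb{P}$. (c3) Let $a>0$, $D_a=\{s\ge 0: f(a-s)=0\}$ and $D_a^c=\mathbb{R}_+\setminus D_a$. The components of the decomposition $\psi\overset{(\mathrm{law})}{=}(\psi\,|\,\psi(a)=0)+\mathcal{L}^{(a)}$ (independent terms) can be identified as $$(\psi(t),\ t\ge0\ |\ \psi(a)=0)\ \overset{(\mathrm{law})}{=}\ \Big(\int_0^t f(t-s)\mathbf{1}_{D_a}(s)\,dZ_s,\ t\ge 0\Big)$$ and $$(\mathcal{L}^{(a)}_t,\ t\ge 0)\ \overset{(\mathrm{law})}{=}\ \Big(\int_0^t f(t-s)\mathbf{1}_{D_a^c}(s)\,dZ_s,\ t\ge 0\Big).$$ The Lévy measures $\nu_a$ and $\tilde\nu_a$ of $(\psi(t),\ t\ge0\,|\,\psi(a)=0)$ and of $(\mathcal{L}^{(a)}_t,\ t\ge 0)$, respectively, are given by $$\nu_a(F)=\int_{D_a}\int_0^\infty F\big(xf(t-s),\ t\ge0\big)\,\rho(dx)\,ds\quad\text{and}\quad\tilde\nu_a(F)=\int_{D_a^c}\int_0^\infty F\big(xf(t-s),\ t\ge0\big)\,\rho(dx)\,ds$$ for every measurable functional $F:\mathbb{R}_+^{[0,\infty)}\to\mathbb{R}_+$.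
   Context: For a nonnegative infinitely divisible process $\psi=(\psi(x),x\in E)$ with no drift, its Lévy measure is the unique measure $\nu$ on $\mathbb{R}_+^E$ (all functions $E\to\mathbb{R}_+$, with the cylindrical $\sigma$-algebra) such that for all $n\ge1$, $\alpha_i\ge 0$, $x_i\in E$, $$\mathbb{E}\Big[e^{-\sum_{i=1}^n\alpha_i\psi(x_i)}\Big]=\exp\Big\{-\int_{\mathbb{R}_+^E}\big(1-e^{-\sum_{i=1}^n\alpha_i y(x_i)}\big)\nu(dy)\Big\},$$ and which has no mass at the zero function $0_E$ in the sense that $\nu(A)=\nu_*(A\setminus\{0_E\})$ for every cylindrical-measurable $A$, where $\nu_*$ is the inner measure. Write $\nu(F)=\int F\,d\nu$; measurability of functionals is with respect to the cylindrical $\sigma$-algebra. Here $E=[0,\infty)$, and $F(g(t),\,t\ge0)$ means $F$ evaluated at the function $t\mapsto g(t)$. Equality in law of processes means equality of finite-dimensional distributions. For a nonnegative random variable $W$ with $\mathbb{E}W=1$, ''$\psi$ under $\mathbb{E}[W;\ \cdot\ ]$'' means the law of $\psi$ under $W\,d\mathbb{P}$. A subordinator is a nondecreasing Lévy process started at $0$. For a nonnegative infinitely divisible process $\psi$ without drift with Lévy measure $\nu$ and $a\in E$, $(\psi\,|\,\psi(a)=0)$ and $\mathcal{L}^{(a)}$ denote independent nonnegative infinitely divisible processes without drift with Lévy measures $\nu_a(dy)=\mathbf{1}_{\{y(a)=0\}}\nu(dy)$ and $\tilde\nu_a(dy)=\mathbf{1}_{\{y(a)>0\}}\nu(dy)$,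 so that $\psi\overset{(\mathrm{law})}{=}(\psi\,|\,\psi(a)=0)+\mathcal{L}^{(a)}$; when $\mathbb{P}[\psi(a)=0]>0$, $(\psi\,|\,\psi(a)=0)$ has the ordinary conditional law of $\psi$ given $\{\psi(a)=0\}$.
   Formalization: In (b3) and in the formula for ν_a(F) in (c3), it is additionally assumed that I(t)>0 for some t>0; if f=0 almost everywhere then ν=0, while for F=1 the right-hand sides are infinite, so these formulas fail. *)

(* Defs.v *)
From HB Require Import structures.
From mathcomp Require Import all_boot all_order all_algebra.
From mathcomp Require Import finmap.
From mathcomp Require Import all_classical all_reals all_analysis.

Set Implicit Arguments.
Unset Strict Implicit.
Unset Printing Implicit Defensive.

Import Order.TTheory GRing.Theory Num.Theory.
Import numFieldNormedType.Exports.

Local Open Scope classical_set_scope.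
Local Open Scope ring_scope.

Section path_space.
Context {R : realType}.

HB.instance Definition _ := Choice.on {nonneg R}.
HB.instance Definition _ := isPointed.Build {nonneg R} 0%:nng.

Lemma posp_subproof (x : R) : 0 <= Num.max x 0.
Proof. by rewrite le_max lexx orbT. Qed.

(* The positive part, as an element of [R_+]. It is applied to numbers that are
   (almost surely) nonnegative, where it is the identity. *)
Definition posp (x : R) : {nonneg R} := NngNum (posp_subproof x).

Definition cylinders (E : Type) : set (set (E -> {nonneg R})) :=
  [set A | exists (x : E) (B : set R),
     measurable B /\ A = [set y | B (y x)%:num]].

End path_space.

(* [R_+^E] with the cylindrical sigma-algebra. *)
Notation paths R E := (g_sigma_algebraType (@cylinders R E)).

Section levy_measure.
Context {R : realType} {E : Type}.

Definition zero_path : paths R E := fun=> 0%:nng.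

Definition inner_measure d (T : measurableType d)
    (mu : {measure set T -> \bar R}) (A : set T) : \bar R :=
  ereal_sup [set mu C | C in [set C | measurable C /\ C `<=` A]].

Definition no_mass_at_zero (nu : {measure set (paths R E) -> \bar R}) : Prop :=
  forall A, measurable A -> nu A = inner_measure nu (A `\ zero_path).

(* [nu] is the Levy measure of the nonnegative infinitely divisible process
   without drift [X]; since [expeR -oo = 0], the Laplace formula forces the
   integral on the right-hand side to be finite. *)
Definition is_levy_measure d (T : measurableType d) (P : probability T R)
    (X : E -> T -> R) (nu : {measure set (paths R E) -> \bar R}) : Prop :=
  (forall (n : nat) (alpha : 'I_n -> {nonneg R}) (x : 'I_n -> E),
     'E_P[fun w => expR (- \sum_(i < n) (alpha i)%:num * X (x i) w)]%E =
     expeR (- \int[nu]_y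
       (1 - expR (- \sum_(i < n) (alpha i)%:num * (y (x i))%:num))%:E)%E) /\
  no_mass_at_zero nu.

Lemma measurable_coord (a : E) :
  measurable_fun [set: paths R E] (fun y : paths R E => (y a)%:num : R).
Proof.
move=> _ B mB; rewrite setTI; apply: sub_sigma_algebra.
by exists a, B.
Qed.

Lemma measurable_vanish (a : E) :
  measurable [set y : paths R E | (y a)%:num = 0].
Proof.
rewrite (_ : mkset _ =
  [set: paths R E] `&` (fun y : paths R E => (y a)%:num : R) @^-1` [set 0]).
  exact: measurable_coord.
by rewrite setTI.
Qed.

Lemma measurable_pos (a : E) :
  measurable [set y : paths R E | 0 < (y a)%:num].
Proof.
rewrite (_ : mkset _ =
  [set: paths R E] `&` (fun y : paths R E => (y a)%:num : R) @^-1` `]0, +oo[).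
  exact: measurable_coord.
by rewrite setTI; apply/seteqP; split=> y /=; rewrite in_itv/= andbT.
Qed.

(* [nu_a(dy) = 1_{y(a) = 0} nu(dy)] *)
Definition levy_zero (nu : {measure set (paths R E) -> \bar R}) (a : E) :=
  mrestr nu (measurable_vanish a).

HB.instance Definition _ nu a := Measure.on (levy_zero nu a).

(* [tilde nu_a(dy) = 1_{y(a) > 0} nu(dy)] *)
Definition levy_pos (nu : {measure set (paths R E) -> \bar R}) (a : E) :=
  mrestr nu (measurable_pos a).

HB.instance Definition _ nu a := Measure.on (levy_pos nu a).

End levy_measure.

Section processes.
Context {R : realType} d (T : measurableType d).

Definition nonneg_process (E : Type) (X : E -> T -> R) : Prop :=
  forall t, measurable_fun setT (X t) /\ forall w, 0 <= X t w.

(* [W dP] *)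
Definition weighted (P : probability T R) (W : T -> R) (A : set T) : \bar R :=
  (\int[P]_(w in A) (W w)%:E)%E.

Definition mutually_independent (P : probability T R) (I : choiceType)
    (G : I -> set (set T)) : Prop :=
  forall (J : {fset I}) (A : I -> set T), (forall i, i \in J -> G i (A i)) ->
    P (\bigcap_(i in [set` J]) A i) = (\prod_(i <- J) P (A i))%E.

Definition sigma_rv (X : T -> R) : set (set T) :=
  preimage_set_system setT X measurable.

Definition sigma_process (E : Type) (X : E -> T -> R) : set (set T) :=
  <<s \bigcup_t sigma_rv (X t) >>.

Definition independent2 (P : probability T R) (G1 G2 : set (set T)) : Prop :=
  mutually_independent P (fun i : 'I_2 => nth set0 [:: G1; G2] i).

Definition independent3 (P : probability T R) (G1 G2 G3 : set (set T)) : Prop :=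
  mutually_independent P (fun i : 'I_3 => nth set0 [:: G1; G2; G3] i).

End processes.

(* Equality of the finite-dimensional distributions of [X1] under [mu1] and
   of [X2] under [mu2]. *)
Definition same_law (R : realType) (E : Type)
    d1 (T1 : measurableType d1) (mu1 : set T1 -> \bar R) (X1 : E -> T1 -> R)
    d2 (T2 : measurableType d2) (mu2 : set T2 -> \bar R) (X2 : E -> T2 -> R)
    : Prop :=
  forall (n : nat) (t : n.-tuple E) (B : set (n.-tuple R)), measurable B ->
    mu1 [set w | B [tuple X1 (tnth t i) w | i < n]] =
    mu2 [set w | B [tuple X2 (tnth t i) w | i < n]].

Section subordinators.
Context {R : realType} d (T : measurableType d) (P : probability T R).

(* A nondecreasing Levy process started at 0. Paths are right-continuous; they
   have left limits by monotonicity. *)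
Record subordinator := Subordinator {
  sub_fun :> {nonneg R} -> T -> R ;
  sub_measurable : forall t, measurable_fun setT (sub_fun t) ;
  sub_start : forall w, sub_fun 0%:nng w = 0 ;
  sub_nondecreasing : forall (w : T) (s t : {nonneg R}),
    s%:num <= t%:num -> sub_fun s w <= sub_fun t w ;
  sub_right_continuous : forall (w : T) (t : {nonneg R}),
    sub_fun (posp s) w @[s --> (t%:num)^'+] --> sub_fun t w ;
  sub_stationary : forall (s t h : {nonneg R}) (B : set R),
    t%:num = s%:num + h%:num -> measurable B ->
    P [set w | B (sub_fun t w - sub_fun s w)] = P [set w | B (sub_fun h w)] ;
  sub_independent : forall t : nat -> {nonneg R},
    (forall n, (t n)%:num <= (t n.+1)%:num) ->
    mutually_independent P
      (fun n => sigma_rv (fun w => sub_fun (t n.+1) w - sub_fun (t n) w)) }.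

(* The path of [Z] extended by [0] to the negative half-line. *)
Definition ext_path (Z : subordinator) (w : T) (s : R) : R := Z (posp s) w.

Section ext_path_cumulative.
Variables (Z : subordinator) (w : T).

Lemma ext_path_nd : nondecreasing (ext_path Z w).
Proof.
move=> s t st; apply: sub_nondecreasing => /=.
by rewrite ge_max !le_max st lexx orbT.
Qed.

Lemma ext_path_rc : right_continuous (ext_path Z w).
Proof.
move=> t; have [t0|t0] := leP 0 t.
  have tE : (posp t)%:num = t by rewrite /= max_l.
  by have := @sub_right_continuous Z w (posp t); rewrite tE.
have E (s : R) : s < 0 -> posp s = 0%:nng.
  by move=> s0; apply/val_inj => /=; rewrite max_r// ltW.
rewrite {2}/ext_path (E _ t0).
apply: cvg_near_cst; near=> s.
rewrite /ext_path E//; near: s; exact: nbhs_right_lt.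
Unshelve. all: by end_near. Qed.

HB.instance Definition _ :=
  isCumulative.Build R _ R (ext_path Z w) ext_path_nd ext_path_rc.

End ext_path_cumulative.

(* [\int_0^t h(s) dZ_s], pathwise, as a Lebesgue-Stieltjes integral; [fine]
   sends [+oo] to [0], which for the integrands used below only matters on a
   null event. *)
Definition sub_integral (Z : subordinator) (h : R -> R) (t : {nonneg R}) (w : T)
    : R :=
  fine (\int[lebesgue_stieltjes_measure (ext_path Z w)]_(s in `[0%R, t%:num])
          (h s)%:E)%E.

Definition stoch_conv (Z : subordinator) (f : R -> R) (t : {nonneg R}) : T -> R :=
  sub_integral Z (fun s => f (t%:num - s)) t.

Definition stoch_conv_on (Z : subordinator) (f : R -> R) (D : set R)
    (t : {nonneg R}) : T -> R :=
  sub_integral Z (fun s => f (t%:num - s) * \1_D s) t.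

(* [X] is a nonnegative infinitely divisible random variable without drift
   whose Levy measure is [rho]. *)
Definition driftless_levy_measure (X : T -> R)
    (rho : {measure set (measurableTypeR R) -> \bar R}) : Prop :=
  rho [set` `]-oo, 0%R]] = 0%E /\
  forall alpha : R, 0 <= alpha ->
    'E_P[fun w => expR (- (alpha * X w))]%E =
    expeR (- \int[rho]_(x in `]0%R, +oo[) (1 - expR (- (alpha * x)))%:E)%E.

(* [V] has law [kappa^{-1} x rho(dx)]. *)
Definition has_size_biased_law (V : T -> R) (kappa : R)
    (rho : {measure set (measurableTypeR R) -> \bar R}) : Prop :=
  forall A : set R, measurable A ->
    P (V @^-1` A) = (\int[rho]_(x in A `&` `]0%R, +oo[) (kappa^-1 * x)%:E)%E.

(* [X] and [L] are (distributed as) [(psi | psi(a) = 0)] and [L^(a)], for [psi]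
   with Levy measure [nu]. *)
Definition levy_decomposition (E : Type) (X L : E -> T -> R)
    (nu : {measure set (paths R E) -> \bar R}) (a : E) : Prop :=
  [/\ nonneg_process X, nonneg_process L,
      independent2 P (sigma_process X) (sigma_process L),
      is_levy_measure P X (levy_zero nu a) &
      is_levy_measure P L (levy_pos nu a)].

End subordinators.

Definition prim {R : realType} (f : R -> R) (t : R) : \bar R :=
  (\int[lebesgue_measure]_(s in `[0%R, t]) (f s)%:E)%E.

(* The function [t |-> x f(t - s)]. *)
Definition jump_path {R : realType} (f : R -> R) (x s : R)
    : paths R {nonneg R} :=
  fun t => posp (x * f (t%:num - s)).

(* Main.v *)
(* With [Phi] the Laplace exponent of [Z_1], independence of the increments
   gives [E exp(- \int h dZ) = exp(- \int Phi(h(s)) ds)] for step functions [h],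
   and [E \int h dZ = kappa \int h ds] extends it to all integrable [h >= 0].
   For [h = \sum_i alpha_i f(t_i - .)] this says that [nu] and the image [M] of
   [ds rho(dx)] under [(s, x) |-> x f(. - s)] have the same Laplace functional.
   Weighted by [1 - exp(- \sum_i alpha_i y(t_i))] both are finite, hence they
   agree on [{y | \sum_i alpha_i y(t_i) > 0}]. To conclude [nu = M] one finds
   countably many times [C] such that for almost every [s] some [c] in [C] has
   [f(c - s) > 0]: then [M] does not charge the paths vanishing on [C], and
   neither does [nu], because measurable sets depend on countably many
   coordinates and [nu] has no mass at the zero path. (b3) is a rewriting of [M];
   (c3) splits the jumps according to whether [f(a - s) = 0]; (a3) is obtained by
   differentiating the Laplace functional in the direction of [psi(a)].
   Since [rho] is not assumed sigma-finite, Fubini is applied to the probability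
   [q(dx) = kappa^-1 x rho(dx)], with the weight [kappa / x]. *)
Require Import Defs.
From HB Require Import structures.
From mathcomp Require Import all_boot all_order all_algebra.
From mathcomp Require Import finmap.
From mathcomp Require Import all_classical all_reals all_analysis.
From mathcomp Require Import measurable_realfun ring lra.

Set Implicit Arguments.
Unset Strict Implicit.
Unset Printing Implicit Defensive.

Import Order.TTheory GRing.Theory Num.Theory.
Import numFieldNormedType.Exports.

Local Open Scope classical_set_scope.
Local Open Scope ring_scope.

(** * Weighted image measures *)

(** Neither [rho] nor [nu] is known to be sigma-finite, and the singleton of [zero_path] is not
    measurable, since a measurable set of paths constrains only countably many times. Measures are
    therefore compared through integrals of [W * F(phi)] with a weight [W] of finite integral, for
    which Laplace transforms determine everything. This last fact is obtained by hand: integer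
    powers of [e^{-y}] already yield the tails [y > b] through explicit polynomials, and coordinates
    are treated one at a time, each turned from an exponential into an indicator.

    The countable set of times is found by minimising the mass left uncovered; the minimum is
    attained because a countable union of countable sets is countable. The passage of the Laplace
    functional from step functions to integrable ones rests on an L1 bound with constant [kappa],
    valid for both sides of the formula. Derivatives are taken along [b = 2^-n], where difference
    quotients increase, so that they can be computed before the limit is known to be finite. *)

Section mixture_measure.

Import HBNNSimple.

(** Exchanging nonnegative series or monotone limits with an integral is valid for every measure, so
    [m] may be [rho] or [nu]. The integral formula holds for simple functions and passes to the
    limit by monotone convergence, first under each [k x], then under [m]. *)
Lemma mixture_measure d1 d2 (X : measurableType d1) (Y : measurableType d2)
    (R : realType) (m : {measure set X -> \bar R}) (W : X -> R)
    (k : X -> {measure set Y -> \bar R}) :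
  measurable_fun setT W -> (forall x, 0 <= W x) ->
  (forall B, measurable B -> measurable_fun [set: X] (k ^~ B)) ->
  exists mu : {measure set Y -> \bar R},
    (forall B, measurable B -> mu B = \int[m]_x ((W x)%:E * k x B))%E /\
    (forall F : Y -> \bar R, measurable_fun setT F -> (forall y, 0 <= F y)%E ->
       \int[mu]_y F y = \int[m]_x ((W x)%:E * \int[k x]_y F y))%E.
Proof.
move=> mW W0 mk.
pose mu0 (B : set Y) := (\int[m]_x ((W x)%:E * k x B))%E.
have mu00 : mu0 set0 = 0%E.
  by rewrite /mu0 integral0_eq// => x _; rewrite measure0 mule0.
have mu0_ge0 B : (0 <= mu0 B)%E.
  by apply: integral_ge0 => x _; rewrite mule_ge0// lee_fin.
have mu0_sigma : semi_sigma_additive mu0.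
  move=> F mF tF mUF.
  have -> : mu0 (\bigcup_n F n) = (\sum_(n <oo) mu0 (F n))%E.
    rewrite /mu0 -integral_nneseries//; last 2 first.
    - move=> n; apply: emeasurable_funM; [exact/measurable_EFinP|exact: mk].
    - by move=> n x _; rewrite mule_ge0// lee_fin.
    apply: eq_integral => x _.
    rewrite nneseriesZl//; congr (_ * _)%E.
    by rewrite measure_semi_bigcup.
  apply: is_cvg_ereal_nneg_natsum_cond => n _ _; exact: mu0_ge0.
pose mu : {measure set Y -> \bar R} :=
  HB.pack mu0 (isMeasure.Build _ _ _ mu0 mu00 mu0_ge0 mu0_sigma).
exists mu; split=> // F mF F0.
have mWE : measurable_fun setT (EFin \o W) by exact/measurable_EFinP.
have intk (G : Y -> \bar R) : measurable_fun setT G -> (forall y, 0 <= G y)%E ->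
    measurable_fun setT (fun x => \int[k x]_y G y)%E.
  by move=> mG G0; exact: measurable_fun_integral_kernel.
pose f_ := nnsfun_approx measurableT mF.
have muf n : (\int[mu]_y (f_ n y)%:E =
              \int[m]_x ((W x)%:E * \int[k x]_y (f_ n y)%:E))%E.
  rewrite integralT_nnsfun sintegralE.
  under [RHS]eq_integral do rewrite integralT_nnsfun sintegralE.
  under [RHS]eq_integral => x _.
    rewrite ge0_mule_fsumr; last by move=> r; exact: nnsfun_mulemu_ge0.
    over.
  rewrite ge0_integral_fsum//; last 2 first.
  - move=> r; apply: emeasurable_funM => //; apply: emeasurable_funM => //.
    exact: mk.
  - move=> r x _; apply: mule_ge0; first by rewrite lee_fin.
    exact: nnsfun_mulemu_ge0.
  apply: eq_fsbigr => r _.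
  rewrite /mu/= /mu0.
  have [r0|r0] := leP 0 r.
    under [RHS]eq_integral do rewrite muleCA.
    rewrite ge0_integralZl//.
    - apply: emeasurable_funM => //; exact: mk.
    - by move=> x _; rewrite mule_ge0// lee_fin.
  rewrite preimage_nnfun0// [X in (_ * X)%E]integral0_eq; last first.
    by move=> x _; rewrite measure0 mule0.
  by rewrite mule0 integral0_eq// => x _; rewrite measure0 !mule0.
transitivity (\int[mu]_y (lim ((f_ n y)%:E @[n --> \oo])))%E.
  apply/eq_integral => z _; apply/esym/cvg_lim => //=.
  exact: cvg_nnsfun_approx.
rewrite monotone_convergence//; last 3 first.
- by move=> n; exact/measurable_EFinP.
- by move=> n z _; rewrite lee_fin.
- by move=> z _ a b ab; rewrite lee_fin; exact/lefP/nd_nnsfun_approx.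
under eq_fun do rewrite muf.
rewrite -monotone_convergence//; last 3 first.
- move=> n; apply: emeasurable_funM => //; apply: intk.
    exact/measurable_EFinP.
  by move=> y; rewrite lee_fin.
- move=> n x _; apply: mule_ge0; first by rewrite lee_fin.
  by apply: integral_ge0 => y _; rewrite lee_fin.
- move=> x _ a b ab; apply: lee_wpmul2l; first by rewrite lee_fin.
  apply: ge0_le_integral => //.
  + by move=> z _; rewrite lee_fin.
  + exact/measurable_EFinP.
  + exact/measurable_EFinP.
  + by move=> z _; rewrite lee_fin; exact/lefP/nd_nnsfun_approx.
apply: eq_integral => x _.
have cvgk : ((\int[k x]_y (f_ n y)%:E)%E @[n --> \oo] --> (\int[k x]_y F y)%E).
  have -> : (\int[k x]_y F y)%E = (\int[k x]_y (lim ((f_ n y)%:E @[n --> \oo])))%E.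
    apply: eq_integral => y _; apply/esym/cvg_lim => //.
    exact: cvg_nnsfun_approx.
  apply: cvg_monotone_convergence => //.
  - by move=> n; exact/measurable_EFinP.
  - by move=> n z _; rewrite lee_fin.
  - by move=> z _ a b ab; rewrite lee_fin; exact/lefP/nd_nnsfun_approx.
by apply/cvg_lim => //; exact: cvgeZl.
Qed.

End mixture_measure.

(** The mixture of the Dirac masses at [phi x]. Having a genuine measure on [Y] makes uniqueness
    theorems for measures available. *)
Lemma weighted_image d1 d2 (X : measurableType d1) (Y : measurableType d2)
    (R : realType) (m : {measure set X -> \bar R}) (W : X -> R) (phi : X -> Y) :
  measurable_fun setT W -> (forall x, 0 <= W x) -> measurable_fun setT phi ->
  exists mu : {measure set Y -> \bar R},
    (forall B, measurable B -> mu B = \int[m]_(x in phi @^-1` B) (W x)%:E)%E /\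
    (forall F : Y -> \bar R, measurable_fun setT F -> (forall y, 0 <= F y)%E ->
       \int[mu]_y F y = \int[m]_x ((W x)%:E * F (phi x)))%E.
Proof.
move=> mW W0 mphi.
have mk B : measurable B -> measurable_fun setT (fun x => \d_(phi x) B : \bar R).
  by move=> mB; exact: (measurableT_comp (@measurable_fun_dirac _ Y R setT B mB) mphi).
have [mu [muE muI]] := @mixture_measure _ _ X Y R m W (fun x => \d_(phi x)) mW W0 mk.
exists mu; split=> [B mB|F mF F0].
  rewrite muE// [RHS]integral_mkcond; apply: eq_integral => x _.
  rewrite /= diracE /patch.
  have -> : (phi x \in B) = (x \in phi @^-1` B) by apply/idP/idP; rewrite !inE.
  by case: ifPn => _; rewrite ?mule1 ?mule0.
rewrite muI//; apply: eq_integral => x _.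
by rewrite integral_dirac// diracT mul1e.
Qed.

(** The pi-lambda theorem for the two weighted images. Since the whole space belongs to [G] and has
    finite mass, the exhausting sequence is constant. *)
Lemma weighted_integral_unique d d1 d2 (Y : measurableType d)
    (X1 : measurableType d1) (X2 : measurableType d2) (R : realType)
    (m1 : {measure set X1 -> \bar R}) (m2 : {measure set X2 -> \bar R})
    (W1 : X1 -> R) (W2 : X2 -> R) (phi1 : X1 -> Y) (phi2 : X2 -> Y)
    (G : set (set Y)) :
  @measurable _ Y = <<s G >> -> setI_closed G -> G setT ->
  measurable_fun setT W1 -> (forall x, 0 <= W1 x) -> measurable_fun setT phi1 ->
  measurable_fun setT W2 -> (forall x, 0 <= W2 x) -> measurable_fun setT phi2 ->
  (\int[m1]_x (W1 x)%:E < +oo)%E ->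
  (forall A, G A -> \int[m1]_(x in phi1 @^-1` A) (W1 x)%:E =
                    \int[m2]_(x in phi2 @^-1` A) (W2 x)%:E)%E ->
  forall F : Y -> \bar R, measurable_fun setT F -> (forall y, 0 <= F y)%E ->
  (\int[m1]_x ((W1 x)%:E * F (phi1 x)) = \int[m2]_x ((W2 x)%:E * F (phi2 x)))%E.
Proof.
move=> YG GI GT mW1 W10 mphi1 mW2 W20 mphi2 W1fin GE F mF F0.
have [mu1 [mu1E mu1I]] := weighted_image m1 mW1 W10 mphi1.
have [mu2 [mu2E mu2I]] := weighted_image m2 mW2 W20 mphi2.
have mG A : G A -> measurable A by rewrite YG; exact: sub_sigma_algebra.
rewrite -mu1I// -mu2I//; apply: eq_measure_integral => A mA _.
apply: (measure_unique G (fun=> setT)) => //.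
- by rewrite bigcup_const//; exists 0%N.
- by move=> B GB; rewrite mu1E ?mu2E ?GE//; exact: mG.
- by move=> _; rewrite mu1E// preimage_setT.
Qed.

Lemma weighted_integral_eq d d1 d2 (Y : measurableType d)
    (X1 : measurableType d1) (X2 : measurableType d2) (R : realType)
    (m1 : {measure set X1 -> \bar R}) (m2 : {measure set X2 -> \bar R})
    (W1 : X1 -> R) (W2 : X2 -> R) (phi1 : X1 -> Y) (phi2 : X2 -> Y) :
  measurable_fun setT W1 -> (forall x, 0 <= W1 x) -> measurable_fun setT phi1 ->
  measurable_fun setT W2 -> (forall x, 0 <= W2 x) -> measurable_fun setT phi2 ->
  (forall A, measurable A -> \int[m1]_x (W1 x * \1_A (phi1 x))%:E =
                             \int[m2]_x (W2 x * \1_A (phi2 x))%:E)%E ->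
  forall F : Y -> \bar R, measurable_fun setT F -> (forall y, 0 <= F y)%E ->
  (\int[m1]_x ((W1 x)%:E * F (phi1 x)) = \int[m2]_x ((W2 x)%:E * F (phi2 x)))%E.
Proof.
move=> mW1 W10 mphi1 mW2 W20 mphi2 E F mF F0.
have [mu1 [mu1E mu1I]] := weighted_image m1 mW1 W10 mphi1.
have [mu2 [mu2E mu2I]] := weighted_image m2 mW2 W20 mphi2.
rewrite -mu1I// -mu2I//; apply: eq_measure_integral => A mA _.
have muE (mu : {measure set Y -> \bar R}) : mu A = (\int[mu]_y (\1_A y)%:E)%E.
  by rewrite integral_indic// setIT.
have mi : measurable_fun setT (EFin \o (\1_A : Y -> R)).
  by apply/measurable_EFinP; exact: measurable_indic.
by rewrite !muE mu1I// mu2I//; exact: E.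
Qed.

Lemma ge0_integrable d (T : measurableType d) (R : realType)
    (m : {measure set T -> \bar R}) (f : T -> R) :
  measurable_fun setT f -> (forall x, 0 <= f x) ->
  (\int[m]_x (f x)%:E < +oo)%E -> m.-integrable setT (EFin \o f).
Proof.
move=> mf f0 fi; apply/integrableP; split; first exact/measurable_EFinP.
by under eq_integral do rewrite /= ger0_norm//.
Qed.

Lemma integrable_mul_bounded d (T : measurableType d) (R : realType)
    (m : {measure set T -> \bar R}) (W g : T -> R) :
  measurable_fun setT W -> (forall x, 0 <= W x) -> measurable_fun setT g ->
  (forall x, 0 <= g x <= 1) ->
  (\int[m]_x (W x)%:E < +oo)%E -> m.-integrable setT (EFin \o (W \* g)).
Proof.
move=> mW W0 mg g01 fi.
apply: le_integrable (ge0_integrable mW W0 fi) => //.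
  by apply/measurable_EFinP/measurable_funM.
move=> x _; have /andP[g0 g1] := g01 x.
by rewrite /= lee_fin !ger0_norm ?mulr_ge0// ler_piMr.
Qed.

Lemma eq_big_tnth_seq (R : nmodType) (I : Type) (s : seq I) (F : I -> R) :
  \sum_(i < size s) F (tnth (in_tuple s) i) = \sum_(x <- s) F x.
Proof. by rewrite [RHS]big_tnth. Qed.

(** * Laplace transforms on the half-line and on the space of paths *)

Section laplace_cutoff.
Context {R : realType}.

(* As n grows this tends to the indicator of ]b, +oo[: with u = exp(-nx), the
   power m satisfies m u ~ n exp(n(b - x)), which tends to 0 if b < x and is at
   least n - 1 otherwise. *)
Definition cutoff (b : R) (n : nat) (x : R) : R :=
  (1 - expR (- (n%:R * x))) ^+ Num.truncn (n%:R * expR (n%:R * b)).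

Lemma expRN_le1 (x : R) : 0 <= x -> 0 <= expR (- x) <= 1.
Proof. by move=> x0; rewrite expR_ge0 -expR0 ler_expR oppr_le0 x0. Qed.

Lemma onem_expRN_itv (x : R) : 0 <= x -> 0 <= 1 - expR (- x) <= 1.
Proof.
by move=> /expRN_le1 /andP[h1 h2]; rewrite subr_ge0 h2 lerBlDr lerDl h1.
Qed.

Lemma bernoulli_ineq (u : R) (m : nat) : 0 <= u <= 1 ->
  1 - m%:R * u <= (1 - u) ^+ m.
Proof.
move=> /andP[u0 u1]; elim: m => [|m ih]; first by rewrite mul0r subr0 expr0.
rewrite exprS; apply: (@le_trans _ _ ((1 - u) * (1 - m%:R * u))).
  rewrite -natr1; have : 0 <= m%:R :> R by []; nra.
by rewrite ler_wpM2l// subr_ge0.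
Qed.

(** From [1 - u <= e^{-u}] and [e^{mu} >= 1 + mu]. *)
Lemma expr_onem_le (u : R) (m : nat) : 0 <= u <= 1 ->
  (1 - u) ^+ m <= (1 + m%:R * u)^-1.
Proof.
move=> /andP[u0 u1].
have mu0 : 0 <= m%:R * u by rewrite mulr_ge0.
apply: (@le_trans _ _ (expR (- (m%:R * u)))).
  rewrite -mulrN mulrC expRM_natr lerXn2r ?nnegrE ?expR_ge0 ?subr_ge0//.
  by rewrite (le_trans _ (expR_ge1Dx _)).
rewrite expRN lef_pV2 ?posrE ?expR_gt0 ?expR_ge1Dx//.
by rewrite ltr_pwDl.
Qed.

Lemma cutoff_itv b n (x : R) : 0 <= x -> 0 <= cutoff b n x <= 1.
Proof.
move=> x0; have /andP[h0 h1] : 0 <= 1 - expR (- (n%:R * x)) <= 1.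
  by rewrite onem_expRN_itv// mulr_ge0.
by rewrite /cutoff exprn_ge0// exprn_ile1.
Qed.

Lemma expR_ge_sqr (y : R) : 0 <= y -> y ^+ 2 / 2 <= expR y.
Proof.
move=> y0; have := @expR_ge1Dxn R y 1 y0.
by apply: le_trans; rewrite lerDr.
Qed.

(** The factor [n] in the exponent of [cutoff] decides the boundary case: without it the limit at
    [x = b > 0] would be [1/e], whereas here it is [0], and the limit is exactly the indicator of
    the open half-line. *)
Lemma cvg_cutoff (b x : R) : 0 <= x ->
  cutoff b n x @[n --> \oo] --> ((b < x)%R%:R : R).
Proof.
move=> x0; have cinv : ((n.+1%:R : R)^-1) @[n --> \oo] --> (0 : R).
  exact: cvg_harmonic.
have u01 n : 0 <= expR (- (n%:R * x)) <= 1 by rewrite expRN_le1// mulr_ge0.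
have [xb|bx] := leP x b.
  rewrite -cvg_shiftS/=.
  have cinv2 : ((n.+1%:R : R)^-1) @[n --> \oo] --> (0 : R) by [].
  apply: (@squeeze_cvgr _ _ _ _ (fun=> 0) (fun n => n.+1%:R^-1)) => //;
    last exact: cvg_cst.
  near=> n; have /andP[-> _] /= := cutoff_itv b n.+1 x0.
  apply: le_trans (expr_onem_le _ (u01 _)) _.
  rewrite lef_pV2 ?posrE ?ltr_pwDl ?mulr_ge0 ?expR_ge0//.
  set N := n.+1%:R.
  have N0 : 0 <= N by [].
  (* Truncation loses at most one: [(m + 1) u >= N] and [u <= 1] give [1 + m u >= N]. *)
  have := truncnS_gt (N * expR (N * b)); rewrite -natr1.
  set m := (Num.truncn _)%:R => mb.
  have /andP[v0 v1] := u01 n.+1; rewrite -/N in v0 v1 *.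
  have e1 : 1 <= expR (N * b) * expR (- (N * x)).
    by rewrite -expRD -expR0 ler_expR -mulrBr mulr_ge0// subr_ge0.
  have : N * 1 <= N * (expR (N * b) * expR (- (N * x))) by rewrite ler_wpM2l.
  have : N * expR (N * b) * expR (- (N * x)) <= (m + 1) * expR (- (N * x)).
    by rewrite ler_wpM2r// ltW.
  rewrite mulrDl mul1r mulr1 mulrA; lra.
rewrite -cvg_shiftS/=.
have c0 : 0 < x - b by rewrite subr_gt0.
(* The lower bound comes from [m u <= N e^{-N(x - b)}] and [e^y >= y^2 / 2] with [y = N(x - b)]. *)
have cinv2 : (1 - (2 / (x - b) ^+ 2) * (n.+1%:R : R)^-1) @[n --> \oo] --> (1 : R).
  rewrite -[X in _ --> X]subr0; apply: cvgB; first exact: cvg_cst.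
  rewrite -(mulr0 (2 / (x - b) ^+ 2)); apply: cvgM => //; exact: cvg_cst.
apply: (@squeeze_cvgr _ _ _ _ (fun n => 1 - (2 / (x - b) ^+ 2) * (n.+1%:R)^-1)
  (fun=> 1)) => //; last exact: cvg_cst.
near=> n; have /andP[_ ->] /= := cutoff_itv b n.+1 x0; rewrite andbT.
apply: le_trans (bernoulli_ineq _ (u01 _)).
rewrite lerD2l lerN2.
set N := n.+1%:R.
have N0 : 0 < N by rewrite /N.
have mb : (Num.truncn (N * expR (N * b)))%:R <= N * expR (N * b).
  by rewrite truncn_le mulr_ge0// ?expR_ge0 ?ltW.
apply: (@le_trans _ _ (N * expR (N * b) * expR (- (N * x)))).
  by rewrite ler_wpM2r ?expR_ge0.
rewrite -mulrA -expRD -mulrBr -opprB mulrN expRN.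
have y0 : 0 < N * (x - b) by rewrite mulr_gt0.
apply: (@le_trans _ _ (N * ((N * (x - b)) ^+ 2 / 2)^-1)).
  rewrite ler_wpM2l ?(ltW N0)// lef_pV2 ?posrE ?expR_gt0//.
    by rewrite expR_ge_sqr// ltW.
  by rewrite divr_gt0// exprn_gt0.
rewrite le_eqVlt; apply/orP; left; apply/eqP.
by field; rewrite !gt_eqF.
Unshelve. all: by end_near. Qed.

Lemma measurable_cutoff b n : measurable_fun [set: R] (cutoff b n).
Proof.
apply: measurable_funX; apply: measurable_funB => //.
by apply: measurableT_comp => //; apply: measurableT_comp.
Qed.

End laplace_cutoff.

Section laplace_unique.
Context {R : realType} d1 d2 (X1 : measurableType d1) (X2 : measurableType d2).
Variables (m1 : {measure set X1 -> \bar R}) (m2 : {measure set X2 -> \bar R}).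
Variables (W1 Y1 : X1 -> R) (W2 Y2 : X2 -> R).
Hypotheses (mW1 : measurable_fun setT W1) (W10 : forall x, 0 <= W1 x).
Hypotheses (mW2 : measurable_fun setT W2) (W20 : forall x, 0 <= W2 x).
Hypotheses (mY1 : measurable_fun setT Y1) (Y10 : forall x, 0 <= Y1 x).
Hypotheses (mY2 : measurable_fun setT Y2) (Y20 : forall x, 0 <= Y2 x).
Hypothesis W1fin : (\int[m1]_x (W1 x)%:E < +oo)%E.
Hypothesis lapl : forall k : nat,
  (\int[m1]_x (W1 x * expR (- (k%:R * Y1 x)))%:E =
   \int[m2]_x (W2 x * expR (- (k%:R * Y2 x)))%:E)%E.

Let W2fin : (\int[m2]_x (W2 x)%:E < +oo)%E.
Proof.
have := lapl 0; under eq_integral do rewrite mul0r oppr0 expR0 mulr1.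
by under [RHS]eq_integral do rewrite mul0r oppr0 expR0 mulr1; move=> <-.
Qed.

Let e (d : measure_display) (X : measurableType d) (W Y : X -> R) (n j k : nat) x :=
  W x * (expR (- (j%:R * Y x)) * (1 - expR (- (n%:R * Y x))) ^+ k).

Let eg01 (d : measure_display) (X : measurableType d) (Y : X -> R) n j k x :
  (forall x, 0 <= Y x) ->
  0 <= expR (- (j%:R * Y x)) * (1 - expR (- (n%:R * Y x))) ^+ k <= 1.
Proof.
move=> Y0.
have /andP[a0 a1] : 0 <= expR (- (j%:R * Y x)) <= 1 by rewrite expRN_le1 ?mulr_ge0.
have /andP[b0 b1] : 0 <= 1 - expR (- (n%:R * Y x)) <= 1.
  by rewrite onem_expRN_itv// mulr_ge0.
by rewrite mulr_ge0 ?exprn_ge0//= mulr_ile1 ?exprn_ge0// exprn_ile1.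
Qed.

Let meg (d : measure_display) (X : measurableType d) (Y : X -> R) n j k :
  measurable_fun setT Y -> measurable_fun setT
    (fun x => expR (- (j%:R * Y x)) * (1 - expR (- (n%:R * Y x))) ^+ k).
Proof.
move=> mY; apply: measurable_funM; last apply: measurable_funX.
  apply: measurableT_comp => //; apply: measurableT_comp => //.
  exact: measurable_funM.
apply: measurable_funB => //.
apply: measurableT_comp => //; apply: measurableT_comp => //.
exact: measurable_funM.
Qed.

(** Pascal recursion: one more factor [1 - e^{-nY}] is the difference of the integrals for [j] and
    [j + n], hence the induction on [k] for all [j] at once. *)
Let lapl_poly n j k :
  (\int[m1]_x (e W1 Y1 n j k x)%:E = \int[m2]_x (e W2 Y2 n j k x)%:E)%E.
Proof.
elim: k j => [|k ih] j.
  have := lapl j; rewrite /e; under eq_integral do rewrite -(mulr1 (expR _)).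
  by under [RHS]eq_integral do rewrite -(mulr1 (expR _)).
have eS (d : measure_display) (X : measurableType d) (W Y : X -> R) x :
    e W Y n j k.+1 x = e W Y n j k x - e W Y n (j + n) k x.
  by rewrite /e natrD (mulrDl _ _ (Y x)) opprD expRD exprS; ring.
under eq_integral do rewrite eS.
under [RHS]eq_integral do rewrite eS.
rewrite !integralB_EFin//; last 4 first.
- by apply: (integrable_mul_bounded mW2 W20 _ _ W2fin) => [|x]; [exact: meg|exact: eg01].
- by apply: (integrable_mul_bounded mW2 W20 _ _ W2fin) => [|x]; [exact: meg|exact: eg01].
- by apply: (integrable_mul_bounded mW1 W10 _ _ W1fin) => [|x]; [exact: meg|exact: eg01].
- by apply: (integrable_mul_bounded mW1 W10 _ _ W1fin) => [|x]; [exact: meg|exact: eg01].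
by rewrite !ih.
Qed.

Let lapl_cutoff b n : (\int[m1]_x (W1 x * cutoff b n (Y1 x))%:E =
                       \int[m2]_x (W2 x * cutoff b n (Y2 x))%:E)%E.
Proof.
have := lapl_poly n 0 (Num.truncn (n%:R * expR (n%:R * b))).
rewrite /e; under eq_integral do rewrite mul0r oppr0 expR0 mul1r.
by under [RHS]eq_integral do rewrite mul0r oppr0 expR0 mul1r.
Qed.

Let cvg_lapl_cutoff (d : measure_display) (X : measurableType d)
    (m : {measure set X -> \bar R}) (W Y : X -> R) (b : R) :
  measurable_fun setT W -> (forall x, 0 <= W x) ->
  measurable_fun setT Y -> (forall x, 0 <= Y x) ->
  (\int[m]_x (W x)%:E < +oo)%E ->
  (\int[m]_x (W x * cutoff b n (Y x))%:E)%E @[n --> \oo] -->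
  (\int[m]_(x in Y @^-1` `]b, +oo[) (W x)%:E)%E.
Proof.
move=> mW W0 mY Y0 Wfin.
rewrite [X in _ --> X]integral_mkcond.
apply: (@dominated_cvg _ _ _ _ _ _ _ _ (EFin \o W)) => //.
- move=> n; apply/measurable_EFinP/measurable_funM => //.
  exact: measurableT_comp (measurable_cutoff _ _) _.
- move=> x _; rewrite /patch.
  have c := @cvg_cutoff R b _ (Y0 x).
  have : W x * cutoff b n (Y x) @[n --> \oo] --> W x * (b < Y x)%R%:R.
    by apply: cvgM => //; exact: cvg_cst.
  move=> cW; rewrite (_ : (if _ then _ else _) = (W x * (b < Y x)%R%:R)%:E).
    by apply: cvg_EFin => //; near=> n.
  rewrite (_ : (x \in _) = (b < Y x)); last first.
    by apply/idP/idP; rewrite inE/= in_itv/= andbT.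
  by case: ltP => _; rewrite ?mulr1 ?mulr0.
- exact: ge0_integrable.
- move=> n x _ /=; have /andP[c0 c1] := cutoff_itv b n (Y0 x).
  by rewrite lee_fin ger0_norm ?mulr_ge0// ler_piMr.
Unshelve. all: by end_near. Qed.

(** A [cutoff] is a polynomial in [e^{-Y}], so its integral is determined by the Laplace transform
    at integers; letting [n] grow, with [W] as dominating function, gives the mass of every set
    [Y > b], and these sets form a pi-system. *)
Lemma laplace_unique (F : R -> \bar R) :
  measurable_fun setT F -> (forall y, 0 <= F y)%E ->
  (\int[m1]_x ((W1 x)%:E * F (Y1 x)) = \int[m2]_x ((W2 x)%:E * F (Y2 x)))%E.
Proof.
apply: (@weighted_integral_unique _ _ _ _ _ _ _ _ _ _ _ _ _
  [set A | A = setT \/ exists b : R, A = `]b, +oo[%classic]) => //.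
- apply: (etrans (RGenOInfty.measurableE R)); apply/seteqP; split.
    by apply: sub_sigma_algebra2 => A [b ->]; right; exists b.
  apply: smallest_sub; first exact: sigma_algebra_measurable.
  move=> A [->|[b ->]]; first exact: (@measurableT _ (g_sigma_algebraType _)).
  by apply: sub_sigma_algebra; exists b.
- move=> A B [->|[a ->]]; first by rewrite setTI.
  move=> [->|[b ->]]; first by rewrite setIT; right; exists a.
  right; exists (Num.max a b); apply/seteqP; split=> x /=;
    rewrite !in_itv/= !andbT gt_max; last by move=> /andP.
  by move=> [-> ->].
- by left.
- move=> A [->|[b ->]].
    rewrite !preimage_setT.
    have := lapl 0; under eq_integral do rewrite mul0r oppr0 expR0 mulr1.
    by under [RHS]eq_integral do rewrite mul0r oppr0 expR0 mulr1.
  have c1 := @cvg_lapl_cutoff _ _ m1 W1 Y1 b mW1 W10 mY1 Y10 W1fin.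
  have c2 := @cvg_lapl_cutoff _ _ m2 W2 Y2 b mW2 W20 mY2 Y20 W2fin.
  rewrite -(cvg_lim _ c1)// -(cvg_lim _ c2)//; congr (lim (_ @ \oo)).
  by apply/funext => n; exact: lapl_cutoff.
Qed.

End laplace_unique.

(** * Laplace functionals on the space of paths *)

Section path_space_laplace.
Context {R : realType} {E : Type}.

(** Finite combinations of coordinates are lists, so that induction and concatenation are available;
    [laplace_formulaP] translates from families indexed by ordinals. *)
Definition pairing (l : seq ({nonneg R} * E)) (y : paths R E) : R :=
  \sum_(p <- l) p.1%:num * (y p.2)%:num.

Lemma pairing_ge0 l y : 0 <= pairing l y.
Proof. by apply: sumr_ge0 => p _; rewrite mulr_ge0. Qed.

Lemma measurable_pairing l : measurable_fun [set: paths R E] (pairing l).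
Proof.
apply: measurable_sum => p; apply: measurable_funM => //.
exact: measurable_coord.
Qed.

Lemma pairing_cons p l y :
  pairing (p :: l) y = p.1%:num * (y p.2)%:num + pairing l y.
Proof. by rewrite /pairing big_cons. Qed.

Lemma pairing_cat l l' y : pairing (l ++ l') y = pairing l y + pairing l' y.
Proof. by rewrite /pairing big_cat. Qed.

Lemma measurable_paths d (T : measurableType d) (phi : T -> paths R E) :
  (forall x, measurable_fun setT (fun t => (phi t x)%:num : R)) ->
  measurable_fun setT phi.
Proof.
move=> mphi; apply: (@measurability _ _ _ _ setT phi (@cylinders R E)) => //.
move=> _ [_ [x [B [mB ->]]] <-]; exact: mphi.
Qed.

(** Intersecting boxes is concatenating lists. Boxes thus form a pi-system, which single cylinders
    over different coordinates do not. *)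
Definition box (s : seq (E * set R)) : set (paths R E) :=
  foldr (fun p A => [set y | p.2 (y p.1)%:num] `&` A) setT s.

Definition measurable_box (s : seq (E * set R)) : Prop :=
  foldr (fun p Q => measurable p.2 /\ Q) True s.

Lemma box_measurable s : measurable_box s -> measurable (box s).
Proof.
elim: s => [_|p s ih /= [mp ms]]; first exact: measurableT.
apply: measurableI; last exact: ih.
by apply: sub_sigma_algebra; exists p.1, p.2.
Qed.

Lemma box_cat s s' : box (s ++ s') = box s `&` box s'.
Proof. by elim: s => [|p s ih] /=; rewrite ?setTI// ih setIA. Qed.

Lemma measurable_box_cat s s' :
  measurable_box s -> measurable_box s' -> measurable_box (s ++ s').
Proof. by move=> + ms'; elim: s => [//|p s ih /= [? ?]]; split => //; exact: ih. Qed.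

Lemma measurable_boxE : @measurable _ (paths R E) =
  <<s [set A | exists s, measurable_box s /\ A = box s] >>.
Proof.
apply/seteqP; split.
  apply: sub_sigma_algebra2 => _ [x [B [mB ->]]].
  by exists [:: (x, B)]; split => //=; rewrite setIT.
apply: smallest_sub; first exact: sigma_algebra_measurable.
by move=> _ [s [ms ->]]; exact: box_measurable.
Qed.

Section unique.
Context d1 d2 (T1 : measurableType d1) (T2 : measurableType d2).
Variables (m1 : {measure set T1 -> \bar R}) (m2 : {measure set T2 -> \bar R}).
Variables (W1 : T1 -> R) (W2 : T2 -> R).
Variables (phi1 : T1 -> paths R E) (phi2 : T2 -> paths R E).
Hypotheses (mW1 : measurable_fun setT W1) (W10 : forall x, 0 <= W1 x).
Hypotheses (mW2 : measurable_fun setT W2) (W20 : forall x, 0 <= W2 x).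
Hypotheses (mphi1 : measurable_fun setT phi1) (mphi2 : measurable_fun setT phi2).
Hypothesis W1fin : (\int[m1]_x (W1 x)%:E < +oo)%E.
Hypothesis lapl : forall l,
  (\int[m1]_x (W1 x * expR (- pairing l (phi1 x)))%:E =
   \int[m2]_x (W2 x * expR (- pairing l (phi2 x)))%:E)%E.

Let Wbox (T : Type) (W : T -> R) (phi : T -> paths R E) s l x :=
  W x * (\1_(box s) (phi x) * expR (- pairing l (phi x))).

Let Wbox0 (T : Type) (W : T -> R) (phi : T -> paths R E) s l x :
  (forall x, 0 <= W x) -> 0 <= Wbox W phi s l x.
Proof. by move=> W0; rewrite /Wbox !mulr_ge0// ?expR_ge0. Qed.

Let measurable_Wbox d (T : measurableType d) (W : T -> R)
    (phi : T -> paths R E) s l : measurable_fun setT W ->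
  measurable_fun setT phi -> measurable_box s ->
  measurable_fun setT (Wbox W phi s l).
Proof.
move=> mW mphi ms; apply: measurable_funM => //; apply: measurable_funM.
  by apply: (measurableT_comp (measurable_indic (box_measurable ms))).
apply: measurableT_comp => //; apply: measurableT_comp => //.
exact: measurableT_comp (measurable_pairing l) mphi.
Qed.

(** Induction on the number of constraints. Taking the remaining indicators and exponentials as the
    weight, [laplace_unique] replaces exponentials of one coordinate by an indicator; the factor
    [e^{-k y(p.1)}] it requires is absorbed into [l], which is why [l] stays general. *)
Let lapl_box s l : measurable_box s ->
  (\int[m1]_x (Wbox W1 phi1 s l x)%:E = \int[m2]_x (Wbox W2 phi2 s l x)%:E)%E.
Proof.
elim: s l => [l _|p s ih l /= [mp ms]].
  rewrite /Wbox/=; under eq_integral do rewrite indicT mul1r.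
  by under [RHS]eq_integral do rewrite indicT mul1r.
have Wcons (T : Type) (W : T -> R) (phi : T -> paths R E) x :
    (Wbox W phi (p :: s) l x)%:E =
    ((Wbox W phi s l x)%:E * (\1_(p.2) (phi x p.1)%:num)%:E)%E.
  rewrite /Wbox/= indicI/= -EFinM; congr EFin.
  have -> : \1_[set y : paths R E | p.2 (y p.1)%:num] (phi x) =
            \1_(p.2) (phi x p.1)%:num :> R.
    by rewrite !indicE; congr (_%:R); apply/idP/idP; rewrite !inE.
  by ring.
under eq_integral do rewrite Wcons.
under [RHS]eq_integral do rewrite Wcons.
have mc d (T : measurableType d) (phi : T -> paths R E) :
    measurable_fun setT phi -> measurable_fun setT (fun x => (phi x p.1)%:num : R).
  move=> mphi; exact: measurableT_comp (measurable_coord p.1) mphi.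
apply: (@laplace_unique R _ _ _ _ _ _ _ (fun x => (phi1 x p.1)%:num) _
  (fun x => (phi2 x p.1)%:num) _ _ _ _ _ _ _ _ _ _ (EFin \o \1_(p.2))) => //.
- exact: measurable_Wbox.
- by move=> x; exact: Wbox0.
- exact: measurable_Wbox.
- by move=> x; exact: Wbox0.
- exact: mc.
- exact: mc.
- apply: le_lt_trans W1fin; apply: ge0_le_integral => //.
  + by move=> x _; rewrite lee_fin; exact: Wbox0.
  + by apply/measurable_EFinP; exact: measurable_Wbox.
  + exact/measurable_EFinP.
  + move=> x _; have /andP[_ e1] := expRN_le1 (pairing_ge0 l (phi1 x)).
    by rewrite lee_fin ler_piMr// mulr_ile1 ?expR_ge0// indicE; case: (_ \in _).
- move=> k.
  have We (T : Type) (W : T -> R) (phi : T -> paths R E) x :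
      Wbox W phi s l x * expR (- (k%:R * (phi x p.1)%:num)) =
      Wbox W phi s ((k%:R%:nng, p.1) :: l) x.
    by rewrite /Wbox pairing_cons/= opprD expRD; ring.
  under eq_integral do rewrite We.
  under [RHS]eq_integral do rewrite We.
  exact: ih.
- by apply/measurable_EFinP; exact: measurable_indic.
- by move=> y; rewrite lee_fin.
Qed.

Lemma laplace_paths_unique (F : paths R E -> \bar R) :
  measurable_fun setT F -> (forall y, 0 <= F y)%E ->
  (\int[m1]_x ((W1 x)%:E * F (phi1 x)) = \int[m2]_x ((W2 x)%:E * F (phi2 x)))%E.
Proof.
apply: (@weighted_integral_unique _ _ _ _ _ _ _ _ _ _ _ _ _ _ measurable_boxE) => //.
- move=> _ _ [s [ms ->]] [s' [ms' ->]]; exists (s ++ s').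
  by split; [exact: measurable_box_cat|rewrite box_cat].
- by exists [::].
- move=> _ [s [ms ->]]; have := lapl_box [::] ms.
  have WE d (T : measurableType d) (m : {measure set T -> \bar R}) (W : T -> R)
      (phi : T -> paths R E) : (\int[m]_x (Wbox W phi s [::] x)%:E =
      \int[m]_(x in phi @^-1` (box s)) (W x)%:E)%E.
    rewrite [RHS]integral_mkcond; apply: eq_integral => x _.
    rewrite /Wbox /pairing big_nil oppr0 expR0 mulr1 /patch indicE.
    have -> : (phi x \in box s) = (x \in phi @^-1` box s).
      by apply/idP/idP; rewrite !inE.
    by case: ifPn => _; rewrite ?mulr1 ?mulr0.
  by rewrite !WE.
Qed.

End unique.

Definition path_of (T : Type) (X : E -> T -> R) (w : T) : paths R E :=
  fun t => posp (X t w).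

Lemma posp_num (x : R) : 0 <= x -> (posp x)%:num = x.
Proof. by move=> x0; rewrite /= max_l. Qed.

Lemma measurable_path_of d (T : measurableType d) (X : E -> T -> R) :
  (forall t, measurable_fun setT (X t)) -> measurable_fun setT (path_of X).
Proof. by move=> mX; apply: measurable_paths => x /=; exact: measurable_maxr. Qed.

Lemma measurable_path_tuple n (t : n.-tuple E) (B : set (n.-tuple R)) :
  measurable B ->
  measurable [set y : paths R E | B [tuple (y (tnth t i))%:num | i < n]].
Proof.
move=> mB; rewrite -[X in measurable X]setTI.
have : measurable_fun [set: paths R E]
    (fun y : paths R E => [tuple (y (tnth t i))%:num | i < n]).
  apply/measurable_fun_tnthP => i.
  rewrite (_ : _ \o _ = fun y : paths R E => (y (tnth t i))%:num).
    exact: measurable_coord.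
  by apply/funext => y /=; rewrite tnth_mktuple.
by apply.
Qed.

Lemma preimage_path_of_tuple (T : Type) (X : E -> T -> R) n (t : n.-tuple E)
    (B : set (n.-tuple R)) : (forall t w, 0 <= X t w) ->
  [set w | B [tuple X (tnth t i) w | i < n]] =
  path_of X @^-1` [set y : paths R E | B [tuple (y (tnth t i))%:num | i < n]].
Proof.
move=> X0; apply/seteqP; split=> w /=; congr (B _); apply/eq_from_tnth => i;
  by rewrite !tnth_mktuple max_l.
Qed.

End path_space_laplace.

Section levy_laplace.
Context {R : realType} {E : Type} d (T : measurableType d) (P : probability T R).

Lemma laplace_formulaP (X : E -> T -> R)
    (nu : {measure set (paths R E) -> \bar R}) :
  (forall (n : nat) (alpha : 'I_n -> {nonneg R}) (x : 'I_n -> E),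
     'E_P[fun w => expR (- \sum_(i < n) (alpha i)%:num * X (x i) w)]%E =
     expeR (- \int[nu]_y
       (1 - expR (- \sum_(i < n) (alpha i)%:num * (y (x i))%:num))%:E)%E) <->
  (forall l, 'E_P[fun w => expR (- \sum_(p <- l) p.1%:num * X p.2 w)]%E =
     expeR (- \int[nu]_y (1 - expR (- pairing l y))%:E)%E).
Proof.
split=> [H l|H n alpha x].
  have := H _ (fun i => (tnth (in_tuple l) i).1) (fun i => (tnth (in_tuple l) i).2).
  under eq_fun do rewrite (eq_big_tnth_seq _ (fun p => p.1%:num * X p.2 _)).
  move=> ->; congr (expeR (- _)%E); apply: eq_integral => y _.
  by rewrite (eq_big_tnth_seq _ (fun p => p.1%:num * (y p.2)%:num)).
have := H [seq (alpha i, x i) | i <- index_enum 'I_n].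
under eq_fun do rewrite big_map/=.
by move=> ->; congr (expeR (- _)%E); apply: eq_integral => y _; rewrite /pairing big_map.
Qed.

End levy_laplace.

(** * Derivative of a Laplace functional; independence *)

Section difference_quotient.
Context {R : realType}.

(** The quotient [(1 - e^{-bx}) / b] at [b = 2^-n]. Halving [b] increases it because
    [1 - u^2 <= 2 (1 - u)], so monotone convergence applies even when the limit has infinite
    integral. *)
Definition expR_quot (n : nat) (x : R) : R :=
  2 ^+ n * (1 - expR (- ((2 ^+ n)^-1 * x))).

Lemma expR_quot_ge0 n x : 0 <= x -> 0 <= expR_quot n x.
Proof.
move=> x0; rewrite mulr_ge0 ?exprn_ge0//.
have : 0 <= (2 ^+ n)^-1 * x by rewrite mulr_ge0// invr_ge0 exprn_ge0.
by move=> /onem_expRN_itv/andP[].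
Qed.

Lemma expR_quotS n x : expR_quot n x <= expR_quot n.+1 x.
Proof.
rewrite /expR_quot; set u := expR (- ((2 ^+ n.+1)^-1 * x)).
have -> : expR (- ((2 ^+ n)^-1 * x)) = u ^+ 2.
  rewrite /u -expRM_natl; congr expR; rewrite exprS; field.
  by rewrite expf_neq0.
rewrite [2 ^+ n.+1]exprS; have p0 : 0 <= 2 ^+ n :> R by rewrite exprn_ge0.
have := mulr_ge0 p0 (sqr_ge0 (1 - u)); lra.
Qed.

Lemma nondecreasing_expR_quot x : nondecreasing_seq (expR_quot ^~ x).
Proof. by apply/nondecreasing_seqP => n; exact: expR_quotS. Qed.

Lemma onem_expRN_bounds (x : R) : 0 <= x ->
  x * expR (- x) <= 1 - expR (- x) <= x.
Proof.
move=> x0; apply/andP; split.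
  have e0 := expR_gt0 (- x).
  have : (1 + x) * expR (- x) <= expR x * expR (- x).
    by rewrite ler_wpM2r ?expR_ge0 ?expR_ge1Dx.
  by rewrite -expRD subrr expR0; lra.
have := expR_ge1Dx (- x); lra.
Qed.

Lemma cvg_expR_quot (x : R) : 0 <= x -> expR_quot n x @[n --> \oo] --> x.
Proof.
move=> x0.
have c2 : ((2 ^+ n : R)^-1 * x) @[n --> \oo] --> (0 : R).
  rewrite -[X in _ --> X](mul0r x); apply: cvgM; last exact: cvg_cst.
  have -> : (fun n => (2 ^+ n : R)^-1) = geometric 1 (2^-1).
    by apply/funext => n; rewrite /= mul1r exprVn.
  by apply: cvg_geometric; rewrite ger0_norm ?invr_ge0// invf_lt1// ltr1n.
have ce : (x * expR (- ((2 ^+ n : R)^-1 * x))) @[n --> \oo] --> x.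
  rewrite -[X in _ --> X]mulr1; apply: cvgM; first exact: cvg_cst.
  rewrite -[X in _ --> X](@expR0 R); apply: continuous_cvg; first exact: continuous_expR.
  rewrite -[X in _ --> X](@oppr0 R); apply: cvgN; exact: c2.
apply: (@squeeze_cvgr _ _ _ _ (fun n => x * expR (- ((2 ^+ n : R)^-1 * x)))
  (fun=> x)) => //; last exact: cvg_cst.
near=> n.
have p0 : 0 < 2 ^+ n :> R by rewrite exprn_gt0.
have y0 : 0 <= (2 ^+ n : R)^-1 * x by rewrite mulr_ge0// invr_ge0 ltW.
have /andP[h1 h2] := onem_expRN_bounds y0.
rewrite /expR_quot; apply/andP; split.
  have : 2 ^+ n * ((2 ^+ n : R)^-1 * x * expR (- ((2 ^+ n)^-1 * x))) <=
         2 ^+ n * (1 - expR (- ((2 ^+ n)^-1 * x))) by rewrite ler_pM2l.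
  by rewrite -mulrA mulVKf// gt_eqF.
have : 2 ^+ n * (1 - expR (- ((2 ^+ n)^-1 * x))) <=
       2 ^+ n * ((2 ^+ n : R)^-1 * x) by rewrite ler_pM2l.
by rewrite mulVKf// gt_eqF.
Unshelve. all: by end_near. Qed.

Lemma measurable_expR_quot n : measurable_fun [set: R] (expR_quot n).
Proof.
apply: measurable_funM => //; apply: measurable_funB => //.
by apply: measurableT_comp => //; apply: measurableT_comp.
Qed.

Lemma cvg_integral_expR_quot d (T : measurableType d)
    (m : {measure set T -> \bar R}) (W X : T -> R) :
  measurable_fun setT W -> (forall x, 0 <= W x) ->
  measurable_fun setT X -> (forall x, 0 <= X x) ->
  (\int[m]_x (W x * expR_quot n (X x))%:E)%E @[n --> \oo] -->
  (\int[m]_x (W x * X x)%:E)%E.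
Proof.
move=> mW W0 mX X0.
have -> : (\int[m]_x (W x * X x)%:E =
    \int[m]_x lim ((W x * expR_quot n (X x))%:E @[n --> \oo]))%E.
  apply: eq_integral => x _; apply/esym/cvg_lim => //.
  apply: cvg_EFin; first by near=> n.
  by apply: cvgM; [exact: cvg_cst|exact: cvg_expR_quot].
apply: cvg_monotone_convergence => //.
- move=> n; apply/measurable_EFinP/measurable_funM => //.
  exact: measurableT_comp (measurable_expR_quot n) mX.
- by move=> n x _; rewrite lee_fin mulr_ge0// expR_quot_ge0.
- move=> x _ a b ab; rewrite lee_fin ler_wpM2l//.
  exact: nondecreasing_expR_quot.
Unshelve. all: by end_near. Qed.

(** Divide both hypotheses by [b = 2^-n]. The quotient [D b / b] tends to the integral of [w y], and
    [c (1 - e^{-D b}) / b] is squeezed between [e^{-D b} c D b / b] and [c D b / b], where [D b]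
    tends to [0]. Both members may be infinite, so the squeeze is done by comparing limits in the
    extended reals. *)
Lemma laplace_derivative d1 d2 (T : measurableType d1) (S : measurableType d2)
    (m1 : {measure set T -> \bar R}) (m2 : {measure set S -> \bar R})
    (W X : T -> R) (w y : S -> R) (c : R) (D : R -> R) :
  measurable_fun setT W -> (forall x, 0 <= W x) ->
  measurable_fun setT X -> (forall x, 0 <= X x) ->
  measurable_fun setT w -> (forall x, 0 <= w x) ->
  measurable_fun setT y -> (forall x, 0 <= y x) -> 0 <= c ->
  (forall b : R, (0 < b)%R ->
     \int[m2]_s (w s * (1 - expR (- (b * y s))))%:E = (D b)%:E)%E ->
  (forall b : R, (0 < b)%R -> \int[m1]_x (W x * (1 - expR (- (b * X x))))%:E =
     (c * (1 - expR (- D b)))%:E)%E ->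
  (\int[m1]_x (W x * X x)%:E = c%:E * \int[m2]_s (w s * y s)%:E)%E.
Proof.
move=> mW W0 mX X0 mw w0 my y0 c0 HD H.
pose b n : R := (2 ^+ n)^-1.
have b0 n : 0 < b n by rewrite invr_gt0 exprn_gt0.
have D0 n : 0 <= D (b n).
  rewrite -lee_fin -HD//; apply: integral_ge0 => s _; rewrite lee_fin mulr_ge0//.
  have : 0 <= b n * y s by rewrite mulr_ge0// ltW.
  by move=> /onem_expRN_itv/andP[].
have scale d (T' : measurableType d) (m : {measure set T' -> \bar R}) (V Y : T' -> R) n :
    measurable_fun setT V -> (forall x, 0 <= V x) ->
    measurable_fun setT Y -> (forall x, 0 <= Y x) ->
    (\int[m]_x (V x * expR_quot n (Y x))%:E =
     (2 ^+ n)%:E * \int[m]_x (V x * (1 - expR (- (b n * Y x))))%:E)%E.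
  move=> mV V0 mY Y0; rewrite -ge0_integralZl_EFin//.
  - by apply: eq_integral => x _; rewrite -EFinM /expR_quot mulrCA.
  - move=> x _; rewrite lee_fin mulr_ge0//.
    have : 0 <= b n * Y x by rewrite mulr_ge0// ltW.
    by move=> /onem_expRN_itv/andP[].
  - apply/measurable_EFinP/measurable_funM => //; apply: measurable_funB => //.
    by apply: measurableT_comp => //; apply: measurableT_comp => //; exact: measurable_funM.
have A := @cvg_integral_expR_quot _ _ m1 _ _ mW W0 mX X0.
have B := @cvg_integral_expR_quot _ _ m2 _ _ mw w0 my y0.
(* Dominated convergence; the dominating function is the integrand at [b = 1], whose integral [D 1]
   is finite. *)
have Dcvg : D (b n) @[n --> \oo] --> (0 : R).
  suff : (\int[m2]_s (w s * (1 - expR (- (b n * y s))))%:E)%E @[n --> \oo] --> 0%E.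
    by under eq_fun do rewrite HD//; move=> /fine_cvgP[].
  rewrite -[X in _ --> X](@integral0 _ _ _ m2 setT).
  apply: (@dominated_cvg _ _ _ _ _ _ _ _ (fun s => (w s * (1 - expR (- (1 * y s))))%:E)) => //.
  - move=> n; apply/measurable_EFinP/measurable_funM => //; apply: measurable_funB => //.
    by apply: measurableT_comp => //; apply: measurableT_comp => //; exact: measurable_funM.
  - move=> s _; apply: cvg_EFin; first by near=> n.
    rewrite -[X in _ --> X](mulr0 (w s)); apply: cvgM; first exact: cvg_cst.
    rewrite -[X in _ --> X](@subrr R 1); apply: cvgB; first exact: cvg_cst.
    rewrite -[X in _ --> X](@expR0 R); apply: continuous_cvg; first exact: continuous_expR.
    rewrite -[X in _ --> X](@oppr0 R); apply: cvgN.
    rewrite -[X in _ --> X](mul0r (y s)); apply: cvgM; last exact: cvg_cst.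
    rewrite /b; have -> : (fun n => (2 ^+ n : R)^-1) = geometric 1 (2^-1).
      by apply/funext => n; rewrite /= mul1r exprVn.
    by apply: cvg_geometric; rewrite ger0_norm ?invr_ge0// invf_lt1// ltr1n.
  - apply: ge0_integrable.
    + apply/measurable_funM => //; apply: measurable_funB => //.
      by apply: measurableT_comp => //; apply: measurableT_comp => //; exact: measurable_funM.
    + move=> s; rewrite mulr_ge0// mul1r.
      by have /andP[] := onem_expRN_itv (y0 s).
    + by rewrite HD// ltry.
  - move=> n s _ /=; rewrite lee_fin ger0_norm.
      rewrite ler_wpM2l// lerD2l lerN2 ler_expR lerN2 ler_wpM2r//.
      by rewrite invf_le1 ?exprn_gt0// exprn_ege1// ler1n.
    rewrite mulr_ge0//.
    have : 0 <= b n * y s by rewrite mulr_ge0// ltW.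
    by move=> /onem_expRN_itv/andP[].
have eD : ((expR (- D (b n)))%:E) @[n --> \oo] --> 1%E.
  apply: cvg_EFin; first by near=> n.
  rewrite -[X in _ --> X](@expR0 R); apply: continuous_cvg; first exact: continuous_expR.
  by rewrite -[X in _ --> X](@oppr0 R); apply: cvgN.
have cB : (c%:E * \int[m2]_s (w s * expR_quot n (y s))%:E)%E @[n --> \oo] -->
          (c%:E * \int[m2]_s (w s * y s)%:E)%E.
  exact: cvgeZl.
have cBe : (c%:E * \int[m2]_s (w s * expR_quot n (y s))%:E *
           (expR (- D (b n)))%:E)%E @[n --> \oo] -->
          (c%:E * \int[m2]_s (w s * y s)%:E)%E.
  rewrite -[X in _ --> X]mule1; apply: cvgeM => //.
  by rewrite mule_defE onee_eq0/= andbF.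
have E1 n : (\int[m1]_x (W x * expR_quot n (X x))%:E =
    (c * (2 ^+ n * (1 - expR (- D (b n)))))%:E)%E.
  by rewrite scale// H// -EFinM; congr EFin; rewrite mulrCA.
have E2 n : (\int[m2]_x (w x * expR_quot n (y x))%:E = (2 ^+ n * D (b n))%:E)%E.
  by rewrite scale// HD.
apply/eqP; rewrite eq_le; apply/andP; split.
- rewrite -(cvg_lim _ A)// -(cvg_lim _ cB)//; apply: lee_lim.
  + by apply/cvg_ex; exists (\int[m1]_x (W x * X x)%:E)%E.
  + by apply/cvg_ex; exists (c%:E * \int[m2]_s (w s * y s)%:E)%E.
  + near=> n; rewrite E1 E2 -EFinM lee_fin ler_wpM2l// ler_wpM2l ?exprn_ge0//.
    by have /andP[] := onem_expRN_bounds (D0 n).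
- rewrite -(cvg_lim _ A)// -(cvg_lim _ cBe)//; apply: lee_lim.
  + by apply/cvg_ex; exists (c%:E * \int[m2]_s (w s * y s)%:E)%E.
  + by apply/cvg_ex; exists (\int[m1]_x (W x * X x)%:E)%E.
  + near=> n; rewrite E1 E2 -!EFinM lee_fin -mulrA ler_wpM2l// -mulrA.
    rewrite ler_wpM2l ?exprn_ge0//.
    by have /andP[] := onem_expRN_bounds (D0 n).
Unshelve. all: by end_near. Qed.

End difference_quotient.

(** * Independence in terms of integrals *)

Section independence.
Context {R : realType} d (T : measurableType d) (P : probability T R).

(** Independence on rectangles identifies the law of the pair with the product of the laws; the rest
    is Tonelli. *)
Lemma integral_indep d1 d2 (S1 : measurableType d1) (S2 : measurableType d2)
    (X : T -> S1) (Y : T -> S2) (H : S1 * S2 -> \bar R) :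
  measurable_fun setT X -> measurable_fun setT Y ->
  (forall A B, measurable A -> measurable B ->
     P (X @^-1` A `&` Y @^-1` B) = P (X @^-1` A) * P (Y @^-1` B))%E ->
  measurable_fun setT H -> (forall z, 0 <= H z)%E ->
  (\int[P]_w H (X w, Y w) = \int[P]_w \int[P]_w' H (X w, Y w'))%E.
Proof.
move=> mX mY XY mH H0.
pose X' : {mfun T >-> S1} := HB.pack X (isMeasurableFun.Build _ _ _ _ X mX).
pose Y' : {mfun T >-> S2} := HB.pack Y (isMeasurableFun.Build _ _ _ _ Y mY).
have mZ : measurable_fun setT (fun w => (X w, Y w)) by exact: measurable_fun_pair.
pose Z' : {mfun T >-> (S1 * S2)%type} := HB.pack (fun w => (X w, Y w))
  (isMeasurableFun.Build _ _ _ _ (fun w => (X w, Y w)) mZ).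
have -> : (\int[P]_w H (X w, Y w) = \int[distribution P Z']_z H z)%E.
  by rewrite (@ge0_integral_pushforward _ _ _ _ _ Z').
have -> : (\int[distribution P Z']_z H z =
           \int[(distribution P X' \x distribution P Y')%E]_z H z)%E.
  apply: eq_measure_integral => A mA _; apply/esym/product_measure_unique => //.
rewrite fubini_tonelli1// /fubini_F.
rewrite (@ge0_integral_pushforward _ _ _ _ _ X')//; last 2 first.
- exact: (measurable_fun_fubini_tonelli_F (m2 := distribution P Y')).
- by move=> x _; exact: integral_ge0.
rewrite preimage_setT; apply: eq_integral => w _ /=.
rewrite (@ge0_integral_pushforward _ _ _ _ _ Y')//.
by apply: measurableT_comp => //; exact: measurable_pair1.
Qed.

Lemma integral_indepM d1 d2 (S1 : measurableType d1) (S2 : measurableType d2)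
    (X : T -> S1) (Y : T -> S2) (F : S1 -> R) (G : S2 -> R) :
  measurable_fun setT X -> measurable_fun setT Y ->
  (forall A B, measurable A -> measurable B ->
     P (X @^-1` A `&` Y @^-1` B) = P (X @^-1` A) * P (Y @^-1` B))%E ->
  measurable_fun setT F -> (forall z, 0 <= F z) ->
  measurable_fun setT G -> (forall z, 0 <= G z) ->
  (\int[P]_w (F (X w) * G (Y w))%:E =
   (\int[P]_w (F (X w))%:E) * \int[P]_w (G (Y w))%:E)%E.
Proof.
move=> mX mY XY mF F0 mG G0.
have := @integral_indep _ _ _ _ X Y (fun z => (F z.1 * G z.2)%:E) mX mY XY.
move=> -> /=; last 2 first.
- by apply/measurable_EFinP/measurable_funM; exact: measurableT_comp.
- by move=> z; rewrite lee_fin mulr_ge0.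
have mFX : measurable_fun setT (fun w => F (X w)) by exact: measurableT_comp.
have mGY : measurable_fun setT (fun w => G (Y w)) by exact: measurableT_comp.
transitivity (\int[P]_w ((F (X w))%:E * \int[P]_w' (G (Y w'))%:E))%E.
  apply: eq_integral => w _; rewrite -ge0_integralZl_EFin//.
  - by move=> x _; rewrite lee_fin.
  - exact/measurable_EFinP.
rewrite ge0_integralZr//.
- exact/measurable_EFinP.
- by move=> x _; rewrite lee_fin.
- by apply: integral_ge0 => x _; rewrite lee_fin.
Qed.

Lemma independent2P (G1 G2 : set (set T)) : G1 setT -> G2 setT ->
  independent2 P G1 G2 <->
  (forall A B, G1 A -> G2 B -> P (A `&` B) = P A * P B)%E.
Proof.
move=> G1T G2T; split=> [H A B GA GB|H J A GA].
  have := H [fset i in ord_enum 2]%fset (fun i => nth set0 [:: A; B] i).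
  rewrite big_uniq ?fset_uniq//=.
  under eq_bigl do rewrite in_fset mem_ord_enum/=.
  rewrite big_ord_recl big_ord1/= => <-.
    congr (P _); apply/seteqP; split=> [w [Aw Bw] [[|[|//]] ?] _//|w AB].
    by split; [have := AB ord0|have := AB (lift ord0 ord0)];
      apply; rewrite /= in_fset mem_ord_enum.
  by move=> [[|[|//]] ?] _.
(* Indices outside [J] get the whole space, whose factor [1] turns the product over two indices into
   the product over [J]. *)
pose A' i := if i \in J then A i else setT.
have -> : \bigcap_(i in [set` J]) A i = A' ord0 `&` A' (lift ord0 ord0).
  rewrite /A'; apply/seteqP; split=> [w AB|w [A0 A1] i /= iJ].
    by split; case: ifPn => // /AB.
  case: (unliftP ord0 i) iJ => [j|] ->.
    by rewrite (ord1 j) => iJ; rewrite iJ in A1.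
  by move=> iJ; rewrite iJ in A0.
rewrite H; last 2 first.
- by rewrite /A'; case: ifPn => // /GA.
- by rewrite /A'; case: ifPn => // /GA.
rewrite big_uniq ?fset_uniq//= big_mkcond/= big_ord_recl big_ord1/= /A'.
by congr (_ * _)%E; case: ifPn => // _; rewrite probability_setT.
Qed.

Lemma independent3E (G1 G2 G3 : set (set T)) A B C :
  independent3 P G1 G2 G3 -> G1 A -> G2 B -> G3 C ->
  P (A `&` B `&` C) = (P A * P B * P C)%E.
Proof.
move=> H GA GB GC.
have := H [fset i in ord_enum 3]%fset (fun i => nth set0 [:: A; B; C] i).
rewrite big_uniq ?fset_uniq//=.
under eq_bigl do rewrite in_fset mem_ord_enum/=.
rewrite !big_ord_recl big_ord0/= mule1 muleA => <-.
  congr (P _); apply/seteqP; split=> [w [[Aw Bw] Cw] [[|[|[|//]]] ?] _//|w AB].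
  by split; [split|]; [have := AB ord0|have := AB (lift ord0 ord0)|
    have := AB (lift ord0 (lift ord0 ord0))]; apply; rewrite /= in_fset mem_ord_enum.
by move=> [[|[|[|//]]] ?] _.
Qed.

(** Generating a sigma-algebra commutes with preimages, and [posp] is the identity on the values of
    [X]. *)
Lemma sigma_process_path_of (E : Type) (X : E -> T -> R) :
  (forall t w, 0 <= X t w) ->
  sigma_process X = preimage_set_system setT (path_of X) measurable.
Proof.
move=> X0; rewrite /measurable/= -g_sigma_preimageE; congr (<<s _ >>).
apply/seteqP; split=> [A [t _ [B mB <-]]|_ [_ [t [B [mB ->]]] <-]].
  exists [set y | B (y t)%:num]; first by exists t, B.
  by rewrite !setTI; apply/seteqP; split=> w /=; rewrite max_l.
exists t => //; exists B => //.
by rewrite !setTI; apply/seteqP; split=> w /=; rewrite max_l.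
Qed.

End independence.

Lemma indic_preimage (R : realType) (T U : Type) (f : T -> U) (A : set U) (x : T) :
  \1_(f @^-1` A) x = \1_A (f x) :> R.
Proof. by rewrite !indicE; congr (_%:R); apply/idP/idP; rewrite !inE. Qed.

Section bounded_expectation.
Context {R : realType} d (T : measurableType d) (P : probability T R).

Lemma expectationE (X : T -> R) : 'E_P[X]%E = (\int[P]_w (X w)%:E)%E.
Proof. by rewrite unlock. Qed.

Definition mean (X : T -> R) : R := fine (\int[P]_w (X w)%:E)%E.

Lemma mean_itv (X : T -> R) : measurable_fun setT X ->
  (forall w, 0 <= X w <= 1) -> (0 <= \int[P]_w (X w)%:E <= 1)%E.
Proof.
move=> mX X01; apply/andP; split.
  by apply: integral_ge0 => w _; rewrite lee_fin; have /andP[] := X01 w.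
have -> : (1 = \int[P]_w (cst 1 w))%E by rewrite integral_cst//= probability_setT mule1.
apply: ge0_le_integral => //.
- by move=> w _; rewrite lee_fin; have /andP[] := X01 w.
- exact/measurable_EFinP.
- by move=> w _; rewrite lee_fin; have /andP[] := X01 w.
Qed.

Lemma mean_fin (X : T -> R) : measurable_fun setT X ->
  (forall w, 0 <= X w <= 1) -> (\int[P]_w (X w)%:E)%E = (mean X)%:E.
Proof.
move=> mX X01; have /andP[h0 h1] := mean_itv mX X01.
by rewrite /mean fineK// ge0_fin_numE// (le_lt_trans h1)// ltry.
Qed.

Lemma mean_ge0 (X : T -> R) : (forall w, 0 <= X w) -> 0 <= mean X.
Proof. by move=> X0; rewrite fine_ge0// integral_ge0// => w _; rewrite lee_fin. Qed.

Lemma integral_gt0 (X : T -> R) : measurable_fun setT X ->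
  (forall w, 0 < X w) -> (0 < \int[P]_w (X w)%:E)%E.
Proof.
move=> mX X0; rewrite lt_neqAle; apply/andP; split; last first.
  by apply: integral_ge0 => w _; rewrite lee_fin ltW.
apply/eqP => I0.
have : (\int[P]_w `|(EFin \o X) w| = 0)%E.
  by rewrite I0; apply: eq_integral => w _; rewrite /= ger0_norm// ltW.
move/ae_eq_integral_abs => /(_ measurableT)[].
  exact/measurable_EFinP.
move=> N [mN N0 subN].
have : P setT = 0%E.
  apply/eqP; rewrite eq_le measure_ge0 andbT -N0 le_measure ?inE//.
  move=> w _; apply: subN => /= /(_ Logic.I) [] h.
  by have := X0 w; rewrite h ltxx.
by rewrite probability_setT => /eqP; rewrite onee_eq0.
Qed.

End bounded_expectation.

Section product_independence.
Context {R : realType} d (T : measurableType d) (P : probability T R).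
Variable X : nat -> T -> R.
Hypothesis mX : forall n, measurable_fun setT (X n).
Hypothesis iX : mutually_independent P (fun n => sigma_rv (X n)).

Lemma integral_indic_comp i (A : set R) : measurable A ->
  (\int[P]_w (\1_A (X i w))%:E = P (X i @^-1` A))%E.
Proof.
move=> mA; under eq_integral do rewrite -indic_preimage.
by rewrite integral_indic ?setIT// -[X in measurable X]setTI; exact: mX.
Qed.

Lemma independent_bigcap n (A : nat -> set R) : (forall i, measurable (A i)) ->
  P [set w | forall i, (i < n)%N -> A i (X i w)] =
  (\prod_(i < n) P (X i @^-1` A i))%E.
Proof.
move=> mA.
pose J := seq_fset tt (iota 0 n).
have JE i : (i \in J) = (i < n)%N by rewrite seq_fsetE mem_iota add0n.
have := @iX J (fun i => X i @^-1` A i).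
rewrite (perm_big _ (seq_fset_perm _ _)) undup_id ?iota_uniq//.
have -> : iota 0 n = index_iota 0 n by rewrite /index_iota subn0.
rewrite big_mkord => <-.
  congr (P _); apply/seteqP; split=> w H i.
    by rewrite /= JE => /H.
  by move=> ilt; apply: H; rewrite /= JE.
by move=> i _; exists (A i) => //; rewrite setTI.
Qed.

(** Interpolates between indicators ([k = 0], where the product formula is independence) and the
    functions [g] ([k = n]); the induction replaces one indicator at a time. *)
Let hyb k (g : nat -> R -> R) (A : nat -> set R) i : R -> R :=
  if (i < k)%N then g i else \1_(A i).

Lemma mean_prod_independent n (g : nat -> R -> R) :
  (forall i, measurable_fun setT (g i)) -> (forall i x, 0 <= g i x <= 1) ->
  mean P (fun w => \prod_(i < n) g i (X i w)) =
  \prod_(i < n) mean P (fun w => g i (X i w)).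
Proof.
move=> mg g01.
have mhyb k A i : (forall i, measurable (A i)) -> measurable_fun setT (hyb k g A i).
  by move=> mA; rewrite /hyb; case: ifP => // _; exact: measurable_indic.
have hyb01 k A i x : 0 <= hyb k g A i x <= 1.
  rewrite /hyb; case: ifP => // _; rewrite indicE; case: (_ \in _);
  by rewrite ?lexx ?ler01.
suff H k A : (forall i, measurable (A i)) ->
    mean P (fun w => \prod_(i < n) hyb k g A i (X i w)) =
    \prod_(i < n) mean P (fun w => hyb k g A i (X i w)).
  have := H n (fun=> setT) (fun=> measurableT).
  rewrite /hyb; under eq_fun do under eq_bigr do rewrite ltn_ord.
  by under [RHS]eq_bigr do rewrite ltn_ord.
elim: k A => [|k ih] A mA.
  rewrite /hyb/=.
  have prodE w : \prod_(i < n) \1_(A i) (X i w) =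
      \1_[set w | forall i, (i < n)%N -> A i (X i w)] w :> R.
    rewrite [RHS]indicE; case: (boolP (w \in mkset _)) => [|].
      rewrite inE/= => H; rewrite big1// => i _; rewrite indicE mem_set//.
      exact: H.
    rewrite notin_setE/= => /existsNP[i /not_implyP[ltin Ai]].
    by rewrite (bigD1 (Ordinal ltin))//= indicE memNset// mul0r.
  have -> : (fun w => \prod_(i < n) \1_(A i) (X i w)) =
            \1_[set w | forall i, (i < n)%N -> A i (X i w)] :> (T -> R).
    by apply/funext => w; rewrite prodE.
  have mP i : measurable (X i @^-1` A i) by rewrite -[X in measurable X]setTI; exact: mX.
  rewrite /mean integral_indic//; last first.
    rewrite (_ : mkset _ = \bigcap_(i < n) (X i @^-1` A i)).
      by apply: bigcap_measurableType => i _; exact: mP.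
    by apply/seteqP; split=> w /= H i; exact: H.
  rewrite setIT; transitivity (fine (\prod_(i < n) (fine (P (X i @^-1` A i)))%:E)%E).
    congr fine; apply: etrans (independent_bigcap n mA) _.
    by apply: eq_bigr => i _; rewrite fineK// fin_num_measure.
  rewrite prodEFin/=; apply: eq_bigr => i _.
  by rewrite integral_indic_comp.
have [nk|kn] := leqP n k.
  have e A' i : (i < n)%N -> hyb k.+1 g A' i = hyb k g A' i.
    by move=> ilt; rewrite /hyb !ifT// ?(leq_trans ilt)// ltnW// ltnS (leq_trans ilt).
  have := ih A mA; under eq_fun do under eq_bigr do rewrite -e//.
  by under [X in _ = X -> _]eq_bigr do rewrite -e//.
pose ok := Ordinal kn.
(* The set at index [k] is left free, so that the induction hypothesis becomes a statement about
   measures in [C]. *)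
pose B (C : set R) i := if i == k then C else A i.
have mB C : measurable C -> forall i, measurable (B C i).
  by move=> mC i; rewrite /B; case: ifP.
pose W w := \prod_(i < n | i != ok) hyb k.+1 g A i (X i w).
pose c := \prod_(i < n | i != ok) mean P (fun w => hyb k.+1 g A i (X i w)).
have hybB C (i : 'I_n) : i != ok -> hyb k g (B C) i = hyb k.+1 g A i.
  move=> ik; rewrite /hyb /B ltnS [(i <= k)%N]leq_eqVlt.
  have -> : (i == k :> nat) = false.
    by apply: contraNF ik => /eqP ik; apply/eqP/val_inj.
  by [].
have hybk C : hyb k g (B C) k = \1_C by rewrite /hyb /B ltnn eqxx.
have W01 w : 0 <= W w <= 1.
  rewrite /W; elim/big_rec: _ => [|i x _ /andP[x0 x1]]; first by rewrite lexx ler01.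
  have /andP[h0 h1] := hyb01 k.+1 A i (X i w).
  by rewrite mulr_ge0//= mulr_ile1.
have mW : measurable_fun setT W.
  rewrite /W; under eq_fun do rewrite -big_filter.
  by apply: measurable_prod => i _; apply: measurableT_comp => //; exact: mhyb.
have c0 : 0 <= c.
  apply: prodr_ge0 => i _; apply: mean_ge0 => w.
  by have /andP[] := hyb01 k.+1 A i (X i w).
have mean_hyb i : (\int[P]_w (hyb k.+1 g A i (X i w))%:E =
                   (mean P (fun w => hyb k.+1 g A i (X i w)))%:E)%E.
  by apply: mean_fin => // ; apply: measurableT_comp => //; exact: mhyb.
(* As [C] varies, this says that the image of [W dP] under [X k] is [c] times the law of [X k];
   integrating [g k] against both is the induction step. *)
have key C : measurable C ->
    (\int[P]_w (W w * \1_C (X k w))%:E = c%:E * P (X k @^-1` C))%E.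
  move=> mC; have := ih _ (mB C mC).
  rewrite (bigD1 ok)//= hybk.
  have -> : \prod_(i < n | i != ok) mean P (fun w => hyb k g (B C) i (X i w)) = c.
    by apply: eq_bigr => i ik; rewrite hybB.
  have -> : (fun w => \prod_(i < n) hyb k g (B C) i (X i w)) =
            (fun w => W w * \1_C (X k w)).
    apply/funext => w; rewrite (bigD1 ok)//= hybk mulrC; congr (_ * _).
    by apply: eq_bigr => i ik; rewrite hybB.
  have -> : mean P (fun w => \1_C (X k w)) = fine (P (X k @^-1` C)).
    by rewrite /mean integral_indic_comp.
  move=> E; rewrite mean_fin; last 2 first.
  - by apply: measurable_funM => //; exact: (measurableT_comp (measurable_indic mC) (mX k)).
  - move=> w; have /andP[w0 w1] := W01 w; rewrite indicE.
    by case: (_ \in _); rewrite ?mulr1 ?mulr0 ?w0// lexx ler01.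
  rewrite E mulrC EFinM fineK// fin_num_measure//.
  by rewrite -[X in measurable X]setTI; exact: mX.
have -> : (fun w => \prod_(i < n) hyb k.+1 g A i (X i w)) =
          (fun w => W w * g k (X k w)).
  apply/funext => w; rewrite (bigD1 ok)//= mulrC; congr (_ * _).
  by rewrite /hyb ltnSn.
rewrite (bigD1 ok)//= -/c.
have -> : hyb k.+1 g A k = g k by rewrite /hyb ltnSn.
have gP : (\int[P]_w (W w * g k (X k w))%:E = \int[P]_w (c * g k (X k w))%:E)%E.
  under eq_integral do rewrite EFinM.
  under [RHS]eq_integral do rewrite EFinM.
  apply: (@weighted_integral_eq _ _ _ _ _ _ _ P P W (fun=> c) (X k) (X k)
    _ _ _ _ _ _ _ (EFin \o g k)) => //.
  - by move=> w; have /andP[] := W01 w.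
  - move=> C mC; rewrite key//.
    under [RHS]eq_integral do rewrite EFinM.
    rewrite ge0_integralZl_EFin ?integral_indic_comp//.
    by apply/measurable_EFinP; exact: (measurableT_comp (measurable_indic mC) (mX k)).
  - exact/measurable_EFinP.
  - by move=> x; rewrite lee_fin; have /andP[] := g01 k x.
have mgX : measurable_fun setT (fun w => g k (X k w)) by exact: measurableT_comp.
rewrite {1}/mean gP; under eq_integral do rewrite EFinM.
rewrite ge0_integralZl_EFin//.
- rewrite (mean_fin _ mgX)//.
  by rewrite -EFinM/= mulrC.
- by move=> w _; rewrite lee_fin; have /andP[] := g01 k (X k w).
- exact/measurable_EFinP.
Qed.

End product_independence.

(** * The Laplace exponent of a subordinator *)

Section monotone_additive.
Context {R : realType}.

(** If [m <= nt < m + 1], both [n g(t)] and [n t g(1)] lie between [m g(1)] and [(m + 1) g(1)], so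
    they differ by at most [g(1)] for every [n]. *)
Lemma monotone_additive_linear (g : R -> R) :
  (forall s t, 0 <= s -> 0 <= t -> g (s + t) = g s + g t) ->
  (forall s t, 0 <= s -> s <= t -> g s <= g t) ->
  forall t, 0 <= t -> g t = t * g 1.
Proof.
move=> gD gm t t0.
have g0 : g 0 = 0 by have := gD 0 0 (lexx _) (lexx _); rewrite addr0; lra.
have gn n s : 0 <= s -> g (n%:R * s) = n%:R * g s.
  move=> s0; elim: n => [|n ih]; first by rewrite !mul0r g0.
  by rewrite -natr1 mulrDl mul1r gD ?mulr_ge0// ih mulrDl mul1r.
have g10 : 0 <= g 1 by rewrite -g0 gm.
have bnd n : n%:R * `|g t - t * g 1| <= g 1.
  have nt0 : 0 <= n%:R * t by rewrite mulr_ge0.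
  have /andP[m1 m2] := truncn_itv nt0.
  set m := Num.truncn _ in m1 m2.
  have h1 : m%:R * g 1 <= n%:R * g t by rewrite -!gn// gm// ?mulr1.
  have h2 : n%:R * g t <= (m.+1)%:R * g 1 by rewrite -!gn// gm// ?mulr1// ltW.
  have h3 : m%:R * g 1 <= n%:R * t * g 1 by rewrite ler_wpM2r.
  have h4 : n%:R * t * g 1 <= m.+1%:R * g 1 by rewrite ler_wpM2r// ltW.
  rewrite -[n%:R]ger0_norm// -normrM mulrBr mulrA.
  move: h2 h4; rewrite -natr1 mulrDl mul1r => h2 h4.
  by rewrite ler_norml; apply/andP; split; lra.
apply/eqP; rewrite -subr_eq0 -normr_eq0; apply/eqP.
apply/eqP; rewrite eq_le normr_ge0 andbT leNgt; apply/negP => e0.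
have := bnd (Num.truncn (g 1 / `|g t - t * g 1|)).+1.
apply/negP; rewrite -ltNge -ltr_pdivrMr//.
exact: truncnS_gt.
Qed.

End monotone_additive.

Section subordinator_laplace.
Context {R : realType} d (T : measurableType d) (P : probability T R).
Variables (Z : subordinator P).

Let nng0 : {nonneg R} := 0%:nng.
Let nng1 : {nonneg R} := 1%:nng.

Lemma sub_ge0 t w : 0 <= Z t w.
Proof.
by rewrite -(sub_start Z w); apply: sub_nondecreasing => /=.
Qed.

Lemma sub_incr_ge0 (s t : {nonneg R}) w : s%:num <= t%:num -> 0 <= Z t w - Z s w.
Proof. by move=> st; rewrite subr_ge0 sub_nondecreasing. Qed.

Lemma measurable_expRN (X : T -> R) (c : R) : measurable_fun setT X ->
  measurable_fun setT (fun w => expR (- (c * X w))).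
Proof.
by move=> mX; apply: measurableT_comp => //; apply: measurableT_comp => //;
  exact: measurable_funM.
Qed.

Lemma mean_sub_stationary (s t h : {nonneg R}) (c : R) : 0 <= c ->
  t%:num = s%:num + h%:num ->
  mean P (fun w => expR (- (c * (Z t w - Z s w)))) =
  mean P (fun w => expR (- (c * Z h w))).
Proof.
move=> c0 tsh; have mZ := sub_measurable Z.
have mI : measurable_fun setT (fun w => Z t w - Z s w) by exact: measurable_funB.
rewrite /mean; congr fine.
transitivity (\int[P]_w ((cst 1 w : R)%:E * (expR (- (c * (Z t w - Z s w))))%:E))%E.
  by apply: eq_integral => w _; rewrite mul1e.
transitivity (\int[P]_w ((cst 1 w : R)%:E * (expR (- (c * Z h w)))%:E))%E; last first.
  by apply: eq_integral => w _; rewrite mul1e.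
apply: (@weighted_integral_eq _ _ _ _ _ _ _ P P (cst 1) (cst 1)
  (fun w => Z t w - Z s w) (Z h) _ _ _ _ _ _ _ (fun x => (expR (- (c * x)))%:E)) => //.
- move=> A mA; under eq_integral do rewrite mul1r -indic_preimage.
  under [RHS]eq_integral do rewrite mul1r -indic_preimage.
  have m1 : measurable ((fun w => Z t w - Z s w) @^-1` A).
    by rewrite -[X in measurable X]setTI; exact: mI.
  have m2 : measurable (Z h @^-1` A).
    by rewrite -[X in measurable X]setTI; exact: mZ.
  rewrite !integral_indic// !setIT; exact: sub_stationary.
- apply/measurable_EFinP; apply: measurableT_comp => //.
  by apply: measurableT_comp => //; exact: measurable_funM.
Qed.

Lemma mean_sub_step (t : nat -> {nonneg R}) (c : nat -> R) n :
  (forall i, (t i)%:num <= (t i.+1)%:num) -> (forall i, 0 <= c i) ->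
  mean P (fun w => expR (- \sum_(i < n) c i * (Z (t i.+1) w - Z (t i) w))) =
  \prod_(i < n) mean P (fun w => expR (- (c i * (Z (t i.+1) w - Z (t i) w)))).
Proof.
move=> nt c0; have mZ := sub_measurable Z.
pose X i w := Z (t i.+1) w - Z (t i) w.
(* The product formula needs functions with values in [[0, 1]] on the whole line; the positive part
   is the identity on increments. *)
pose g i x := expR (- (c i * Num.max x 0)).
have gX i w : expR (- (c i * (Z (t i.+1) w - Z (t i) w))) = g i (X i w).
  by rewrite /g max_l// sub_incr_ge0.
have -> : (fun w => expR (- \sum_(i < n) c i * (Z (t i.+1) w - Z (t i) w))) =
          (fun w => \prod_(i < n) g i (X i w)).
  by apply/funext => w; rewrite -sumrN expR_sum; apply: eq_bigr => i _; rewrite gX.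
rewrite mean_prod_independent.
- by apply: eq_bigr => i _; congr (mean _ _); apply/funext => w; rewrite gX.
- by move=> i; exact: measurable_funB.
- exact: sub_independent.
- move=> i; apply: measurableT_comp => //; apply: measurableT_comp => //.
  by apply: measurable_funM => //; exact: measurable_maxr.
- by move=> i x; apply: expRN_le1; rewrite mulr_ge0// le_max lexx orbT.
Qed.

Lemma mean_subD (s t : {nonneg R}) (c : R) : 0 <= c ->
  mean P (fun w => expR (- (c * Z (posp (s%:num + t%:num)) w))) =
  mean P (fun w => expR (- (c * Z s w))) * mean P (fun w => expR (- (c * Z t w))).
Proof.
move=> c0; pose u := posp (s%:num + t%:num).
have uE : u%:num = s%:num + t%:num by rewrite posp_num ?addr_ge0.
(* The grid [0, s, s + t], constant afterwards. *)
pose tt (i : nat) : {nonneg R} := if i is i'.+1 then if i' is 0 then s else u else nng0.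
have := @mean_sub_step tt (fun=> c) 2.
rewrite big_ord_recl big_ord1/= /bump/=.
have -> : (fun w => expR (- \sum_(i < 2) c * (Z (tt i.+1) w - Z (tt i) w))) =
          (fun w => expR (- (c * Z u w))).
  apply/funext => w; rewrite big_ord_recl big_ord1 /= /bump/= [Z nng0 w]sub_start; congr expR; ring.
have -> : (fun w => expR (- (c * (Z s w - Z nng0 w)))) =
          (fun w => expR (- (c * Z s w))).
  by apply/funext => w; rewrite [Z nng0 w]sub_start subr0.
move=> ->.
- by congr (_ * _); apply: mean_sub_stationary.
- move=> [|[|i]]; rewrite /tt; [exact: ge0| |exact: lexx].
  by rewrite uE lerDl ge0.
- by move=> _; exact: c0.
Qed.

Definition lexp (c : R) : R := - ln (mean P (fun w => expR (- (c * Z 1%:nng w)))).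

Lemma mean_sub_gt0 (c : R) t : 0 <= c -> 0 < mean P (fun w => expR (- (c * Z t w))).
Proof.
move=> c0; have mZ := sub_measurable Z.
rewrite -lte_fin -mean_fin.
- by apply: integral_gt0; [exact: measurable_expRN|move=> w; exact: expR_gt0].
- exact: measurable_expRN.
- by move=> w; rewrite expRN_le1// mulr_ge0// sub_ge0.
Qed.

(** By independence and stationarity of increments, [s |-> - ln E e^{-c Z_s}] is additive;
    monotonicity of the paths makes it monotone, hence linear. *)
Lemma mean_subE (c : R) (t : {nonneg R}) : 0 <= c ->
  mean P (fun w => expR (- (c * Z t w))) = expR (- (t%:num * lexp c)).
Proof.
move=> c0; have mZ := sub_measurable Z.
pose g s := - ln (mean P (fun w => expR (- (c * Z (posp s) w)))).
have pospE (s : {nonneg R}) : posp s%:num = s by apply/val_inj; rewrite /= max_l.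
have gE : g t%:num = t%:num * g 1.
  apply: (@monotone_additive_linear R g); last exact: ge0.
  - move=> a b a0 b0; have mab := mean_subD (posp a) (posp b) c0.
    have pab : posp (a + b) = posp ((posp a)%:num + (posp b)%:num).
      by rewrite !posp_num.
    rewrite /g pab mab lnM ?posrE ?mean_sub_gt0 ?opprD//.
  - move=> a b a0 ab; rewrite lerN2 ler_ln ?posrE ?mean_sub_gt0//.
    rewrite -lee_fin -!mean_fin.
    + apply: ge0_le_integral => //.
      * by apply/measurable_EFinP/measurable_expRN.
      * by apply/measurable_EFinP/measurable_expRN.
      * move=> w _; rewrite lee_fin ler_expR lerN2 ler_wpM2l// sub_nondecreasing//=.
        by rewrite ge_max !le_max ab lexx orbT.
    + exact: measurable_expRN.
    + by move=> w; rewrite expRN_le1// mulr_ge0// sub_ge0.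
    + exact: measurable_expRN.
    + by move=> w; rewrite expRN_le1// mulr_ge0// sub_ge0.
have -> : lexp c = g 1.
  rewrite /lexp /g; congr (- ln (mean _ _)); apply/funext => w.
  by congr (expR (- (_ * Z _ w))); apply/val_inj; rewrite /= max_l.
rewrite -gE /g opprK pospE lnK// posrE; exact: mean_sub_gt0.
Qed.

Section levy.
Variables (kappa : R) (rho : {measure set (measurableTypeR R) -> \bar R}).
Hypotheses (kappa_gt0 : 0 < kappa) (kappaE : 'E_P[Z (1%:nng)%R]%E = kappa%:E).
Hypothesis rhoE : driftless_levy_measure P (Z 1%:nng) rho.

(** The Laplace transform of a finite variable is positive, and [expeR (- +oo)] is [0]; so the
    integral is finite and the logarithm can be taken. *)
Lemma lexpE (c : R) : 0 <= c ->
  (\int[rho]_(x in `]0%R, +oo[) (1 - expR (- (c * x)))%:E = (lexp c)%:E)%E.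
Proof.
move=> c0; have [_ /(_ c c0)] := rhoE; rewrite expectationE mean_fin; last 2 first.
- exact/measurable_expRN/sub_measurable.
- by move=> w; rewrite expRN_le1// mulr_ge0// sub_ge0.
have I0 : (0 <= \int[rho]_(x in `]0%R, +oo[) (1 - expR (- (c * x)))%:E)%E.
  apply: integral_ge0 => x /=; rewrite in_itv/= andbT => x0; rewrite lee_fin.
  by have /andP[] : 0 <= 1 - expR (- (c * x)) <= 1 by rewrite onem_expRN_itv// mulr_ge0// ltW.
rewrite /lexp; have := mean_sub_gt0 nng1 c0.
case: (\int[rho]_(x in _) _)%E I0 => [r| |]//= r0 m0.
- by move=> [->]; rewrite expRK opprK.
- move=> [m00]; move: m0; by rewrite m00 ltxx.
Qed.

(* x^+ 1_{x > 0} rather than x, so that the weights are nonnegative everywhere *)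
Let y (x : R) : R := Num.max x 0.
Let w (c : R) (x : R) : R := c * \1_(`]0%R, +oo[ : set R) x.

Let y0 x : 0 <= y x.
Proof. by rewrite /y le_max lexx orbT. Qed.

Let my : measurable_fun [set: R] y.
Proof. exact: measurable_maxr. Qed.

Let mw c : measurable_fun [set: R] (w c).
Proof. by apply: measurable_funM => //; exact: measurable_indic. Qed.

(** The derivative at [0] of [b |-> E e^{-b Z_t}], as an identity in the extended reals; the value
    [kappa] of the integral is deduced from it at [t = 1]. *)
Lemma mean_sub_linear (t : {nonneg R}) :
  (\int[P]_w (Z t w)%:E = t%:num%:E * \int[rho]_(x in `]0%R, +oo[) x%:E)%E.
Proof.
have mZ := sub_measurable Z.
have wE (G : R -> R) : measurable_fun setT G -> (forall x, 0 < x -> 0 <= G x) ->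
    (\int[rho]_x (w t%:num x * G (y x))%:E =
     t%:num%:E * \int[rho]_(x in `]0%R, +oo[) (G x)%:E)%E.
  move=> mG G0; rewrite -ge0_integralZl_EFin//; last 2 first.
  - by move=> x /=; rewrite in_itv/= andbT => /G0; rewrite lee_fin.
  - by apply/measurable_EFinP; exact: measurable_funTS.
  rewrite [RHS]integral_mkcond; apply: eq_integral => x _.
  rewrite /w /y /patch indicE; case: ifPn => [|_]; last by rewrite mulr0 mul0r.
  rewrite inE/= in_itv/= andbT => x0.
  by rewrite mulr1 max_l ?ltW.
have := @laplace_derivative R _ _ T (measurableTypeR R) P rho (cst 1) (Z t) (w t%:num) y 1
  (fun b => t%:num * lexp b).
under eq_integral do rewrite mul1r.
move=> ->; rewrite ?mul1e.
- by rewrite (wE id)// => x x0; exact: ltW.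
- by [].
- by [].
- exact: mZ.
- by move=> x; exact: sub_ge0.
- exact: mw.
- by move=> x; rewrite /w mulr_ge0.
- exact: my.
- exact: y0.
- by [].
- move=> b b0; rewrite (wE (fun x => 1 - expR (- (b * x)))).
  + by rewrite lexpE ?ltW.
  + apply: measurable_funB => //; apply: measurableT_comp => //.
    by apply: measurableT_comp => //; exact: measurable_funM.
  + move=> x x0; have : 0 <= b * x by rewrite mulr_ge0 ?ltW.
    by move=> /onem_expRN_itv/andP[].
- move=> b b0; have b0' := ltW b0.
  rewrite mul1r -mean_subE//.
  have bZ om : 0 <= b * Z t om by rewrite mulr_ge0// sub_ge0.
  under eq_integral do rewrite mul1r.
  have int1 : (\int[P]_w (1 : R)%:E = 1)%E.
    apply: etrans (integral_cst P measurableT 1%E) _.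
    by rewrite /= probability_setT mule1.
  have i1 : P.-integrable setT (EFin \o (fun om => expR (- (b * Z t om)))).
    apply: ge0_integrable; first exact: measurable_expRN.
      by move=> x; exact: expR_ge0.
    rewrite mean_fin ?ltry//; first exact: measurable_expRN.
    by move=> x; exact: expRN_le1.
  under eq_integral do rewrite EFinB.
  rewrite integralB_EFin//; last first.
    by apply: (@ge0_integrable _ _ _ _ (cst 1)) => //; rewrite int1 ltry.
  rewrite int1 mean_fin ?EFinB//.
    exact: measurable_expRN.
  by move=> x; exact: expRN_le1.
Qed.

Lemma levy_mean : (\int[rho]_(x in `]0%R, +oo[) x%:E = kappa%:E)%E.
Proof.
by have := mean_sub_linear nng1; rewrite mul1e -expectationE kappaE.
Qed.

Lemma mean_subK (t : {nonneg R}) : (\int[P]_w (Z t w)%:E = (kappa * t%:num)%:E)%E.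
Proof. by rewrite mean_sub_linear levy_mean -EFinM mulrC. Qed.

Lemma lexp0 : lexp 0 = 0.
Proof.
apply: EFin_inj; rewrite -lexpE// integral0_eq// => x _.
by rewrite mul0r oppr0 expR0 subrr.
Qed.

Lemma measurable_onem_expR (c : R) (D : set R) :
  measurable_fun D (fun x => (1 - expR (- (c * x)))%:E).
Proof.
apply: measurable_funTS; apply/measurable_EFinP; apply: measurable_funB => //.
by apply: measurableT_comp => //; apply: measurableT_comp => //; exact: measurable_funM.
Qed.

Lemma lexp_nd (a b : R) : 0 <= a -> a <= b -> lexp a <= lexp b.
Proof.
move=> a0 ab; have b0 := le_trans a0 ab; suff : (\int[rho]_(x in `]0%R, +oo[) (1 - expR (- (a * x)))%:E <=
        \int[rho]_(x in `]0%R, +oo[) (1 - expR (- (b * x)))%:E)%E.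
  by rewrite (lexpE a0) (lexpE b0) lee_fin.
apply: ge0_le_integral => //.
- move=> x /=; rewrite in_itv/= andbT => x0; rewrite lee_fin.
  by have /andP[] : 0 <= 1 - expR (- (a * x)) <= 1 by rewrite onem_expRN_itv// mulr_ge0// ltW.
- exact: measurable_onem_expR.
- exact: measurable_onem_expR.
- move=> x /=; rewrite in_itv/= andbT => x0.
  by rewrite lee_fin lerD2l lerN2 ler_expR lerN2 ler_wpM2r// ltW.
Qed.

Lemma lexp_ge0 (a : R) : 0 <= a -> 0 <= lexp a.
Proof. by move=> a0; rewrite -lexp0 lexp_nd. Qed.

(** Pointwise, [e^{-ax} - e^{-bx} <= (b - a) x], and the mean of [rho] is [kappa]. *)
Lemma lexp_lipschitz (a b : R) : 0 <= a -> a <= b ->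
  lexp b <= lexp a + kappa * (b - a).
Proof.
move=> a0 ab; have b0 := le_trans a0 ab.
suff : (\int[rho]_(x in `]0%R, +oo[) (1 - expR (- (b * x)))%:E <=
        \int[rho]_(x in `]0%R, +oo[) (1 - expR (- (a * x)))%:E +
        (b - a)%:E * \int[rho]_(x in `]0%R, +oo[) x%:E)%E.
  by rewrite (lexpE a0) (lexpE b0) levy_mean -EFinM -EFinD lee_fin mulrC.
rewrite -ge0_integralZl_EFin ?subr_ge0//; last first.
- by move=> x /=; rewrite in_itv/= andbT => x0; rewrite lee_fin ltW.
have ge (c x : R) : 0 <= c -> `]0%R, +oo[%classic x -> (0 <= (1 - expR (- (c * x)))%:E)%E.
  rewrite /= in_itv/= andbT => c0 x0; rewrite lee_fin.
  by have /andP[] : 0 <= 1 - expR (- (c * x)) <= 1 by rewrite onem_expRN_itv// mulr_ge0// ltW.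
have mb : measurable_fun (`]0%R, +oo[%classic : set R) (fun x : R => ((b - a)%:E * x%:E)%E).
  by apply: measurable_funTS; apply/measurable_EFinP; exact: measurable_funM.
have b1 (x : R) : `]0%R, +oo[%classic x -> (0 <= (b - a)%:E * x%:E)%E.
  by rewrite /= in_itv/= andbT => x0; rewrite lee_fin mulr_ge0 ?subr_ge0// ltW.
rewrite -ge0_integralD//; last 2 first.
- by move=> x; exact: ge.
- exact: measurable_onem_expR.
apply: ge0_le_integral => //.
- by move=> x; exact: ge.
- exact: measurable_onem_expR.
- by apply: emeasurable_funD => //; exact: measurable_onem_expR.
move=> x /=; rewrite in_itv/= andbT => x0; rewrite -EFinM -EFinD lee_fin.
have c0 : 0 <= (b - a) * x by rewrite mulr_ge0 ?subr_ge0// ltW.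
have /andP[_ h] := onem_expRN_bounds c0.
have /andP[_ ea] : 0 <= expR (- (a * x)) <= 1 by rewrite expRN_le1// mulr_ge0// ltW.
have -> : - (b * x) = - (a * x) + - ((b - a) * x) by ring.
rewrite expRD.
have /andP[u0 _] := onem_expRN_itv c0.
have : expR (- (a * x)) * (1 - expR (- ((b - a) * x))) <= 1 - expR (- ((b - a) * x)).
  by rewrite ler_piMl.
lra.
Qed.

Lemma lexp_dist (a b : R) : 0 <= a -> 0 <= b -> `|lexp a - lexp b| <= kappa * `|a - b|.
Proof.
wlog ab : a b / a <= b => [H a0 b0|a0 b0].
  have [ab|/ltW ba] := leP a b; first exact: H.
  by rewrite distrC [X in _ * X]distrC H.
rewrite distrC [X in _ * X]distrC !ger0_norm ?subr_ge0 ?lexp_nd//.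
by rewrite lerBlDl; exact: lexp_lipschitz.
Qed.

End levy.

End subordinator_laplace.

(** * Integrals against a subordinator *)

Section stieltjes_kernel.
Context {R : realType} d (T : measurableType d) (P : probability T R).
Variable Z : subordinator P.

Definition lsm (w : T) : {measure set (measurableTypeR R) -> \bar R} :=
  lebesgue_stieltjes_measure (ext_path Z w).

Lemma lsm_oc w (a b : R) : a <= b ->
  lsm w `]a, b]%classic = (ext_path Z w b - ext_path Z w a)%:E.
Proof.
move=> ab; rewrite /lsm/= /lebesgue_stieltjes_measure/= /measure_extension/=.
rewrite measurable_mu_extE; last exact: is_ocitv.
by rewrite /= wlength_itv_bnd.
Qed.

Lemma measurable_ext_path (s : R) : measurable_fun setT (fun w => ext_path Z w s).
Proof. exact: sub_measurable. Qed.

Let I (n : nat) : set (measurableTypeR R) := `](- n%:R), n%:R]%classic.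

Let nI (n : nat) : - n%:R <= n%:R :> R.
Proof. by have : 0 <= n%:R :> R by []; lra. Qed.

Let mI n : measurable (I n). Proof. exact: measurable_itv. Qed.

Let ndI : nondecreasing_seq I.
Proof.
apply/nondecreasing_seqP => n; apply/subsetPset => x; rewrite /I /= !in_itv/=.
move=> /andP[xn nx]; rewrite -natr1; apply/andP; split; first by lra.
by lra.
Qed.

Let bigcupI : \bigcup_n I n = setT.
Proof.
apply/seteqP; split=> // x _; exists (Num.truncn `|x|).+1 => //.
have := truncnS_gt `|x|; rewrite /I /= in_itv/= ltr_norml => /andP[h1 h2].
by rewrite h1 ltW.
Qed.

Let ocitvE : @measurable _ (measurableTypeR R) = <<s @ocitv R >>.
Proof. by []. Qed.

Let ocitv_setI : setI_closed (@ocitv R).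
Proof. exact: ocitvI. Qed.

Let lsm_fin w n (A : set (measurableTypeR R)) : measurable A -> lsm w (A `&` I n) \is a fin_num.
Proof.
move=> mA; rewrite ge0_fin_numE//; apply: (@le_lt_trans _ _ (lsm w (I n))).
  apply: le_measure; rewrite ?inE; [exact: (measurableI _ _ mA (mI n))|exact: mI|by []].
by rewrite /I (lsm_oc _ (nI n)) ltry.
Qed.

Let measurable_lsm_oc (A : set (measurableTypeR R)) : ocitv A -> measurable_fun setT (lsm ^~ A).
Proof.
move=> /ocitvP[->|[[a b] /= ab ->]].
  by under eq_fun do rewrite measure0; exact: measurable_cst.
under eq_fun do rewrite lsm_oc ?ltW//.
by apply/measurable_EFinP/measurable_funB; exact: measurable_ext_path.
Qed.

(** Dynkin induction from half-open intervals, whose mass is an increment of the path. The window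
    [I n] has finite mass, which the subtraction for complements requires; it is removed in
    [measurable_lsm] by a monotone limit. *)
Let measurable_lsmI n (A : set (measurableTypeR R)) : measurable A ->
  measurable_fun setT (fun w => lsm w (A `&` I n)).
Proof.
rewrite ocitvE; move: A; apply: (@dynkin_induction _ (measurableTypeR R) (@ocitv R)
  (fun A => measurable_fun setT (fun w => lsm w (A `&` I n)))) => //.
- under eq_fun do rewrite setTI; exact: measurable_lsm_oc (is_ocitv _ _).
- move=> A oA; apply: measurable_lsm_oc; apply: ocitv_setI => //; exact: is_ocitv.
- move=> A mA mlA.
  have -> : (fun w => lsm w (~` A `&` I n)) =
            (fun w => lsm w (I n) - lsm w (A `&` I n))%E.
    apply/funext => w; rewrite setIC -setDE measureD//.
      by rewrite [in RHS]setIC.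
    by rewrite -[I n]setTI -ge0_fin_numE// lsm_fin//; exact: measurableT.
  apply: emeasurable_funB => //; exact: measurable_lsm_oc (is_ocitv _ _).
- move=> F mF tF mlF.
  have -> : (fun w => lsm w (\bigcup_k F k `&` I n)) =
            (fun w => \sum_(k <oo) lsm w (F k `&` I n))%E.
    apply/funext => w; rewrite setI_bigcupl measure_semi_bigcup//.
    + by move=> k; apply: (measurableI _ _ _ (mI n)).
    + exact: trivIset_setIr.
    + by apply: bigcup_measurable => k _; apply: (measurableI _ _ _ (mI n)).
  by apply: ge0_emeasurable_sum => // k w _ _; exact: measure_ge0.
Qed.

Lemma measurable_lsm (A : set (measurableTypeR R)) : measurable A -> measurable_fun setT (lsm ^~ A).
Proof.
move=> mA.
apply: (@emeasurable_fun_cvg _ _ _ _ (fun n w => lsm w (A `&` I n))).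
  by move=> n; exact: measurable_lsmI.
move=> w _.
have -> : lsm w A = lsm w (\bigcup_n (A `&` I n)).
  by rewrite -setI_bigcupr bigcupI setIT.
apply: nondecreasing_cvg_mu.
- by move=> n; apply: (measurableI _ _ _ (mI n)).
- by apply: bigcup_measurable => n _; apply: (measurableI _ _ _ (mI n)).
- by move=> m n mn; apply/subsetPset; apply: setIS; apply/subsetPset; exact: ndI.
Qed.

Lemma measurable_lsm_integral (h : R -> \bar R) : measurable_fun setT h ->
  (forall s, 0 <= h s)%E -> measurable_fun setT (fun w => \int[lsm w]_s h s)%E.
Proof.
move=> mh h0; apply: measurable_fun_integral_kernel => // U mU.
exact: measurable_lsm.
Qed.

(** * Campbell's formula for the mean of a Stieltjes integral *)

Section campbell.
Variables (kappa : R) (rho : {measure set (measurableTypeR R) -> \bar R}).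
Hypotheses (kappa_gt0 : 0 < kappa) (kappaE : 'E_P[Z (1%:nng)%R]%E = kappa%:E).
Hypothesis rhoE : driftless_levy_measure P (Z 1%:nng) rho.

Let mean_ext (s : R) : (\int[P]_w (ext_path Z w s)%:E = (kappa * Num.max s 0)%:E)%E.
Proof. by rewrite (mean_subK kappaE rhoE). Qed.

Let lebesgue_pos (a b : R) : a <= b ->
  lebesgue_measure (`]a, b]%classic `&` `[0%R, +oo[%classic : set R) =
  (Num.max b 0 - Num.max a 0)%:E.
Proof.
move=> ab; have [b0|b0] := ltP b 0.
  rewrite (_ : _ `&` _ = set0).
    by rewrite measure0 max_r ?subrr// ltW// (le_lt_trans ab).
  apply/seteqP; split=> // x /=; rewrite !in_itv/= andbT => -[/andP[_ xb] x0].
  by have := lt_le_trans b0 (le_trans x0 xb); rewrite ltxx.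
have [a0|a0] := ltP a 0.
  rewrite (_ : _ `&` _ = `[0, b]%classic).
    rewrite lebesgue_measure_itv/= lte_fin subr0; case: (ltP 0 b) => [_|b0'].
      by rewrite ?oppr0 ?adde0 ?addr0.
    by congr EFin; apply: le_anti; rewrite b0 b0'.
  apply/seteqP; split=> x /=; rewrite !in_itv/= andbT.
    by move=> [/andP[_ ->] ->].
  by move=> /andP[x0 ->]; rewrite x0 (lt_le_trans a0 x0).
rewrite (_ : _ `&` _ = `]a, b]%classic).
  rewrite lebesgue_measure_itv/= lte_fin; case: (ltP a b) => [//|ba].
  by congr EFin; apply/esym/eqP; rewrite subr_eq0; apply/eqP/le_anti; rewrite ab ba.
apply/seteqP; split=> x /=; rewrite !in_itv/= andbT.
  by move=> [].
by move=> /andP[ax ->]; rewrite ax/= (le_trans a0 (ltW ax)).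
Qed.

(** The mean of the random measures [lsm w] and [kappa] times Lebesgue measure on the half-line
    agree on half-open intervals, because [E Z_s = kappa s] and the path is extended by [0] to
    negative times. The windows [I n] have finite mass for both. *)
Lemma campbell_mean (h : R -> \bar R) : measurable_fun setT h ->
  (forall s, 0 <= h s)%E ->
  (\int[P]_w \int[lsm w]_s h s =
   kappa%:E * \int[lebesgue_measure]_(s in `[0%R, +oo[) h s)%E.
Proof.
move=> mh h0.
have [mu1 [mu1E mu1I]] := @mixture_measure _ _ T (measurableTypeR R) R P (cst 1) lsm
  (@measurable_cst _ _ _ _ _ _) (fun=> ler01) measurable_lsm.
pose W (s : R) : R := kappa * \1_(`[0%R, +oo[%classic : set R) s.
have mW : measurable_fun setT W by apply: measurable_funM => //; exact: measurable_indic.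
have W0 s : 0 <= W s by rewrite /W mulr_ge0// ltW.
have [mu2 [mu2E mu2I]] := @weighted_image _ _ (measurableTypeR R) (measurableTypeR R) R
  lebesgue_measure W id mW W0 (@measurable_id _ _ _).
transitivity (\int[mu1]_s h s)%E.
  by rewrite mu1I//; apply: eq_integral => w _; rewrite mul1e.
transitivity (\int[mu2]_s h s)%E; last first.
  rewrite mu2I// -ge0_integralZl_EFin ?ltW//; last exact: measurable_funTS.
  rewrite [RHS]integral_mkcond; apply: eq_integral => s _.
  rewrite /W /patch indicE; case: ifPn => _; rewrite ?mulr1//.
  by rewrite mulr0 mul0e.
apply: eq_measure_integral => A mA _.
have mu12 (a b : R) : a <= b -> mu1 `]a, b]%classic = mu2 `]a, b]%classic.
  move=> ab; rewrite mu1E ?mu2E//.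
  transitivity (kappa * (Num.max b 0 - Num.max a 0))%:E.
    under eq_integral do rewrite mul1e lsm_oc// EFinB.
    rewrite integralB_EFin//.
    - by rewrite !mean_ext -EFinB mulrBr.
    - apply: ge0_integrable; [exact: measurable_ext_path|move=> w; exact: sub_ge0|].
      by rewrite mean_ext ltry.
    - apply: ge0_integrable; [exact: measurable_ext_path|move=> w; exact: sub_ge0|].
      by rewrite mean_ext ltry.
  rewrite EFinM -(lebesgue_pos ab) preimage_id.
  under [RHS]eq_integral do rewrite /W EFinM.
  rewrite ge0_integralZl_EFin ?ltW//; last first.
    by apply/measurable_funTS/measurable_EFinP; exact: measurable_indic.
  rewrite integral_indic// 1?setIC//.
apply: (@measure_unique _ R (measurableTypeR R) (@ocitv R) I ocitvE ocitv_setI) => //.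
- by move=> n; exact: is_ocitv.
- by move=> B /ocitvP[->|[[a b] /= ab ->]]; [rewrite !measure0|rewrite mu12// ltW].
- move=> n; have n0 := nI n.
  rewrite mu1E//; under eq_integral do rewrite mul1e lsm_oc//.
  apply: (@le_lt_trans _ _ (\int[P]_w (ext_path Z w n%:R)%:E)%E); last by rewrite mean_ext ltry.
  apply: ge0_le_integral => //.
  + by move=> w _; rewrite lee_fin subr_ge0 ext_path_nd.
  + by apply/measurable_EFinP/measurable_funB; exact: measurable_ext_path.
  + by apply/measurable_EFinP; exact: measurable_ext_path.
  + by move=> w _; rewrite lee_fin lerBlDr lerDl; exact: sub_ge0.
Qed.

End campbell.

End stieltjes_kernel.

Section laplace_functional.
Context {R : realType} d (T : measurableType d) (P : probability T R).
Variable Z : subordinator P.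
Variables (kappa : R) (rho : {measure set (measurableTypeR R) -> \bar R}).
Hypotheses (kappa_gt0 : 0 < kappa) (kappaE : 'E_P[Z (1%:nng)%R]%E = kappa%:E).
Hypothesis rhoE : driftless_levy_measure P (Z 1%:nng) rho.

Local Notation lam := (@lebesgue_measure R).
Local Notation J h w := (\int[lsm Z w]_s (h s)%:E)%E.

(** The random measure does not charge negative times. Vanishing there lets Campbell's formula be
    written with integrals over the whole line. *)
Record testfun (h : R -> R) : Prop := TestFun {
  testfun_measurable : measurable_fun setT h ;
  testfun_ge0 : forall s, 0 <= h s ;
  testfun_neg : forall s, s < 0 -> h s = 0 ;
  testfun_fin : (\int[lam]_s (h s)%:E < +oo)%E }.

(** Where the integral is infinite, [fine] makes the exponential equal to [1] instead of [0]. For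
    test functions this event is null, by [J_fin_ae]. *)
Definition sub_laplace (h : R -> R) : R :=
  mean P (fun w => expR (- fine (J h w))).

Definition sub_exponent (h : R -> R) : R := fine (\int[lam]_s (lexp Z (h s))%:E)%E.

Lemma campbell_testfun (h : R -> R) : measurable_fun setT h -> (forall s, 0 <= h s) ->
  (forall s, s < 0 -> h s = 0) ->
  (\int[P]_w J h w = kappa%:E * \int[lam]_s (h s)%:E)%E.
Proof.
move=> mh h0 hneg; rewrite (campbell_mean kappa_gt0 kappaE rhoE)//; last exact/measurable_EFinP.
congr (_ * _)%E; rewrite integral_mkcond; apply: eq_integral => s _.
rewrite /patch; case: ifPn => //; rewrite notin_setE/= in_itv/= andbT => /negP.
by rewrite -ltNge => /hneg ->.
Qed.

Lemma measurable_J (h : R -> R) : measurable_fun setT h -> (forall s, 0 <= h s) ->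
  measurable_fun setT (fun w => J h w).
Proof.
move=> mh h0; apply: measurable_lsm_integral; first exact/measurable_EFinP.
by move=> s; rewrite lee_fin.
Qed.

Lemma J_ge0 (h : R -> R) w : (forall s, 0 <= h s) -> (0 <= J h w)%E.
Proof. by move=> h0; apply: integral_ge0 => s _; rewrite lee_fin. Qed.

Lemma measurable_expJ (h : R -> R) : measurable_fun setT h -> (forall s, 0 <= h s) ->
  measurable_fun setT (fun w => expR (- fine (J h w))).
Proof.
move=> mh h0; apply: measurableT_comp => //; apply: measurableT_comp => //.
exact: measurableT_comp (measurable_J mh h0).
Qed.

Lemma expJ_itv (h : R -> R) w : (forall s, 0 <= h s) ->
  0 <= expR (- fine (J h w)) <= 1.
Proof. by move=> h0; rewrite expRN_le1// fine_ge0// J_ge0. Qed.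

Lemma expRN_dist (x y : R) : 0 <= x -> 0 <= y -> `|expR (- x) - expR (- y)| <= `|x - y|.
Proof.
wlog xy : x y / x <= y => [H x0 y0|x0 y0].
  have [xy|/ltW yx] := leP x y; first exact: H.
  by rewrite distrC [X in _ <= X]distrC H.
rewrite ger0_norm ?subr_ge0 ?ler_expR ?lerN2//.
rewrite distrC ger0_norm ?subr_ge0//.
have yx0 : 0 <= y - x by rewrite subr_ge0.
have /andP[_ h1] := onem_expRN_bounds yx0.
have /andP[h2 _] := onem_expRN_itv yx0.
have /andP[_ h3] := expRN_le1 x0.
have -> : - y = - x + - (y - x) by ring.
rewrite expRD -[X in X - _]mulr1 -mulrBr; apply: le_trans h1.
by rewrite ler_piMl.
Qed.

Lemma expJ_dist (h g : R -> R) w : measurable_fun setT h -> measurable_fun setT g ->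
  (forall s, 0 <= h s) -> (forall s, 0 <= g s) ->
  ((`|expR (- fine (J h w)) - expR (- fine (J g w))|)%:E <= J (fun s => `|h s - g s|) w)%E.
Proof.
move=> mh mg h0 g0.
have md : measurable_fun setT (fun s => `|h s - g s|).
  by apply: measurableT_comp => //; exact: measurable_funB.
have mE (k : R -> R) : measurable_fun setT k ->
    @measurable_fun _ _ (measurableTypeR R) _ setT (fun s => (k s)%:E).
  by move=> mk; apply/measurable_EFinP.
have dom (a b : R -> R) : measurable_fun setT a -> measurable_fun setT b ->
    (forall s, 0 <= a s) -> (forall s, 0 <= b s) ->
    (J a w <= J b w + J (fun s => `|a s - b s|) w)%E.
  move=> ma mb a0 b0.
  have mab : measurable_fun setT (fun s => `|a s - b s|).
    by apply: measurableT_comp => //; exact: measurable_funB.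
  rewrite -ge0_integralD//; last 3 first.
  - by move=> s _; rewrite lee_fin.
  - exact: mE.
  - exact: (mE (fun s => `|a s - b s|)).
  apply: ge0_le_integral => //.
  - by move=> s _; rewrite lee_fin.
  - exact: (mE a).
  - by apply: (mE (b \+ (fun s => `|a s - b s|))); exact: measurable_funD.
  - by move=> s _; rewrite -EFinD lee_fin -lerBlDl ler_norm.
have hg := dom _ _ mh mg h0 g0; have gh := dom _ _ mg mh g0 h0.
have ed : J (fun s => `|g s - h s|) w = J (fun s => `|h s - g s|) w.
  by apply: eq_integral => s _; rewrite distrC.
rewrite ed in gh.
have := J_ge0 w h0; have := J_ge0 w g0.
have := @J_ge0 (fun s => `|h s - g s|) w (fun s => normr_ge0 _).
move: hg gh.
case: (J h w) => [x| |]; case: (J g w) => [y| |];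
  case: (J (fun s => `|h s - g s|) w) => [z| |] //=.
- rewrite -!EFinD !lee_fin => h1 h2 _ y0 x0.
  apply: le_trans (expRN_dist x0 y0) _.
  by rewrite ler_norml; apply/andP; split; lra.
(* An infinite value occurs: either the right-hand side is infinite, or both integrals are, and then
   [fine] sends both to [0] and the difference vanishes. *)
all: by move=> *; rewrite ?leey ?subrr ?normr0.
Qed.

(** The pathwise bound [expJ_dist] is integrated with Campbell's formula. Its counterpart
    [sub_exponent_dist] has the same constant, by the Lipschitz bound on [lexp]. *)
Lemma sub_laplace_dist (h g : R -> R) : testfun h -> testfun g ->
  ((`|sub_laplace h - sub_laplace g|)%:E <= kappa%:E * \int[lam]_s (`|h s - g s|)%:E)%E.
Proof.
move=> [mh h0 hn _] [mg g0 gn _].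
have md : measurable_fun setT (fun s => `|h s - g s|).
  by apply: measurableT_comp => //; exact: measurable_funB.
rewrite -campbell_testfun//; last first.
  by move=> s s0; rewrite hn// gn// subrr normr0.
have ie (k : R -> R) : measurable_fun setT k -> (forall s, 0 <= k s) ->
    P.-integrable setT (EFin \o (fun w => expR (- fine (J k w)))).
  move=> mk k0; apply: ge0_integrable; first exact: measurable_expJ.
    by move=> w; exact: expR_ge0.
  rewrite mean_fin ?ltry//; first exact: measurable_expJ.
  by move=> w; exact: expJ_itv.
have -> : (`|sub_laplace h - sub_laplace g|%:E =
    `| \int[P]_w ((expR (- fine (J h w)))%:E - (expR (- fine (J g w)))%:E)|)%E.
  rewrite integralB_EFin//; try exact: ie.
  by rewrite !mean_fin//; do ?[exact: measurable_expJ|move=> w; exact: expJ_itv].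
apply: le_trans (le_abse_integral _ _ _) _ => //.
  by apply/measurable_EFinP/measurable_funB; exact: measurable_expJ.
apply: ge0_le_integral => //.
- by apply: measurableT_comp => //; apply/measurable_EFinP/measurable_funB;
    exact: measurable_expJ.
- exact: measurable_J.
- by move=> w _; rewrite -EFinB abse_EFin; exact: expJ_dist.
Qed.

Lemma measurable_lexp (h : R -> R) : measurable_fun setT h -> (forall s, 0 <= h s) ->
  measurable_fun setT (fun s => lexp Z (h s)).
Proof.
move=> mh h0.
have -> : (fun s => lexp Z (h s)) = (fun x => lexp Z (Num.max x 0)) \o h.
  by apply/funext => s /=; rewrite max_l.
apply: measurableT_comp => //.
apply: nondecreasing_measurable; first exact: measurableT.
move=> x y xy; apply: (lexp_nd rhoE); first by rewrite le_max lexx orbT.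
by rewrite ge_max !le_max xy lexx orbT.
Qed.

Lemma sub_exponent_fin (h : R -> R) : testfun h ->
  (\int[lam]_s (lexp Z (h s))%:E)%E = (sub_exponent h)%:E.
Proof.
move=> [mh h0 hn hfin]; rewrite /sub_exponent fineK// ge0_fin_numE; last first.
  by apply: integral_ge0 => s _; rewrite lee_fin (lexp_ge0 rhoE).
apply: (@le_lt_trans _ _ (kappa%:E * \int[lam]_s (h s)%:E)%E); last first.
  by rewrite lte_mul_pinfty// lee_fin ltW.
rewrite -ge0_integralZl_EFin ?(ltW kappa_gt0)//; [|by move=> s _; rewrite lee_fin|exact/measurable_EFinP].
apply: ge0_le_integral => //.
- by move=> s _; rewrite lee_fin (lexp_ge0 rhoE).
- by apply/measurable_EFinP; exact: measurable_lexp.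
- by apply/measurable_EFinP; exact: measurable_funM.
- move=> s _; rewrite -EFinM lee_fin.
  have := lexp_lipschitz kappaE rhoE (lexx 0) (h0 s).
  by rewrite (lexp0 rhoE) add0r subr0.
Qed.

Lemma sub_exponent_dist (h g : R -> R) : testfun h -> testfun g ->
  ((`|expR (- sub_exponent h) - expR (- sub_exponent g)|)%:E <=
   kappa%:E * \int[lam]_s (`|h s - g s|)%:E)%E.
Proof.
move=> th tg; have [mh h0 hn hfin] := th; have [mg g0 gn gfin] := tg.
have e0 k : testfun k -> 0 <= sub_exponent k.
  move=> tk; apply: fine_ge0; apply: integral_ge0 => s _; rewrite lee_fin.
  by apply: (lexp_ge0 rhoE); exact: testfun_ge0.
apply: (@le_trans _ _ (`|sub_exponent h - sub_exponent g|%:E)%E).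
  by rewrite lee_fin; apply: expRN_dist; exact: e0.
have ie k : testfun k -> lam.-integrable setT (EFin \o (fun s => lexp Z (k s))).
  move=> tk; apply: ge0_integrable.
  - by apply: measurable_lexp; [exact: testfun_measurable|exact: testfun_ge0].
  - by move=> s; rewrite (lexp_ge0 rhoE)//; exact: testfun_ge0.
  - by rewrite sub_exponent_fin// ltry.
have -> : (`|sub_exponent h - sub_exponent g|%:E =
    `| \int[lam]_s ((lexp Z (h s))%:E - (lexp Z (g s))%:E)|)%E.
  rewrite integralB_EFin//; try exact: ie.
  transitivity (`|(sub_exponent h)%:E - (sub_exponent g)%:E|)%E; first by [].
  by congr (`| _ - _ |)%E; apply/esym; apply: sub_exponent_fin.
apply: le_trans (le_abse_integral _ _ _) _ => //.
  by apply/measurable_EFinP/measurable_funB; exact: measurable_lexp.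
have md : measurable_fun setT (fun s => `|h s - g s|).
  by apply: measurableT_comp => //; exact: measurable_funB.
rewrite -ge0_integralZl_EFin ?(ltW kappa_gt0)//; last exact/measurable_EFinP.
apply: ge0_le_integral => //.
- by apply: measurableT_comp => //; apply/measurable_EFinP/measurable_funB;
    exact: measurable_lexp.
- by apply/measurable_EFinP; exact: measurable_funM.
- move=> s _; rewrite -EFinB abse_EFin -EFinM lee_fin.
  exact: (lexp_dist kappaE rhoE).
Qed.

(** Both members are Lipschitz with constant [kappa] in L1, so the identity passes to L1 limits; an
    error [e / (2 kappa)] costs [e / 2] on each side. *)
Lemma sub_laplace_closed (h : R -> R) : testfun h ->
  (forall e : R, 0 < e -> exists g, [/\ testfun g,
     (\int[lam]_s (`|h s - g s|)%:E <= e%:E)%E & sub_laplace g = expR (- sub_exponent g)]) ->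
  sub_laplace h = expR (- sub_exponent h).
Proof.
move=> th H; apply/eqP; rewrite -subr_eq0 -normr_eq0; apply/eqP/le_anti.
rewrite normr_ge0 andbT; apply/ler_addgt0Pr => e e0; rewrite add0r.
have e'0 : 0 < e / (2 * kappa) by rewrite divr_gt0// mulr_gt0.
have [g [tg hg gE]] := H _ e'0.
have b (x : R) : (x%:E <= kappa%:E * \int[lam]_s (`|h s - g s|)%:E)%E -> x <= e / 2.
  move=> xb; rewrite -lee_fin; apply: le_trans xb _.
  have -> : ((e / 2)%:E = kappa%:E * (e / (2 * kappa))%:E)%E.
    by rewrite -EFinM; congr EFin; field; rewrite gt_eqF.
  by rewrite lee_pmul2l// lte_fin.
have h1 := b _ (sub_laplace_dist th tg).
have h2 := b _ (sub_exponent_dist th tg).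
rewrite gE in h1.
have split (x y z : R) : `|x - z| <= e / 2 -> `|y - z| <= e / 2 -> `|x - y| <= e.
  move=> xz yz; have -> : x - y = (x - z) - (y - z) by ring.
  by apply: le_trans (ler_normB _ _) _; lra.
exact: split h1 h2.
Qed.

End laplace_functional.

(** * Step functions on a regular grid *)

Section step_functions.
Context {R : realType}.
Variables (e : R) (N : nat).
Hypothesis e0 : 0 < e.

(** Open on the left, so that the Stieltjes measure of a cell is the increment between its
    endpoints. *)
Definition cell (i : nat) : set R := `](i%:R * e), (i.+1%:R * e)]%classic.

Definition stepf (c : nat -> R) (s : R) : R := \sum_(i < N) c i * \1_(cell i) s.

Lemma cell_le i : i%:R * e <= i.+1%:R * e.
Proof. by rewrite ler_pM2r// ler_nat. Qed.

Lemma cell_inj i j s : cell i s -> cell j s -> i = j.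
Proof.
have H a b : cell a s -> cell b s -> (a <= b)%N.
  rewrite /cell /= !in_itv/= => /andP[h1 _] /andP[_ h2].
  by have := lt_le_trans h1 h2; rewrite ltr_pM2r// ltr_nat ltnS.
by move=> si sj; apply/eqP; rewrite eqn_leq H// H.
Qed.

Lemma stepf_cell c i s : (i < N)%N -> cell i s -> stepf c s = c i.
Proof.
move=> iN si; rewrite /stepf (bigD1 (Ordinal iN))//= big1 ?addr0.
  by rewrite indicE mem_set// mulr1.
move=> j ji; rewrite indicE memNset ?mulr0// => sj.
by move/eqP: ji; apply; apply: val_inj => /=; exact: cell_inj sj si.
Qed.

Lemma stepf_out c s : (forall i, (i < N)%N -> ~ cell i s) -> stepf c s = 0.
Proof.
by move=> H; rewrite /stepf big1// => i _; rewrite indicE memNset ?mulr0//; exact: H.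
Qed.

Lemma stepf_comp c (phi : R -> R) s : phi 0 = 0 -> phi (stepf c s) = stepf (phi \o c) s.
Proof.
move=> phi0; have [[i [iN si]]|H] := pselect (exists i, (i < N)%N /\ cell i s).
  by rewrite !(stepf_cell _ iN si).
by rewrite !stepf_out// => i iN si; apply: H; exists i.
Qed.

Lemma measurable_stepf c : measurable_fun setT (stepf c).
Proof.
apply: measurable_sum => i; apply: measurable_funM => //.
by apply: measurable_indic; exact: measurable_itv.
Qed.

Lemma stepf_ge0 c s : (forall i, 0 <= c i) -> 0 <= stepf c s.
Proof. by move=> c0; apply: sumr_ge0 => i _; rewrite mulr_ge0. Qed.

Lemma integral_stepf (m : {measure set (measurableTypeR R) -> \bar R}) c :
  (forall i, 0 <= c i) ->
  (\int[m]_s (stepf c s)%:E = \sum_(i < N) (c i)%:E * m (cell i))%E.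
Proof.
move=> c0; have mi i : measurable_fun (setT : set (measurableTypeR R))
    (fun s => (\1_(cell i) s : R)%:E).
  by apply/measurable_EFinP; apply: measurable_indic; exact: measurable_itv.
rewrite /stepf; under eq_integral do rewrite -sumEFin.
rewrite ge0_integral_sum//; last 2 first.
- move=> i; under eq_fun do rewrite EFinM.
  by apply: emeasurable_funM => //; exact: measurable_cst.
- by move=> i s _; rewrite lee_fin mulr_ge0.
apply: eq_bigr => i _; under eq_integral do rewrite EFinM.
rewrite ge0_integralZl_EFin// ?integral_indic ?setIT//.
exact: measurable_itv.
Qed.

Lemma cell_exists s : 0 < s -> s <= N%:R * e -> exists2 i, (i < N)%N & cell i s.
Proof.
move=> s0; elim: N => [|n ih].
  by rewrite mul0r => /(lt_le_trans s0); rewrite ltxx.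
have [sn|ns] := leP s (n%:R * e).
  by move=> _; have [i iN si] := ih sn; exists i => //; exact: ltnW.
by move=> sn; exists n => //; rewrite /cell /= in_itv/= ns.
Qed.

Lemma cell_sub i s : (i < N)%N -> cell i s -> 0 < s <= N%:R * e.
Proof.
rewrite /cell /= in_itv/= => iN /andP[h1 h2]; apply/andP; split.
  by apply: le_lt_trans h1; rewrite mulr_ge0// ltW.
by apply: le_trans h2 _; rewrite ler_pM2r// ler_nat.
Qed.

End step_functions.

Section laplace_functional2.
Context {R : realType} d (T : measurableType d) (P : probability T R).
Variable Z : subordinator P.
Variables (kappa : R) (rho : {measure set (measurableTypeR R) -> \bar R}).
Hypotheses (kappa_gt0 : 0 < kappa) (kappaE : 'E_P[Z (1%:nng)%R]%E = kappa%:E).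
Hypothesis rhoE : driftless_levy_measure P (Z 1%:nng) rho.

Local Notation lam := (@lebesgue_measure R).

Lemma lebesgue_cell (e : R) i : 0 < e -> lam (cell e i) = e%:E.
Proof.
move=> e0; rewrite lebesgue_measure_itv/= lte_fin ltr_pM2r// ltr_nat ltnSn.
by congr EFin; rewrite -natr1; ring.
Qed.

Lemma lebesgue_stepf (e : R) N c : 0 < e -> (forall i, 0 <= c i) ->
  (\int[lam]_s (stepf e N c s)%:E = (\sum_(i < N) c i * e)%:E)%E.
Proof.
move=> e0 c0; rewrite integral_stepf// -sumEFin; apply: eq_bigr => i _.
by rewrite EFinM; congr (_ * _)%E; exact: lebesgue_cell.
Qed.

Lemma testfun_stepf (e : R) N c : 0 < e -> (forall i, 0 <= c i) -> testfun (stepf e N c).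
Proof.
move=> e0 c0; split.
- exact: measurable_stepf.
- by move=> s; exact: stepf_ge0.
- move=> s s0; apply: stepf_out => i iN /(cell_sub e0 iN)/andP[s0' _].
  by have := lt_trans s0 s0'; rewrite ltxx.
- by rewrite lebesgue_stepf// ltry.
Qed.

Lemma sub_laplace_stepf (e : R) N c : 0 < e -> (forall i, 0 <= c i) ->
  sub_laplace Z (stepf e N c) = expR (- sub_exponent Z (stepf e N c)).
Proof.
move=> e0 c0.
pose t i : {nonneg R} := posp (i%:R * e).
have tE i : (t i)%:num = i%:R * e by rewrite posp_num// mulr_ge0// ltW.
have -> : sub_laplace Z (stepf e N c) =
    mean P (fun w => expR (- \sum_(i < N) c i * (Z (t i.+1) w - Z (t i) w))).
  rewrite /sub_laplace; congr (mean P _); apply/funext => w; congr (expR (- _)).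
  rewrite integral_stepf//.
  rewrite (eq_bigr (fun i : 'I_N => (c i * (Z (t i.+1) w - Z (t i) w))%:E)).
    by rewrite sumEFin.
  by move=> i _; rewrite EFinM; congr (_ * _)%E; apply: lsm_oc; exact: cell_le.
rewrite mean_sub_step//; last by move=> i; rewrite !tE; exact: cell_le.
pose et : {nonneg R} := posp e.
have etE : et%:num = e by rewrite posp_num ?ltW.
have stepE i : mean P (fun w => expR (- (c i * (Z (t i.+1) w - Z (t i) w)))) =
    expR (- (e * lexp Z (c i))).
  rewrite (mean_sub_stationary Z (c0 i) (s := t i) (h := et)); last first.
    by rewrite !tE etE -natr1; ring.
  by rewrite mean_subE// etE.
rewrite (eq_bigr (fun i : 'I_N => expR (- (e * lexp Z (c i))))); last first.
  by move=> i _; exact: stepE.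
rewrite -expR_sum sumrN; congr (expR (- _)).
rewrite /sub_exponent.
have lE s : lexp Z (stepf e N c s) = stepf e N (lexp Z \o c) s.
  by apply: stepf_comp => //; exact: (lexp0 rhoE).
under eq_integral do rewrite lE.
rewrite lebesgue_stepf//; last by move=> i; apply: (lexp_ge0 rhoE).
by apply: eq_bigr => i _; rewrite mulrC.
Qed.

(** Approximation by the values of [h] at the left endpoints of [n + 1] cells covering []0, K]]: it
    converges pointwise by continuity, and the error is dominated by the maximum of [h] on [[0, K]],
    hence convergence in L1. *)
Lemma sub_laplace_continuous (K : R) (h : R -> R) : 0 < K -> continuous h ->
  (forall s, 0 <= h s) ->
  sub_laplace Z (fun s => h s * \1_(`]0%R, K]%classic : set R) s) =
  expR (- sub_exponent Z (fun s => h s * \1_(`]0%R, K]%classic : set R) s)).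
Proof.
move=> K0 ch h0; set hK := fun s => _.
have [c cK hB] := EVT_max (ltW K0) (continuous_subspaceT ch).
pose B := h c.
have B0 : 0 <= B by exact: h0.
have mh : measurable_fun setT h by exact: continuous_measurable_fun.
have m1 : measurable_fun setT (\1_(`]0%R, K]%classic : set R) : R -> R).
  by apply: measurable_indic; exact: measurable_itv.
have mhK : measurable_fun setT hK by exact: measurable_funM.
have hK_in s : 0 < s <= K -> hK s = h s.
  by move=> sK; rewrite /hK indicE mem_set ?mulr1//= in_itv.
have hK_out s : ~~ (0 < s <= K) -> hK s = 0.
  by move=> sK; rewrite /hK indicE memNset ?mulr0//= in_itv/=; apply/negP.
have dom (s : R) : 0 <= hK s <= B * \1_(`]0%R, K]%classic : set R) s.
  rewrite /hK mulr_ge0//= indicE; case: (boolP (s \in _)) => [|_]; last by rewrite !mulr0.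
  rewrite inE/= in_itv/= => /andP[s0 sK]; rewrite !mulr1; apply: hB.
  by rewrite in_itv/= (ltW s0).
have Bfin : (\int[lam]_s (B * \1_(`]0%R, K]%classic : set R) s)%:E < +oo)%E.
  under eq_integral do rewrite EFinM.
  rewrite ge0_integralZl_EFin//; last by apply/measurable_EFinP.
  rewrite integral_indic// setIT /= lebesgue_measure_itv/= lte_fin K0 -EFinB -EFinM.
  exact: ltry.
have thK : testfun hK.
  split => //.
  - by move=> s; have /andP[] := dom s.
  - move=> s s0; apply: hK_out; apply/negP => /andP[s0' _].
    by have := lt_trans s0 s0'; rewrite ltxx.
  - apply: le_lt_trans Bfin; apply: ge0_le_integral => //.
    + by move=> s _; rewrite lee_fin; have /andP[] := dom s.
    + exact/measurable_EFinP.
    + by apply/measurable_EFinP; exact: measurable_funM.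
    + by move=> s _; rewrite lee_fin; have /andP[] := dom s.
pose e n : R := K / n.+1%:R.
have e0 n : 0 < e n by rewrite divr_gt0.
have NeK n : n.+1%:R * e n = K by rewrite mulrC divfK.
pose g n := stepf (e n) n.+1 (fun i => h (i%:R * e n)).
have g_in n s : 0 < s <= K -> exists2 p, g n s = h p & 0 <= p <= K /\ `|p - s| <= e n.
  move=> /andP[s0 sK]; have [|i iN si] := @cell_exists _ (e n) n.+1 s s0.
    by rewrite NeK.
  exists (i%:R * e n); first by rewrite /g (stepf_cell (e0 n) _ iN si).
  move: si; rewrite /cell/= in_itv/= => /andP[h1 h2]; split.
    apply/andP; split; first by rewrite mulr_ge0// ltW.
    by apply: le_trans sK; exact: ltW.
  rewrite distrC ger0_norm ?subr_ge0 ?(ltW h1)//.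
  by move: h2; rewrite -natr1 mulrDl mul1r lerBlDl.
have g_out n s : ~~ (0 < s <= K) -> g n s = 0.
  move=> sK; apply: stepf_out => i iN /(cell_sub (e0 n) iN); rewrite NeK.
  by apply/negP.
have tg n : testfun (g n) by apply: testfun_stepf.
have dom2 n (s : R) : `|hK s - g n s| <= B * \1_(`]0%R, K]%classic : set R) s.
  rewrite indicE; case: (boolP (0 < s <= K)) => sK.
    rewrite mem_set ?mulr1//=.
    have [p gp [pK _]] := g_in n s sK; rewrite gp hK_in//.
    have hs : h s <= B by apply: hB; rewrite in_itv/=; case/andP: sK => /ltW -> ->.
    have hp : h p <= B by apply: hB; rewrite in_itv/=.
    have := h0 s; have := h0 p => ? ?.
    by rewrite ler_norml; apply/andP; split; lra.
  rewrite memNset/= ?in_itv/=; last by apply/negP.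
  by rewrite mulr0 hK_out// g_out// subrr normr0.
have cvg_pt (s : R) : `|hK s - g n s| @[n --> \oo] --> (0 : R).
  case: (boolP (0 < s <= K)) => sK; last first.
    under eq_fun do rewrite hK_out// g_out// subrr normr0.
    exact: cvg_cst.
  apply/cvgrPdist_lt => eps eps0.
  have /cvgrPdist_lt /(_ eps eps0) := ch s.
  rewrite near_simpl => -[eta /= eta0 H].
  have ce : e n @[n --> \oo] --> (0 : R).
    rewrite -[X in _ --> X](mulr0 K); apply: cvgM; first exact: cvg_cst.
    exact: cvg_harmonic.
  move/cvgrPdist_lt : ce => /(_ eta eta0) [M _ HM].
  exists M => // n Mn /=; rewrite sub0r normrN normr_id hK_in//.
  have [p -> [_ ps]] := g_in n s sK; apply: H => /=.
  rewrite distrC; apply: le_lt_trans ps _.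
  by have := HM n Mn; rewrite /= sub0r normrN ger0_norm// ltW.
have cvgI : (\int[lam]_s (`|hK s - g n s|)%:E)%E @[n --> \oo] --> 0%E.
  rewrite -[X in _ --> X](@integral0 _ _ _ lam setT).
  apply: (@dominated_cvg _ _ R lam setT measurableT
    (fun n s => (`|hK s - g n s|)%:E) (cst 0%E) (fun s => (B * \1_(`]0%R, K]%classic : set R) s)%:E)) => //.
  - move=> n; apply/measurable_EFinP; apply: measurableT_comp => //.
    by apply: measurable_funB => //; exact: testfun_measurable.
  - by move=> s _; apply: cvg_EFin; [near=> n|exact: cvg_pt].
  - apply: ge0_integrable => //; first exact: measurable_funM.
    by move=> s; rewrite mulr_ge0.
  - by move=> n s _ /=; rewrite lee_fin normr_id.
apply: (sub_laplace_closed kappa_gt0 kappaE rhoE thK) => eps eps0.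
have [n hn] : exists n, (\int[lam]_s (`|hK s - g n s|)%:E <= eps%:E)%E.
  have /fine_cvgP[[M1 _ F1] /cvgrPdist_le /(_ eps eps0) [M2 _ F2]] := cvgI.
  exists (maxn M1 M2); have f1 := F1 _ (leq_maxl M1 M2).
  have := F2 _ (leq_maxr M1 M2); rewrite /= sub0r normrN => f2.
  by rewrite -(fineK f1) lee_fin; apply: le_trans f2; exact: ler_norm.
exists (g n); split => //; exact: sub_laplace_stepf.
Unshelve. all: by end_near. Qed.

(** Continuous functions are dense in L1 of []0, K]], and [sub_laplace_closed] carries the identity
    to the limit. *)
Lemma laplace_functional (K : R) (h : R -> R) : 0 < K -> testfun h ->
  (forall s, K < s -> h s = 0) ->
  sub_laplace Z h = expR (- sub_exponent Z h).
Proof.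
move=> K0 th hK; have [mh h0 hn hfin] := th.
pose E : set R := `]0%R, K]%classic.
have mE : measurable E by exact: measurable_itv.
have iE : lam.-integrable E (EFin \o h).
  have i0 : lam.-integrable setT (EFin \o h) by exact: ge0_integrable.
  by apply: (integrableS _ _ _ i0).
have lE : (lam E < +oo)%E by rewrite /E lebesgue_measure_itv/= lte_fin K0 ltry.
have [g [cg ig cvg_g]] := approximation_continuous_integrable mE lE iE.
apply: (sub_laplace_closed kappa_gt0 kappaE rhoE th) => eps eps0.
have [n hgn] : exists n, (\int[lam]_(s in E) (`|h s - g n s|)%:E <= eps%:E)%E.
  have /fine_cvgP[[M1 _ F1] /cvgrPdist_le /(_ eps eps0) [M2 _ F2]] := cvg_g.
  exists (maxn M1 M2); have f1 := F1 _ (leq_maxl M1 M2).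
  have := F2 _ (leq_maxr M1 M2); rewrite /= sub0r normrN => f2.
  by rewrite -(fineK f1) lee_fin; apply: le_trans f2; exact: ler_norm.
(* The positive part, in a form whose continuity is immediate. As [h] is nonnegative, it is no
   further from [h] than [g n] is. *)
pose gp s := (g n s + `|g n s|) / 2.
have gpE s : gp s = Num.max (g n s) 0.
  by rewrite /gp; case: leP => s0; [rewrite ler0_norm//|rewrite ger0_norm 1?ltW//]; field.
have cgp : continuous gp.
  move=> s; apply: cvgM; last exact: cvg_cst.
  by apply: cvgD; [exact: cg|apply: cvg_norm; exact: cg].
have gp0 s : 0 <= gp s by rewrite gpE le_max lexx orbT.
pose gE s := gp s * \1_E s.
have mgp : measurable_fun setT gp by exact: continuous_measurable_fun.
have mgE : measurable_fun setT gE by apply: measurable_funM => //; exact: measurable_indic.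
have gE0 s : 0 <= gE s by rewrite mulr_ge0.
have mgn : measurable_fun setT (g n) by exact: continuous_measurable_fun.
have md : measurable_fun setT (fun s => `|h s - gE s|).
  by apply: measurableT_comp => //; exact: measurable_funB.
have hgE : (\int[lam]_s (`|h s - gE s|)%:E <= eps%:E)%E.
  apply: le_trans hgn.
  have -> : (\int[lam]_s (`|h s - gE s|)%:E = \int[lam]_(s in E) (`|h s - gE s|)%:E)%E.
    rewrite [RHS]integral_mkcond; apply: ge0_ae_eq_integral => //.
    - exact/measurable_EFinP.
    - by apply/(measurable_restrictT _ _).1 => //; apply: measurable_funTS; exact/measurable_EFinP.
    - by move=> s _; rewrite /patch; case: ifP.
    (* Outside []0, K]] both functions vanish, except that [h] may be nonzero at [0]. *)
    - exists [set 0]; split; [exact: measurable_set1|exact: lebesgue_measure_set1|].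
      move=> s /= H; apply: contrapT => s0; apply: H => _.
      rewrite /patch; case: ifPn => //; rewrite notin_setE /E /= in_itv/= => sE.
      have -> : h s = 0.
        have [sneg|spos] := ltP s 0; first exact: hn.
        apply: hK; rewrite ltNge; apply/negP => sK; apply: sE.
        by rewrite sK andbT lt_neqAle spos andbT eq_sym; apply/eqP.
      by rewrite /gE indicE memNset ?mulr0 ?subrr ?normr0// /E /= in_itv.
  apply: ge0_le_integral => //.
  - exact/measurable_funTS/measurable_EFinP.
  - apply/measurable_funTS/measurable_EFinP; apply: measurableT_comp => //.
    exact: measurable_funB.
  - move=> s Es; rewrite lee_fin /gE indicE mem_set// mulr1 gpE.
    have hs0 := h0 s; have [gs|gs] := leP (g n s) 0; last by [].
    by rewrite subr0 !ger0_norm ?subr_ge0 ?(le_trans gs)//; lra.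
exists gE; split => //; last by apply: sub_laplace_continuous.
split => //.
- move=> s s0; rewrite /gE indicE memNset ?mulr0// /E /= in_itv/= => /andP[s0' _].
  by have := lt_trans s0 s0'; rewrite ltxx.
- apply: (@le_lt_trans _ _ (\int[lam]_s ((h s)%:E + (`|h s - gE s|)%:E))%E).
    apply: ge0_le_integral => //.
    + by move=> s _; rewrite lee_fin.
    + exact/measurable_EFinP.
    + by apply: emeasurable_funD; exact/measurable_EFinP.
    + move=> s _; rewrite -EFinD lee_fin -lerBlDl -normrN opprB.
      exact: ler_norm.
  rewrite ge0_integralD//;
    do ?[by move=> s _; rewrite lee_fin|exact/measurable_EFinP].
  by rewrite lte_add_pinfty// (le_lt_trans hgE)// ltry.
Qed.

End laplace_functional2.

(** * Joint Laplace functional of a family of integrals *)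

Section integral_families.
Context {R : realType} d (T : measurableType d) (P : probability T R).
Variable Z : subordinator P.
Variables (kappa : R) (rho : {measure set (measurableTypeR R) -> \bar R}).
Hypotheses (kappa_gt0 : 0 < kappa) (kappaE : 'E_P[Z (1%:nng)%R]%E = kappa%:E).
Hypothesis rhoE : driftless_levy_measure P (Z 1%:nng) rho.

Local Notation lam := (@lebesgue_measure R).
Local Notation J h w := (\int[lsm Z w]_s (h s)%:E)%E.

(** Extension by zero turns integrals with different upper limits into integrals over one line, so a
    linear combination of them is the integral of a single test function. *)
Definition cut (t : {nonneg R}) (h : R -> R) (s : R) : R :=
  h s * \1_(`[0%R, t%:num]%classic : set R) s.

Lemma cut_in t h s : 0 <= s <= t%:num -> cut t h s = h s.
Proof. by move=> st; rewrite /cut indicE mem_set ?mulr1//= in_itv. Qed.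

Lemma cut_out t h s : ~~ (0 <= s <= t%:num) -> cut t h s = 0.
Proof. by move=> st; rewrite /cut indicE memNset ?mulr0//= in_itv/=; apply/negP. Qed.

Lemma sub_integralE h t w : sub_integral Z h t w = fine (J (cut t h) w).
Proof.
rewrite /sub_integral integral_mkcond; congr fine; apply: eq_integral => s _.
rewrite /patch /cut indicE; case: ifPn => _; by rewrite ?mulr1 ?mulr0.
Qed.

Lemma testfun_cut (t : {nonneg R}) (h : R -> R) : measurable_fun setT h -> (forall s, 0 <= h s) ->
  (\int[lam]_(s in `[0%R, t%:num]) (h s)%:E < +oo)%E -> testfun (cut t h).
Proof.
move=> mh h0 hfin; split.
- by apply: measurable_funM => //; apply: measurable_indic; exact: measurable_itv.
- by move=> s; rewrite /cut mulr_ge0.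
- move=> s s0; rewrite cut_out//; apply/negP => /andP[s0' _].
  by have := le_lt_trans s0' s0; rewrite ltxx.
- apply: le_lt_trans hfin; rewrite [leRHS]integral_mkcond le_eqVlt; apply/orP; left.
  apply/eqP; apply: eq_integral => s _.
  by rewrite /patch /cut indicE; case: ifPn => _; rewrite ?mulr1 ?mulr0.
Qed.

Lemma measurable_sub_integral (t : {nonneg R}) (h : R -> R) : measurable_fun setT h ->
  (forall s, 0 <= h s) -> measurable_fun setT (sub_integral Z h t).
Proof.
move=> mh h0.
have -> : sub_integral Z h t = fun w => fine (J (cut t h) w).
  by apply/funext => w; exact: sub_integralE.
have mJ : measurable_fun setT (fun w => J (cut t h) w).
  apply: measurable_J; last by move=> s; rewrite /cut mulr_ge0.
  by apply: measurable_funM => //; apply: measurable_indic; exact: measurable_itv.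
exact: measurableT_comp mJ.
Qed.

Lemma sub_integral_ge0 (t : {nonneg R}) (h : R -> R) w : (forall s, 0 <= h s) ->
  0 <= sub_integral Z h t w.
Proof.
by move=> h0; apply: fine_ge0; apply: integral_ge0 => s _; rewrite lee_fin.
Qed.

Lemma J_fin_ae (h : R -> R) : testfun h -> {ae P, forall w, J h w \is a fin_num}.
Proof.
move=> [mh h0 hn hfin].
have iJ : P.-integrable setT (fun w => J h w).
  apply/integrableP; split; first exact: measurable_J.
  under eq_integral => w _ do rewrite gee0_abs ?J_ge0//.
  rewrite (campbell_testfun kappa_gt0 kappaE rhoE)//.
  by rewrite lte_mul_pinfty// lee_fin ltW.
have := integrable_ae measurableT iJ; apply: filterS => w; exact.
Qed.

Section family.
Variables (E : Type) (t : E -> {nonneg R}) (h : E -> R -> R).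
Hypothesis mh : forall x, measurable_fun setT (h x).
Hypothesis h0 : forall x s, 0 <= h x s.
Hypothesis hfin : forall x, (\int[lam]_(s in `[0%R, (t x)%:num]) (h x s)%:E < +oo)%E.

Definition sumcut (l : seq ({nonneg R} * E)) (s : R) : R :=
  \sum_(p <- l) p.1%:num * cut (t p.2) (h p.2) s.

Lemma sumcut_ge0 l s : 0 <= sumcut l s.
Proof. by apply: sumr_ge0 => p _; rewrite mulr_ge0// /cut mulr_ge0. Qed.

Lemma measurable_sumcut l : measurable_fun setT (sumcut l).
Proof.
apply: measurable_sum => p; apply: measurable_funM => //.
by apply: testfun_measurable; exact: testfun_cut.
Qed.

Lemma testfun_sumcut l : testfun (sumcut l).
Proof.
split; [exact: measurable_sumcut|exact: sumcut_ge0| |].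
  move=> s s0; rewrite /sumcut big1// => p _.
  by rewrite (testfun_neg (testfun_cut (mh _) (h0 _) (hfin _)))// mulr0.
rewrite /sumcut; under eq_integral do rewrite -sumEFin.
rewrite ge0_integral_sum//; last 2 first.
- move=> p; apply/measurable_EFinP; apply: measurable_funM => //.
  by apply: testfun_measurable; exact: testfun_cut.
- by move=> p s _; rewrite lee_fin mulr_ge0// /cut mulr_ge0.
apply: lte_sum_pinfty => p _; under eq_integral do rewrite EFinM.
have tc := testfun_cut (mh p.2) (h0 p.2) (hfin p.2).
rewrite ge0_integralZl_EFin//.
- by rewrite lte_mul_pinfty ?lee_fin//; exact: testfun_fin.
- by move=> s _; rewrite lee_fin; exact: testfun_ge0.
- by apply/measurable_EFinP; exact: testfun_measurable.
Qed.

(** Additivity passes through [fine] only where the integrals are finite, hence the almost sure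
    statement. *)
Lemma J_sumcut l : {ae P, forall w, J (sumcut l) w \is a fin_num /\
  fine (J (sumcut l) w) = \sum_(p <- l) p.1%:num * sub_integral Z (h p.2) (t p.2) w}.
Proof.
elim: l => [|p l ih].
  apply: aeW => w; rewrite big_nil.
  have -> : J (sumcut [::]) w = 0%E by rewrite integral0_eq// => s _; rewrite /sumcut big_nil.
  by [].
have tc := testfun_cut (mh p.2) (h0 p.2) (hfin p.2).
have := J_fin_ae tc; move: ih; apply: filterS2 => w [fl El] fp.
have mE (k : R -> R) : measurable_fun setT k ->
    @measurable_fun _ _ (measurableTypeR R) _ setT (fun s => (k s)%:E).
  by move=> mk; apply/measurable_EFinP.
have Jcons : (J (sumcut (p :: l)) w =
    p.1%:num%:E * J (cut (t p.2) (h p.2)) w + J (sumcut l) w)%E.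
  have -> : (J (sumcut (p :: l)) w =
     \int[lsm Z w]_s ((p.1%:num * cut (t p.2) (h p.2) s)%:E + (sumcut l s)%:E))%E.
    by apply: eq_integral => s _; rewrite /sumcut big_cons EFinD.
  rewrite ge0_integralD//; last 4 first.
  - by move=> s _; rewrite lee_fin mulr_ge0//; exact: testfun_ge0.
  - apply: (mE (fun s => p.1%:num * cut (t p.2) (h p.2) s)).
    by apply: measurable_funM => //; exact: testfun_measurable.
  - by move=> s _; rewrite lee_fin; exact: sumcut_ge0.
  - by apply: mE; exact: measurable_sumcut.
  congr (_ + _)%E; under eq_integral do rewrite EFinM.
  rewrite ge0_integralZl_EFin//.
  - by move=> s _; rewrite lee_fin; exact: testfun_ge0.
  - by apply: mE; exact: testfun_measurable.
split; first by rewrite Jcons fin_numD fl andbT fin_numM.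
rewrite Jcons fineD// ?fin_numM// El big_cons fineM//; congr (_ * _ + _).
by rewrite sub_integralE.
Qed.

Lemma laplace_family l :
  mean P (fun w => expR (- \sum_(p <- l) p.1%:num * sub_integral Z (h p.2) (t p.2) w)) =
  expR (- sub_exponent Z (sumcut l)).
Proof.
(* A common bound for the supports; the [1] keeps it positive for the empty list. *)
pose K : R := 1 + \sum_(p <- l) (t p.2)%:num.
have K0 : 0 < K by rewrite ltr_pwDl// sumr_ge0.
rewrite -(laplace_functional kappa_gt0 kappaE rhoE K0 (testfun_sumcut l)); last first.
  move=> s Ks; rewrite /sumcut; have : \sum_(p <- l) (t p.2)%:num < s.
    by apply: lt_trans Ks; rewrite ltrDr.
  elim: l {K K0 Ks} => [|p l ih]; first by rewrite !big_nil.
  rewrite !big_cons => ps.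
  have sum0 : 0 <= \sum_(p <- l) (t p.2)%:num by apply: sumr_ge0.
  rewrite ih ?addr0; last first.
    by apply: le_lt_trans ps; rewrite lerDr.
  rewrite cut_out ?mulr0//; apply/negP => /andP[_ st].
  have : (t p.2)%:num < s by apply: le_lt_trans ps; rewrite lerDl.
  by rewrite ltNge st.
rewrite /sub_laplace /mean; congr fine.
have mX p : measurable_fun setT (fun w => p.1%:num * sub_integral Z (h p.2) (t p.2) w).
  by apply: measurable_funM => //; exact: measurable_sub_integral.
apply: ge0_ae_eq_integral => //.
- apply/measurable_EFinP; apply: measurableT_comp => //; apply: measurableT_comp => //.
  exact: measurable_sum.
- apply/measurable_EFinP; apply: measurable_expJ; first exact: measurable_sumcut.
  exact: sumcut_ge0.
- by have := J_sumcut l; apply: filterS => w [_ ->] _.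
Qed.

End family.

End integral_families.

(** * Uniqueness of Levy measures *)

Lemma measurable_inv_ge0 d (T : measurableType d) (R : realType) (g : T -> R) :
  measurable_fun setT g -> (forall x, 0 <= g x) ->
  measurable_fun setT (fun x => (g x)^-1).
Proof.
move=> mg g0; have -> : (fun x => (g x)^-1) = (fun x => (g x) `^ (-1)).
  by apply/funext => x; rewrite powR_inv1.
exact: (measurableT_comp (measurable_powR (-1))).
Qed.

Lemma integral_mrestr d (T : measurableType d) (R : realType)
    (m : {measure set T -> \bar R}) (D : set T) (mD : measurable D) (F : T -> \bar R) :
  measurable_fun setT F -> (forall x, 0 <= F x)%E ->
  (\int[mrestr m mD]_x F x = \int[m]_x ((\1_D x)%:E * F x))%E.
Proof.
move=> mF F0.
have m1 : measurable_fun setT (\1_D : T -> R) by exact: measurable_indic.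
have [mu [muE muI]] := @weighted_image _ _ T T R m (\1_D) id m1
  (fun x => ler0n _ _) (@measurable_id _ _ _).
rewrite -muI//; apply: eq_measure_integral => A mA _.
by rewrite muE// /mrestr integral_indic// setIC.
Qed.

Section levy_uniqueness.
Context {R : realType} {E : Type} d1 d2 (T1 : measurableType d1) (T2 : measurableType d2).
Variables (m1 : {measure set T1 -> \bar R}) (m2 : {measure set T2 -> \bar R}).
Variables (W1 : T1 -> R) (W2 : T2 -> R).
Variables (phi1 : T1 -> paths R E) (phi2 : T2 -> paths R E).
Hypotheses (mW1 : measurable_fun setT W1) (W10 : forall x, 0 <= W1 x).
Hypotheses (mW2 : measurable_fun setT W2) (W20 : forall x, 0 <= W2 x).
Hypotheses (mphi1 : measurable_fun setT phi1) (mphi2 : measurable_fun setT phi2).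

Let L (d : measure_display) (T : measurableType d) (m : {measure set T -> \bar R})
    (W : T -> R) (phi : T -> paths R E) l :=
  (\int[m]_x (W x * (1 - expR (- pairing l (phi x))))%:E)%E.

Hypothesis Lfin : forall l, (L m1 W1 phi1 l < +oo)%E.
Hypothesis L12 : forall l, L m1 W1 phi1 l = L m2 W2 phi2 l.

Let mexp (d : measure_display) (T : measurableType d) (phi : T -> paths R E) l :
  measurable_fun setT phi ->
  measurable_fun setT (fun x => expR (- pairing l (phi x))).
Proof.
move=> mphi; apply: measurableT_comp => //; apply: measurableT_comp => //.
exact: measurableT_comp (measurable_pairing l) mphi.
Qed.

Let mWl (d : measure_display) (T : measurableType d) (W : T -> R)
    (phi : T -> paths R E) l : measurable_fun setT W -> measurable_fun setT phi ->
  measurable_fun setT (fun x => W x * (1 - expR (- pairing l (phi x)))).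
Proof.
by move=> mW mphi; apply: measurable_funM => //; apply: measurable_funB => //; exact: mexp.
Qed.

Let Wl0 (T : Type) (W : T -> R) (phi : T -> paths R E) l x : (forall x, 0 <= W x) ->
  0 <= W x * (1 - expR (- pairing l (phi x))).
Proof.
by move=> W0; have /andP[h _] := onem_expRN_itv (pairing_ge0 l (phi x)); rewrite mulr_ge0.
Qed.

(** [(1 - e^{-l0}) e^{-l}] is the difference of [1 - e^{-(l0 + l)}] and [1 - e^{-l}], both
    integrable: exponents determine the Laplace functional of the measure weighted by
    [1 - e^{-l0}]. *)
Let tilt (d : measure_display) (T : measurableType d) (m : {measure set T -> \bar R})
    (W : T -> R) (phi : T -> paths R E) l0 l :
  measurable_fun setT W -> (forall x, 0 <= W x) -> measurable_fun setT phi ->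
  (forall l, L m W phi l < +oo)%E ->
  (\int[m]_x (W x * (1 - expR (- pairing l0 (phi x))) * expR (- pairing l (phi x)))%:E =
   L m W phi (l0 ++ l) - L m W phi l)%E.
Proof.
move=> mW W0 mphi fin.
have ie l' : m.-integrable setT
    (EFin \o (fun x => W x * (1 - expR (- pairing l' (phi x))))).
  by apply: ge0_integrable; [exact: mWl|move=> x; exact: Wl0|exact: fin].
rewrite /L -integralB_EFin//; try exact: ie.
apply: eq_integral => x _; rewrite -EFinB pairing_cat opprD expRD; congr EFin; ring.
Qed.

Lemma levy_weight_unique l0 (F : paths R E -> \bar R) :
  measurable_fun setT F -> (forall y, 0 <= F y)%E ->
  (\int[m1]_x ((W1 x * (1 - expR (- pairing l0 (phi1 x))))%:E * F (phi1 x)) =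
   \int[m2]_x ((W2 x * (1 - expR (- pairing l0 (phi2 x))))%:E * F (phi2 x)))%E.
Proof.
move=> mF F0; apply: laplace_paths_unique => //.
- exact: mWl.
- by move=> x; exact: Wl0.
- exact: mWl.
- by move=> x; exact: Wl0.
- exact: Lfin.
- move=> l; rewrite !tilt//; first by rewrite !L12.
  by move=> l'; rewrite -L12.
Qed.

(** The weight [1 - e^{-l0}] is divided out. Where it vanishes its inverse is [0] by convention,
    which is harmless since [F] vanishes there too. *)
Lemma levy_unique_supp l0 (F : paths R E -> \bar R) :
  measurable_fun setT F -> (forall y, 0 <= F y)%E ->
  (forall y, pairing l0 y = 0 -> F y = 0%E) ->
  (\int[m1]_x ((W1 x)%:E * F (phi1 x)) = \int[m2]_x ((W2 x)%:E * F (phi2 x)))%E.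
Proof.
move=> mF F0 Fsupp.
pose G y := ((1 - expR (- pairing l0 y))^-1%:E * F y)%E.
have mG : measurable_fun setT G.
  apply: emeasurable_funM => //; apply/measurable_EFinP.
  apply: measurable_inv_ge0; last first.
    by move=> y; have /andP[] := onem_expRN_itv (pairing_ge0 l0 y).
  have mp : measurable_fun setT (fun y : paths R E => 1 - expR (- pairing l0 y)).
    apply: measurable_funB => //; apply: measurableT_comp => //.
    by apply: measurableT_comp => //; exact: measurable_pairing.
  exact: mp.
have G0 y : (0 <= G y)%E.
  apply: mule_ge0 => //; rewrite lee_fin invr_ge0.
  by have /andP[] := onem_expRN_itv (pairing_ge0 l0 y).
have WG w y : ((w * (1 - expR (- pairing l0 y)))%:E * G y = w%:E * F y)%E.
  have [p0|p0] := eqVneq (pairing l0 y) 0; first by rewrite /G Fsupp// !mule0.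
  rewrite /G muleA -EFinM -mulrA divff ?mulr1// subr_eq0 eq_sym -expR0.
  by rewrite (inj_eq (@expR_inj R)) oppr_eq0.
have := levy_weight_unique l0 mG G0.
under eq_integral do rewrite WG.
by under [X in _ = X -> _]eq_integral do rewrite WG.
Qed.

End levy_uniqueness.

(** * The size-biased probability attached to [rho] *)

Section size_biased.
Context {R : realType}.
Variables (kappa : R) (rho : {measure set (measurableTypeR R) -> \bar R}).
Hypotheses (kappa_gt0 : 0 < kappa).
Hypothesis rho_mean : (\int[rho]_(x in `]0%R, +oo[) x%:E = kappa%:E)%E.

(** The inverse cut off to positive arguments, so that weights are nonnegative everywhere. *)
Definition posinv (x : R) : R := x^-1 * \1_(`]0%R, +oo[%classic : set R) x.

Lemma posinv_ge0 x : 0 <= posinv x.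
Proof.
rewrite /posinv indicE; case: (boolP (x \in _)) => [|_]; last by rewrite mulr0.
by rewrite inE/= in_itv/= andbT => x0; rewrite mulr1 invr_ge0 ltW.
Qed.

Lemma measurable_posinv : measurable_fun setT posinv.
Proof.
have -> : posinv = fun x => (Num.max x 0)^-1.
  apply/funext => x; rewrite /posinv indicE.
  case: (boolP (x \in _)); rewrite ?inE ?notin_setE/= in_itv/= andbT.
    by move=> x0; rewrite mulr1 max_l// ltW.
  by move=> /negP; rewrite -leNgt => x0; rewrite mulr0 max_r// invr0.
apply: measurable_inv_ge0; first exact: measurable_maxr.
by move=> x; rewrite le_max lexx orbT.
Qed.

Lemma size_biased_probability :
  exists q : probability (measurableTypeR R) R,
    (forall A, measurable A ->
       q A = (\int[rho]_(x in A `&` `]0%R, +oo[) (kappa^-1 * x)%:E)%E) /\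
    (forall G : R -> \bar R, measurable_fun setT G -> (forall x, 0 <= G x)%E ->
       \int[q]_x ((kappa * posinv x)%:E * G x) = \int[rho]_(x in `]0%R, +oo[) G x)%E.
Proof.
pose W (x : R) : R := kappa^-1 * x * \1_(`]0%R, +oo[%classic : set R) x.
have m1 : measurable_fun setT (\1_(`]0%R, +oo[%classic : set R) : R -> R).
  by apply: measurable_indic; exact: measurable_itv.
have mW : measurable_fun setT W by do 2 apply: measurable_funM => //.
have W0 x : 0 <= W x.
  rewrite /W indicE; case: (boolP (x \in _)) => [|_]; last by rewrite mulr0.
  rewrite inE/= in_itv/= andbT => x0.
  by rewrite mulr1 mulr_ge0 ?invr_ge0 ?ltW.
have [mu [muE muI]] := @weighted_image _ _ (measurableTypeR R) (measurableTypeR R) R rho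
  W id mW W0 (@measurable_id _ _ _).
have muA A : measurable A ->
    mu A = (\int[rho]_(x in A `&` `]0%R, +oo[) (kappa^-1 * x)%:E)%E.
  move=> mA; rewrite muE// preimage_id integral_mkcondr; apply: eq_integral => x _.
  by rewrite /W /patch indicE; case: ifPn => _; rewrite ?mulr1 ?mulr0.
have mu1 : mu setT = 1%E.
  rewrite muA// setTI; under eq_integral do rewrite EFinM.
  rewrite ge0_integralZl_EFin//.
  - by rewrite rho_mean -EFinM mulVf// gt_eqF.
  - by move=> x /=; rewrite in_itv/= andbT => x0; rewrite lee_fin ltW.
  - by rewrite invr_ge0 ltW.
(* The total mass is already [1]: normalising only packages [mu] as a probability, and the Dirac
   mass is the default value for degenerate total masses. *)
pose q : probability (measurableTypeR R) R := mnormalize mu \d_(0 : measurableTypeR R).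
have qE A : q A = mu A.
  by rewrite /q/= /mnormalize mu1 onee_eq0/= invr1 mule1.
exists q; split; first by move=> A mA; rewrite qE muA.
move=> G mG G0.
have mkp : measurable_fun setT (fun x => kappa * posinv x).
  by apply: measurable_funM => //; exact: measurable_posinv.
have -> : (\int[q]_x ((kappa * posinv x)%:E * G x) =
          \int[mu]_x ((kappa * posinv x)%:E * G x))%E.
  by apply: eq_measure_integral => A _ _; exact: qE.
rewrite muI; last 2 first.
- by apply: emeasurable_funM => //; exact/measurable_EFinP.
- move=> x; apply: mule_ge0 => //; rewrite lee_fin mulr_ge0 ?(ltW kappa_gt0)//.
  exact: posinv_ge0.
rewrite [RHS]integral_mkcond; apply: eq_integral => x _.
rewrite /W /posinv /patch indicE muleA -EFinM.
case: ifPn => [|_]; last by rewrite mulr0 mul0r mul0e.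
rewrite inE/= in_itv/= andbT => x0.
rewrite !mulr1 (_ : _ * _ = 1) ?mul1e//.
by field; rewrite !gt_eqF.
Qed.

End size_biased.

(** * The jumps of the stochastic convolution *)

Section reflection.
Context {R : realType}.
Local Notation lam := (@lebesgue_measure R).

(** Uniqueness of Lebesgue measure: reflection maps []a, b]] to [[t - b, t - a[], which has the same
    length. *)
Lemma lebesgue_integral_reflect (t : R) (h : R -> \bar R) :
  measurable_fun setT h -> (forall s, 0 <= h s)%E ->
  (\int[lam]_s h (t - s)%R = \int[lam]_s h s)%E.
Proof.
move=> mh h0.
pose r (s : measurableTypeR R) : measurableTypeR R := t - s.
have mr : measurable_fun setT r by apply: measurable_funB.
have [mu [muE muI]] := @weighted_image _ _ (measurableTypeR R) (measurableTypeR R) R lam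
  (cst 1) r (@measurable_cst _ _ _ _ _ _) (fun=> ler01) mr.
transitivity (\int[mu]_s h s)%E.
  by rewrite muI//; apply: eq_integral => s _; rewrite mul1e.
apply: eq_measure_integral => A mA _; apply/esym/lebesgue_measure_unique => //.
move=> _ [[a b] _ <-]; rewrite muE//=.
have -> : r @^-1` `]a, b]%classic = `[t - b, t - a[%classic.
  apply/seteqP; split=> s; rewrite /r /= !in_itv/= => /andP[h1 h2].
    by apply/andP; split; lra.
  by apply/andP; split; lra.
rewrite (eq_integral (cst 1%E))// integral_cst//= mul1e.
rewrite !lebesgue_measure_itv/= !lte_fin.
have -> : (t - b < t - a) = (a < b) by rewrite ltrD2l ltrN2.
by case: ifP => // _; rewrite -!EFinB; congr EFin; ring.
Qed.

Lemma lebesgue_integral_shift (t : R) (h : R -> \bar R) :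
  measurable_fun setT h -> (forall s, 0 <= h s)%E ->
  (\int[lam]_s h (s - t)%R = \int[lam]_s h s)%E.
Proof.
move=> mh h0; have mk : measurable_fun setT (fun s : R => h (- s)).
  by apply: measurableT_comp.
have := @lebesgue_integral_reflect t (fun s => h (- s)) mk (fun s => h0 _).
under eq_integral do rewrite opprB.
move=> ->; have := @lebesgue_integral_reflect 0 h mh h0.
by under eq_integral do rewrite sub0r.
Qed.

End reflection.

Section jumps.
Context {R : realType}.
Variables (kappa : R) (rho : {measure set (measurableTypeR R) -> \bar R}).
Hypotheses (kappa_gt0 : 0 < kappa).
Variable q : probability (measurableTypeR R) R.
Hypothesis qE : forall G : R -> \bar R, measurable_fun setT G -> (forall x, 0 <= G x)%E ->
  (\int[q]_x ((kappa * posinv x)%:E * G x) = \int[rho]_(x in `]0%R, +oo[) G x)%E.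
Variable f : R -> R.
Hypotheses (f_meas : measurable_fun setT f) (f_ge0 : forall u : R, 0 <= f u).

Local Notation lam := (@lebesgue_measure R).
Local Notation S := (measurableTypeR R * measurableTypeR R)%type.

Definition jumps : {measure set S -> \bar R} := (lam \x q)%E.

(** The density of [1_D(s) ds rho(dx)] with respect to the sigma-finite measure [ds q(dx)]. *)
Definition jump_weight (D : set R) (z : S) : R := \1_D z.1 * (kappa * posinv z.2).

Definition jump_map (z : S) : paths R {nonneg R} := jump_path f z.2 z.1.

Lemma measurable_jump_map : measurable_fun setT jump_map.
Proof.
apply: measurable_paths => x; rewrite /jump_map /jump_path /=.
apply: measurable_maxr => //; apply: measurable_funM; first exact: measurable_snd.
apply: (measurableT_comp f_meas); apply: measurable_funB => //; exact: measurable_fst.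
Qed.

Lemma jump_weight_ge0 D z : 0 <= jump_weight D z.
Proof.
by rewrite /jump_weight mulr_ge0// mulr_ge0 ?posinv_ge0// ltW.
Qed.

Lemma measurable_jump_weight (D : set R) : measurable D ->
  measurable_fun setT (jump_weight D).
Proof.
move=> mD; apply: measurable_funM.
  apply: (measurableT_comp (f := (\1_D : R -> R))); last exact: measurable_fst.
  exact: measurable_indic.
apply: measurable_funM => //.
by apply: (measurableT_comp (@measurable_posinv R)); exact: measurable_snd.
Qed.

Lemma jumps_integral (D : set R) (G : S -> \bar R) : measurable D ->
  measurable_fun setT G -> (forall y, 0 <= G y)%E ->
  (\int[jumps]_z ((jump_weight D z)%:E * G z) =
   \int[lam]_(s in D) \int[rho]_(x in `]0%R, +oo[) G (s, x))%E.
Proof.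
move=> mD mG G0.
have mH : measurable_fun setT (fun z => (jump_weight D z)%:E * G z)%E.
  by apply: emeasurable_funM => //; apply/measurable_EFinP; exact: measurable_jump_weight.
have H0 z : (0 <= (jump_weight D z)%:E * G z)%E.
  by rewrite mule_ge0// lee_fin jump_weight_ge0.
rewrite /jumps fubini_tonelli1// /fubini_F [RHS]integral_mkcond.
apply: eq_integral => s _ /=.
have mGs : measurable_fun setT (fun x => G (s, x)).
  by apply: measurableT_comp => //; exact: measurable_pair1.
rewrite /jump_weight/= /patch indicE; case: ifPn => _.
  under eq_integral do rewrite mul1r.
  by rewrite qE.
by rewrite integral0_eq// => x _; rewrite mul0r mul0e.
Qed.

Lemma pairing_jump l s (x : R) : 0 <= x ->
  pairing l (jump_path f x s) = \sum_(p <- l) p.1%:num * f (p.2%:num - s) * x.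
Proof.
move=> x0; apply: eq_bigr => p _; rewrite /jump_path posp_num ?mulr_ge0//.
by rewrite -mulrA [x * _]mulrC.
Qed.

End jumps.

Section convolution.
Context {R : realType} d (T : measurableType d) (P : probability T R).
Variable Z : subordinator P.
Variables (kappa : R) (rho : {measure set (measurableTypeR R) -> \bar R}).
Hypotheses (kappa_gt0 : 0 < kappa) (kappaE : 'E_P[Z (1%:nng)%R]%E = kappa%:E).
Hypothesis rhoE : driftless_levy_measure P (Z 1%:nng) rho.
Variable q : probability (measurableTypeR R) R.
Hypothesis qE : forall G : R -> \bar R, measurable_fun setT G -> (forall x, 0 <= G x)%E ->
  (\int[q]_x ((kappa * posinv x)%:E * G x) = \int[rho]_(x in `]0%R, +oo[) G x)%E.
Variable f : R -> R.
Hypotheses (f_meas : measurable_fun setT f) (f_ge0 : forall u : R, 0 <= f u).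
Hypothesis f_neg : forall u : R, u < 0 -> f u = 0.
Hypothesis I_fin : forall t : R, 0 < t -> (prim f t < +oo)%E.

Local Notation lam := (@lebesgue_measure R).

Definition conv_kernel (D : set R) (t : {nonneg R}) (s : R) : R :=
  f (t%:num - s) * \1_D s.

Lemma conv_kernel_ge0 D t s : 0 <= conv_kernel D t s.
Proof. by rewrite /conv_kernel mulr_ge0. Qed.

Lemma measurable_shift (t : R) : measurable_fun setT (fun s : R => f (t - s)).
Proof. by apply: measurableT_comp => //; exact: measurable_funB. Qed.

Lemma measurable_conv_kernel (D : set R) t : measurable D ->
  measurable_fun setT (conv_kernel D t).
Proof.
move=> mD; apply: measurable_funM; first exact: measurable_shift.
exact: measurable_indic.
Qed.

Lemma prim_reflect (t : R) :
  (\int[lam]_(s in `[0%R, t]) (f (t - s))%:E = prim f t)%E.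
Proof.
pose g (s : R) : \bar R := ((f s)%:E * (\1_(`[0%R, t]%classic : set R) s)%:E)%E.
have mg : measurable_fun setT g.
  apply: emeasurable_funM; first exact/measurable_EFinP.
  by apply/measurable_EFinP; apply: measurable_indic; exact: measurable_itv.
have g0 s : (0 <= g s)%E by rewrite /g mule_ge0// lee_fin.
have := lebesgue_integral_reflect t mg g0.
have -> : (\int[lam]_s g s = prim f t)%E.
  rewrite /prim [RHS]integral_mkcond; apply: eq_integral => s _.
  by rewrite /g /patch indicE; case: ifPn => _; rewrite ?mule1 ?mule0.
move=> <-; rewrite [LHS]integral_mkcond; apply: eq_integral => s _.
rewrite /g /patch indicE.
have -> : (t - s \in (`[0, t]%classic : set R)) = (s \in (`[0, t]%classic : set R)).
  by apply/idP/idP; rewrite !inE/= !in_itv/= => /andP[? ?]; apply/andP; split; lra.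
by case: ifPn => _; rewrite ?mule1 ?mule0.
Qed.

Lemma prim_fin (t : {nonneg R}) : (prim f t%:num < +oo)%E.
Proof.
have [t0|t0] := ltP 0 t%:num; first exact: I_fin.
have -> : t%:num = 0 by apply: le_anti; rewrite t0 ge0.
by rewrite /prim set_itv1 integral_set1.
Qed.

Lemma conv_kernel_fin (D : set R) (t : {nonneg R}) : measurable D ->
  (\int[lam]_(s in `[0%R, t%:num]) (conv_kernel D t s)%:E < +oo)%E.
Proof.
move=> mD; apply: le_lt_trans (prim_fin t); rewrite -prim_reflect.
apply: ge0_le_integral => //.
- by move=> s _; rewrite lee_fin conv_kernel_ge0.
- by apply: measurable_funTS; apply/measurable_EFinP; exact: measurable_conv_kernel.
- by apply: measurable_funTS; apply/measurable_EFinP; exact: measurable_shift.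
- by move=> s _; rewrite lee_fin /conv_kernel ler_piMr// indicE; case: (_ \in _).
Qed.

(** Makes the full convolution an instance of the restricted one, so that only the latter has to be
    studied. *)
Lemma stoch_convE t w : stoch_conv Z f t w = stoch_conv_on Z f `[0%R, +oo[%classic t w.
Proof.
rewrite /stoch_conv /stoch_conv_on !sub_integralE; congr fine.
apply: eq_integral => s _; rewrite /cut indicE [in RHS]indicE.
case: (boolP (s \in _)) => [|_]; last by rewrite !mulr0.
by rewrite inE/= in_itv/= => /andP[s0 _]; rewrite mem_set ?mulr1//= in_itv/= s0.
Qed.

Lemma stoch_conv_on_process (D : set R) : measurable D ->
  nonneg_process (stoch_conv_on Z f D).
Proof.
move=> mD t; split.
  apply: measurable_sub_integral; first exact: (measurable_conv_kernel t mD).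
  exact: (conv_kernel_ge0 D t).
by move=> w; apply: sub_integral_ge0; exact: (conv_kernel_ge0 D t).
Qed.

Definition conv_exponent (D : set R) l : R :=
  sub_exponent Z (sumcut id (conv_kernel D) l).

Lemma conv_laplace (D : set R) l : measurable D ->
  mean P (fun w => expR (- \sum_(p <- l) p.1%:num * stoch_conv_on Z f D p.2 w)) =
  expR (- conv_exponent D l).
Proof.
move=> mD; apply: (laplace_family kappa_gt0 kappaE rhoE).
- by move=> t; exact: measurable_conv_kernel.
- exact: conv_kernel_ge0.
- by move=> t; exact: conv_kernel_fin.
Qed.

(** The upper limits disappear because [f] vanishes on negative numbers, the lower limit because [D]
    lies in the half-line. *)
Lemma sumcut_conv (D : set R) l s : D `<=` `[0%R, +oo[%classic ->
  sumcut id (conv_kernel D) l s = \1_D s * \sum_(p <- l) p.1%:num * f (p.2%:num - s).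
Proof.
move=> D0; rewrite mulr_sumr; apply: eq_bigr => p _.
rewrite [RHS]mulrCA; congr (_ * _).
have [st|st] := boolP (0 <= s <= p.2%:num); first by rewrite cut_in// /conv_kernel mulrC.
rewrite cut_out// indicE; have [|_] := boolP (s \in D); last by rewrite mul0r.
rewrite inE => /D0 /=; rewrite in_itv/= andbT => s0.
rewrite f_neg ?mulr0// subr_lt0; move: st; rewrite s0/= -ltNge.
exact.
Qed.

(** At a fixed time [s] the path [x f(. - s)] is paired to [c x] with [c] a combination of values of
    [f], so the inner integral is [lexp Z c]. *)
Lemma jumps_conv_exponent (D : set R) l : measurable D -> D `<=` `[0%R, +oo[%classic ->
  (\int[jumps q]_z
     (jump_weight kappa D z * (1 - expR (- pairing l (jump_map f z))))%:E =
   (conv_exponent D l)%:E)%E.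
Proof.
move=> mD D0.
have mj := measurable_jump_map f_meas.
pose G z := (1 - expR (- pairing l (jump_map f z)))%:E.
have mG : measurable_fun setT G.
  apply/measurable_EFinP; apply: measurable_funB => //; apply: measurableT_comp => //.
  by apply: measurableT_comp => //; exact: measurableT_comp (measurable_pairing l) mj.
have G0 z : (0 <= G z)%E.
  by rewrite lee_fin; have /andP[] := onem_expRN_itv (pairing_ge0 l (jump_map f z)).
under eq_integral do rewrite EFinM.
rewrite (jumps_integral kappa_gt0 qE mD mG G0).
have tf : testfun (sumcut id (conv_kernel D) l).
  apply: testfun_sumcut.
  - by move=> t; exact: measurable_conv_kernel.
  - exact: conv_kernel_ge0.
  - by move=> t; exact: conv_kernel_fin.
rewrite /conv_exponent -(sub_exponent_fin kappa_gt0 kappaE rhoE tf).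
rewrite [LHS]integral_mkcond; apply: eq_integral => s _.
rewrite sumcut_conv// /patch indicE; case: ifPn => sD; last first.
  by rewrite mul0r (lexp0 rhoE).
have c0 : 0 <= \sum_(p <- l) p.1%:num * f (p.2%:num - s).
  by apply: sumr_ge0 => p _; rewrite mulr_ge0.
rewrite mul1r -(lexpE rhoE c0).
apply: eq_integral => x; rewrite inE/= in_itv/= andbT => x0.
by rewrite /G /jump_map/= pairing_jump ?ltW// -mulr_suml.
Qed.

End convolution.

(** * Laws and independence through Laplace functionals *)

Section laws.
Context {R : realType} {E : Type}.

Definition lin (T : Type) (X : E -> T -> R) (l : seq ({nonneg R} * E)) (w : T) : R :=
  \sum_(p <- l) p.1%:num * X p.2 w.

Lemma lin_ge0 (T : Type) (X : E -> T -> R) l w : (forall t w, 0 <= X t w) -> 0 <= lin X l w.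
Proof. by move=> X0; apply: sumr_ge0 => p _; rewrite mulr_ge0. Qed.

Lemma measurable_lin d (T : measurableType d) (X : E -> T -> R) l :
  (forall t, measurable_fun setT (X t)) -> measurable_fun setT (lin X l).
Proof. by move=> mX; apply: measurable_sum => p; exact: measurable_funM. Qed.

Lemma pairing_path_of (T : Type) (X : E -> T -> R) l w : (forall t w, 0 <= X t w) ->
  pairing l (path_of X w) = lin X l w.
Proof. by move=> X0; apply: eq_bigr => p _; rewrite /path_of posp_num. Qed.

Lemma lin_exp_mean d (T : measurableType d) (P : probability T R) (X : E -> T -> R) l :
  nonneg_process X ->
  (\int[P]_w (expR (- lin X l w))%:E)%E = (mean P (fun w => expR (- lin X l w)))%:E.
Proof.
move=> pX; apply: mean_fin.
  apply: measurableT_comp => //; apply: measurableT_comp => //.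
  by apply: measurable_lin => t; have [] := pX t.
by move=> w; rewrite expRN_le1// lin_ge0// => t w'; have [_] := pX t.
Qed.

Lemma weighted_same_law d1 d2 (T1 : measurableType d1) (T2 : measurableType d2)
    (m1 : {measure set T1 -> \bar R}) (m2 : {measure set T2 -> \bar R})
    (W1 : T1 -> R) (W2 : T2 -> R) (X1 : E -> T1 -> R) (X2 : E -> T2 -> R) :
  measurable_fun setT W1 -> (forall x, 0 <= W1 x) -> nonneg_process X1 ->
  measurable_fun setT W2 -> (forall x, 0 <= W2 x) -> nonneg_process X2 ->
  (\int[m1]_x (W1 x)%:E < +oo)%E ->
  (forall l, \int[m1]_x (W1 x * expR (- lin X1 l x))%:E =
             \int[m2]_x (W2 x * expR (- lin X2 l x))%:E)%E ->
  forall (n : nat) (t : n.-tuple E) (B : set (n.-tuple R)), measurable B ->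
    (\int[m1]_(w in [set w | B [tuple X1 (tnth t i) w | i < n]]) (W1 w)%:E =
     \int[m2]_(w in [set w | B [tuple X2 (tnth t i) w | i < n]]) (W2 w)%:E)%E.
Proof.
move=> mW1 W10 pX1 mW2 W20 pX2 W1fin L12 n t B mB.
have X10 s w : 0 <= X1 s w by have [_] := pX1 s.
have X20 s w : 0 <= X2 s w by have [_] := pX2 s.
have mp1 : measurable_fun setT (path_of X1).
  by apply: measurable_path_of => s; have [] := pX1 s.
have mp2 : measurable_fun setT (path_of X2).
  by apply: measurable_path_of => s; have [] := pX2 s.
pose A := [set y : paths R E | B [tuple (y (tnth t i))%:num | i < n]].
have mA : measurable A by exact: measurable_path_tuple.
have L l : (\int[m1]_x (W1 x * expR (- pairing l (path_of X1 x)))%:E =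
            \int[m2]_x (W2 x * expR (- pairing l (path_of X2 x)))%:E)%E.
  under eq_integral do rewrite pairing_path_of//.
  by under [RHS]eq_integral do rewrite pairing_path_of//.
have E1 : [set w | B [tuple X1 (tnth t i) w | i < n]] = path_of X1 @^-1` A.
  exact: preimage_path_of_tuple.
have E2 : [set w | B [tuple X2 (tnth t i) w | i < n]] = path_of X2 @^-1` A.
  exact: preimage_path_of_tuple.
have WE d (T : measurableType d) (W : T -> R) (X : E -> T -> R) x :
    ((W x)%:E * (EFin \o (\1_A : paths R E -> R)) (path_of X x))%E =
    ((EFin \o W) \_ (path_of X @^-1` A)) x.
  rewrite /patch /= -indic_preimage indicE.
  by case: ifPn => _; rewrite ?mule1 ?mule0.
rewrite E1 E2 integral_mkcond [RHS]integral_mkcond.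
transitivity (\int[m1]_x ((W1 x)%:E * (EFin \o (\1_A : paths R E -> R)) (path_of X1 x)))%E.
  by apply: eq_integral => x _; rewrite WE.
transitivity (\int[m2]_x ((W2 x)%:E * (EFin \o (\1_A : paths R E -> R)) (path_of X2 x)))%E.
  apply: laplace_paths_unique => //.
  - by apply/measurable_EFinP; exact: measurable_indic.
  - by move=> y; rewrite lee_fin.
by apply: eq_integral => x _; rewrite WE.
Qed.

Lemma same_law_laplace d1 d2 (T1 : measurableType d1) (T2 : measurableType d2)
    (P1 : probability T1 R) (P2 : probability T2 R)
    (X1 : E -> T1 -> R) (X2 : E -> T2 -> R) :
  nonneg_process X1 -> nonneg_process X2 ->
  (forall l, mean P1 (fun w => expR (- lin X1 l w)) =
             mean P2 (fun w => expR (- lin X2 l w))) ->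
  same_law P1 X1 P2 X2.
Proof.
move=> pX1 pX2 L12 n t B mB.
have X10 s w : 0 <= X1 s w by have [_] := pX1 s.
have X20 s w : 0 <= X2 s w by have [_] := pX2 s.
have meas d (T : measurableType d) (X : E -> T -> R) : nonneg_process X ->
    measurable [set w | B [tuple X (tnth t i) w | i < n]].
  move=> pX.
  have -> : [set w | B [tuple X (tnth t i) w | i < n]] =
      path_of X @^-1` [set y : paths R E | B [tuple (y (tnth t i))%:num | i < n]].
    by apply: preimage_path_of_tuple => s w; have [_] := pX s.
  rewrite -[X in measurable X]setTI; apply: measurable_path_of => //.
    by move=> s; have [] := pX s.
  exact: measurable_path_tuple.
have I1 d (T : measurableType d) (Q : probability T R) A : measurable A ->
    (\int[Q]_(w in A) (cst 1%R w : R)%:E = Q A)%E.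
  by move=> mA; rewrite (eq_integral (cst 1%E))// integral_cst// mul1e.
have := @weighted_same_law _ _ _ _ P1 P2 (cst 1) (cst 1) X1 X2
  (@measurable_cst _ _ _ _ _ _) (fun=> ler01) pX1
  (@measurable_cst _ _ _ _ _ _) (fun=> ler01) pX2 _ _ n t B mB.
rewrite !I1; do ?[exact: meas|exact: measurableT].
apply.
  by rewrite probability_setT ltry.
move=> l; under eq_integral do rewrite mul1r.
under [RHS]eq_integral do rewrite mul1r.
by rewrite !lin_exp_mean// L12.
Qed.

Lemma levy_laplace d (T : measurableType d) (P : probability T R) (X : E -> T -> R)
    (nu : {measure set (paths R E) -> \bar R}) l :
  nonneg_process X -> is_levy_measure P X nu ->
  ((mean P (fun w => expR (- lin X l w)))%:E =
   expeR (- \int[nu]_y (1 - expR (- pairing l y))%:E))%E.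
Proof.
move=> pX [/laplace_formulaP /(_ l) + _].
by rewrite expectationE => <-; rewrite -lin_exp_mean.
Qed.

(** The value [expR (- c)] is positive, so the integral cannot be infinite and the exponential can
    be inverted. *)
Lemma levy_exponentE d (T : measurableType d) (P : probability T R) (X : E -> T -> R)
    (nu : {measure set (paths R E) -> \bar R}) l (c : R) :
  nonneg_process X -> is_levy_measure P X nu ->
  mean P (fun w => expR (- lin X l w)) = expR (- c) ->
  (\int[nu]_y (1 - expR (- pairing l y))%:E = c%:E)%E.
Proof.
move=> pX nuE mE; have := levy_laplace l pX nuE; rewrite mE.
have : (0 <= \int[nu]_y (1 - expR (- pairing l y))%:E)%E.
  apply: integral_ge0 => y _; rewrite lee_fin.
  by have /andP[] := onem_expRN_itv (pairing_ge0 l y).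
case: (\int[nu]_y _)%E => [r| |]//= _.
- by move=> [] /expR_inj/oppr_inj ->.
- by move=> [] e0; have := expR_gt0 (- c); rewrite e0 ltxx.
Qed.

Lemma is_levy_measure_laplace d (T : measurableType d) (P : probability T R)
    (X : E -> T -> R) (nu : {measure set (paths R E) -> \bar R}) (c : seq ({nonneg R} * E) -> R) :
  nonneg_process X -> no_mass_at_zero nu ->
  (forall l, mean P (fun w => expR (- lin X l w)) = expR (- c l)) ->
  (forall l, \int[nu]_y (1 - expR (- pairing l y))%:E = (c l)%:E)%E ->
  is_levy_measure P X nu.
Proof.
move=> pX nu0 mE nuE; split=> //; apply/laplace_formulaP => l.
by rewrite expectationE [LHS]lin_exp_mean// mE nuE.
Qed.

End laws.

Section path_independence.
Context {R : realType} {E : Type} d (T : measurableType d) (P : probability T R).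
Variables X L : E -> T -> R.
Hypotheses (pX : nonneg_process X) (pL : nonneg_process L).

Let X0 t w : 0 <= X t w. Proof. by have [_] := pX t. Qed.
Let L0 t w : 0 <= L t w. Proof. by have [_] := pL t. Qed.
Let mX t : measurable_fun setT (X t). Proof. by have [] := pX t. Qed.
Let mL t : measurable_fun setT (L t). Proof. by have [] := pL t. Qed.

Lemma sigma_process_setT (Y : E -> T -> R) : (forall t w, 0 <= Y t w) -> sigma_process Y setT.
Proof.
by move=> Y0; rewrite sigma_process_path_of//; exists setT => //; rewrite preimage_setT setTI.
Qed.

Lemma independent2_paths : independent2 P (sigma_process X) (sigma_process L) <->
  (forall A B : set (paths R E), measurable A -> measurable B ->
    P (path_of X @^-1` A `&` path_of L @^-1` B) =
    P (path_of X @^-1` A) * P (path_of L @^-1` B))%E.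
Proof.
rewrite independent2P; [|exact: sigma_process_setT..].
rewrite !sigma_process_path_of//; split=> [H A B mA mB|H _ _ [A mA <-] [B mB <-]].
  by apply: H; [exists A|exists B] => //; rewrite setTI.
by rewrite !setTI; exact: H.
Qed.

Lemma mean_independent2 l1 l2 : independent2 P (sigma_process X) (sigma_process L) ->
  mean P (fun w => expR (- (lin X l1 w + lin L l2 w))) =
  mean P (fun w => expR (- lin X l1 w)) * mean P (fun w => expR (- lin L l2 w)).
Proof.
move=> /independent2_paths XL.
have me l : measurable_fun [set: paths R E] (fun y : paths R E => expR (- pairing l y)).
  by apply: measurableT_comp => //; apply: measurableT_comp => //; exact: measurable_pairing.
have := integral_indepM (measurable_path_of mX) (measurable_path_of mL) XL
  (me l1) (fun z => expR_ge0 _) (me l2) (fun z => expR_ge0 _).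
under eq_integral do rewrite !pairing_path_of// -expRD -opprD.
under [X in _ = (X * _)%E -> _]eq_integral do rewrite !pairing_path_of//.
under [X in _ = (_ * X)%E -> _]eq_integral do rewrite !pairing_path_of//.
rewrite (lin_exp_mean P l1 pX) (lin_exp_mean P l2 pL) -EFinM => H.
by rewrite {1}/mean H.
Qed.

End path_independence.

Section disjoint_independence.
Context {R : realType} {E : Type} d (T : measurableType d) (P : probability T R).
Variables X L : E -> T -> R.
Hypotheses (pX : nonneg_process X) (pL : nonneg_process L).

Let X0 t w : 0 <= X t w. Proof. by have [_] := pX t. Qed.
Let L0 t w : 0 <= L t w. Proof. by have [_] := pL t. Qed.
Let mX t : measurable_fun setT (X t). Proof. by have [] := pX t. Qed.
Let mL t : measurable_fun setT (L t). Proof. by have [] := pL t. Qed.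

Definition lefts (l : seq ({nonneg R} * (E + E))) : seq ({nonneg R} * E) :=
  pmap (fun p => if p.2 is inl t then Some (p.1, t) else None) l.
Definition rights (l : seq ({nonneg R} * (E + E))) : seq ({nonneg R} * E) :=
  pmap (fun p => if p.2 is inr t then Some (p.1, t) else None) l.

Lemma big_lefts_rights (F : {nonneg R} -> E + E -> R) l :
  \sum_(p <- l) F p.1 p.2 =
  \sum_(p <- lefts l) F p.1 (inl p.2) + \sum_(p <- rights l) F p.1 (inr p.2).
Proof.
elim: l => [|[a [t|t]] l ih]; first by rewrite !big_nil addr0.
  by rewrite /lefts /rights /= !big_cons/= ih addrA.
by rewrite /lefts /rights /= !big_cons/= ih addrCA.
Qed.

(** The pair is read as one process indexed by [E + E] and compared with its copy on the product
    space [T * T], where the components are independent by construction. The hypothesis says that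
    the two Laplace functionals agree. *)
Lemma independent2_laplace :
  (forall l1 l2, mean P (fun w => expR (- (lin X l1 w + lin L l2 w))) =
    mean P (fun w => expR (- lin X l1 w)) * mean P (fun w => expR (- lin L l2 w))) ->
  independent2 P (sigma_process X) (sigma_process L).
Proof.
move=> H; apply/independent2_paths => // A B mA mB.
pose XL (e : E + E) w := match e with inl t => X t w | inr t => L t w end.
pose XL2 (e : E + E) (z : T * T) := match e with inl t => X t z.1 | inr t => L t z.2 end.
have XL0 e w : 0 <= XL e w by case: e => t /=.
have XL20 e w : 0 <= XL2 e w by case: e => t /=.
have mXL : measurable_fun setT (path_of XL).
  by apply: measurable_path_of => -[t|t]; [exact: mX|exact: mL].
have mXL2 : measurable_fun setT (path_of XL2).
  apply: measurable_path_of => -[t|t]; first exact: measurableT_comp (mX t) measurable_fst.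
  exact: measurableT_comp (mL t) measurable_snd.
have mlinX l : measurable_fun setT (lin X l) by exact: measurable_lin.
have mlinL l : measurable_fun setT (lin L l) by exact: measurable_lin.
have mex (Y : T -> R) : measurable_fun setT Y -> measurable_fun setT (fun w => expR (- Y w)).
  by move=> mY; apply: measurableT_comp => //; apply: measurableT_comp.
have L12 l : (\int[P]_w (cst 1 w * expR (- pairing l (path_of XL w)))%:E =
    \int[(P \x P)%E]_z (cst 1 z * expR (- pairing l (path_of XL2 z)))%:E)%E.
  under eq_integral do rewrite mul1r pairing_path_of// /lin
    (big_lefts_rights (fun a e => a%:num * XL e _)).
  under [RHS]eq_integral do rewrite mul1r pairing_path_of// /lin
    (big_lefts_rights (fun a e => a%:num * XL2 e _)).
  transitivity (mean P (fun w => expR (- (lin X (lefts l) w + lin L (rights l) w))))%:E.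
    apply: mean_fin.
      by apply: mex; apply: measurable_funD; [exact: mlinX|exact: mlinL].
    by move=> w; apply: expRN_le1; apply: addr_ge0; exact: lin_ge0.
  rewrite H EFinM -(lin_exp_mean P _ pX) -(lin_exp_mean P _ pL).
  pose g (z : T * T) := expR (- (lin X (lefts l) z.1 + lin L (rights l) z.2)).
  have mg : measurable_fun setT (fun z => (g z)%:E).
    apply/measurable_EFinP; apply: measurableT_comp => //; apply: measurableT_comp => //.
    apply: measurable_funD.
      exact: measurableT_comp (mlinX _) measurable_fst.
    exact: measurableT_comp (mlinL _) measurable_snd.
  transitivity (\int[(P \x P)%E]_z (g z)%:E)%E; last by [].
  rewrite fubini_tonelli1//; last by move=> z; rewrite lee_fin expR_ge0.
  rewrite /fubini_F /g /=.
  under [RHS]eq_integral => w _.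
    under eq_integral do rewrite opprD expRD EFinM.
    rewrite ge0_integralZl_EFin ?expR_ge0//; last first.
      by apply/measurable_EFinP; apply: mex; exact: mlinL.
    over.
  rewrite ge0_integralZr//.
  - by apply/measurable_EFinP; apply: mex; exact: mlinX.
  - by apply: integral_ge0 => w _; rewrite lee_fin expR_ge0.
have F1 : (\int[P]_w (cst 1 w)%:E < +oo)%E.
  by rewrite (eq_integral (cst 1%E))// integral_cst// mul1e /= probability_setT ltry.
pose C : set (paths R (E + E)) :=
  (fun y => (fun t => y (inl t)) : paths R E) @^-1` A `&`
  (fun y => (fun t => y (inr t)) : paths R E) @^-1` B.
have minl : measurable_fun setT
    (fun y : paths R (E + E) => (fun t => y (inl t)) : paths R E).
  by apply: measurable_paths => t; exact: measurable_coord.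
have minr : measurable_fun setT
    (fun y : paths R (E + E) => (fun t => y (inr t)) : paths R E).
  by apply: measurable_paths => t; exact: measurable_coord.
have mC : measurable C.
  by apply: measurableI; rewrite -[X in measurable X]setTI; [exact: minl|exact: minr].
have mpX : measurable_fun setT (path_of X) by exact: measurable_path_of.
have mpL : measurable_fun setT (path_of L) by exact: measurable_path_of.
have mPA : measurable (path_of X @^-1` A) by rewrite -[X in measurable X]setTI; exact: mpX.
have mPB : measurable (path_of L @^-1` B) by rewrite -[X in measurable X]setTI; exact: mpL.
have U : (\int[P]_w ((cst 1%R w)%:E * (EFin \o (\1_C : paths R (E + E) -> R)) (path_of XL w)) =
    \int[(P \x P)%E]_z ((cst 1%R z)%:E * (EFin \o (\1_C : paths R (E + E) -> R)) (path_of XL2 z)))%E.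
  apply: laplace_paths_unique => //.
  - by apply/measurable_EFinP; exact: measurable_indic.
  - by move=> y; rewrite lee_fin.
transitivity (\int[P]_w (\1_(path_of X @^-1` A `&` path_of L @^-1` B) w)%:E)%E.
  by rewrite integral_indic ?setIT//; exact: measurableI.
transitivity (\int[(P \x P)%E]_z (\1_((path_of X @^-1` A) `*` (path_of L @^-1` B)) z)%:E)%E.
  transitivity (\int[P]_w ((cst 1%R w)%:E * (EFin \o (\1_C : paths R (E + E) -> R)) (path_of XL w)))%E.
    by apply: eq_integral => w _; rewrite mul1e /= -indic_preimage.
  by rewrite U; apply: eq_integral => w _; rewrite mul1e /= -indic_preimage.
rewrite integral_indic ?setIT//; last exact: measurableX.
exact: product_measure1E.
Qed.

End disjoint_independence.

(** * Decomposition at a point *)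

Section no_mass.
Context {R : realType} {E : Type} (nu : {measure set (paths R E) -> \bar R}).

(** A measurable set contained in [V] has the same mass for [nu] and for its restriction, so the
    inner approximations of the intersection with [V] serve for the restriction. *)
Lemma no_mass_mrestr (V : set (paths R E)) (mV : measurable V) :
  no_mass_at_zero nu -> no_mass_at_zero (mrestr nu mV).
Proof.
move=> nu0 A mA; apply/eqP; rewrite eq_le; apply/andP; split.
  rewrite [leLHS](_ : _ = inner_measure nu ((A `&` V) `\ zero_path)); last first.
    by apply: nu0; exact: measurableI.
  apply: ge_ereal_sup => _ [C [mC CA] <-]; apply: ereal_sup_ubound.
  exists C; last by rewrite /mrestr; congr (nu _); apply: setIidl => y /CA[[]].
  by split=> // y /CA[[Ay _] y0].
apply: ge_ereal_sup => _ [C [mC CA] <-].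
by apply: le_measure; rewrite ?inE// => y /CA[].
Qed.

End no_mass.

Lemma measurable_onem_expRN_pairing {R : realType} {E : Type} (l : seq ({nonneg R} * E)) :
  measurable_fun [set: paths R E] (fun y : paths R E => 1 - expR (- pairing l y)).
Proof.
apply: measurable_funB => //; apply: measurableT_comp => //.
by apply: measurableT_comp => //; exact: measurable_pairing.
Qed.

Section decomposition.
Context {R : realType} d (T : measurableType d) (P : probability T R).
Variable Z : subordinator P.
Variables (kappa : R) (rho : {measure set (measurableTypeR R) -> \bar R}).
Hypotheses (kappa_gt0 : 0 < kappa) (kappaE : 'E_P[Z (1%:nng)%R]%E = kappa%:E).
Hypothesis rhoE : driftless_levy_measure P (Z 1%:nng) rho.
Variable q : probability (measurableTypeR R) R.
Hypothesis qE : forall G : R -> \bar R, measurable_fun setT G -> (forall x, 0 <= G x)%E ->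
  (\int[q]_x ((kappa * posinv x)%:E * G x) = \int[rho]_(x in `]0%R, +oo[) G x)%E.
Variable f : R -> R.
Hypotheses (f_meas : measurable_fun setT f) (f_ge0 : forall u : R, 0 <= f u).
Hypothesis f_neg : forall u : R, u < 0 -> f u = 0.
Hypothesis I_fin : forall t : R, 0 < t -> (prim f t < +oo)%E.

Local Notation lam := (@lebesgue_measure R).
Local Notation Rp := (`[0%R, +oo[%classic : set R).
Local Notation conv := (stoch_conv_on Z f).

Lemma stoch_conv_funE : stoch_conv Z f = conv Rp.
Proof. by apply/funext => t; apply/funext => w; exact: stoch_convE. Qed.

Lemma conv_process (D : set R) : measurable D -> nonneg_process (conv D).
Proof. exact: stoch_conv_on_process. Qed.

Lemma conv_lin_laplace (D : set R) l : measurable D ->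
  mean P (fun w => expR (- lin (conv D) l w)) = expR (- conv_exponent Z f D l).
Proof. exact: (conv_laplace kappa_gt0 kappaE rhoE). Qed.

Section disjoint.
Variables D1 D2 : set R.
Hypotheses (mD1 : measurable D1) (mD2 : measurable D2).
Hypotheses (D10 : D1 `<=` Rp) (D20 : D2 `<=` Rp) (D12 : D1 `&` D2 = set0).

Lemma conv_testfun D l : measurable D -> testfun (sumcut id (conv_kernel f D) l).
Proof.
move=> mD; apply: testfun_sumcut.
- by move=> t; exact: measurable_conv_kernel.
- exact: conv_kernel_ge0.
- by move=> t; exact: conv_kernel_fin.
Qed.

(** The Laplace exponent vanishes at [0], so it is additive on functions of which one vanishes at
    each point. *)
Lemma sub_exponentD (h1 h2 : R -> R) : testfun h1 -> testfun h2 -> testfun (h1 \+ h2) ->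
  (forall s, h1 s = 0 \/ h2 s = 0) ->
  sub_exponent Z (h1 \+ h2) = sub_exponent Z h1 + sub_exponent Z h2.
Proof.
move=> t1 t2 t12 h12; apply: EFin_inj; rewrite EFinD.
apply: (etrans (esym (sub_exponent_fin kappa_gt0 kappaE rhoE t12))).
apply: (etrans _ (congr2 (fun u v => u + v)%E (sub_exponent_fin kappa_gt0 kappaE rhoE t1)
  (sub_exponent_fin kappa_gt0 kappaE rhoE t2))).
have h10 := testfun_ge0 t1; have h20 := testfun_ge0 t2.
have ml h : testfun h -> measurable_fun setT (fun s => (lexp Z (h s))%:E).
  case=> mh hh _ _; apply/measurable_EFinP.
  exact: (measurable_lexp rhoE mh hh).
rewrite -ge0_integralD//; [|by move=> s _; rewrite lee_fin (lexp_ge0 rhoE)|exact: ml|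
  by move=> s _; rewrite lee_fin (lexp_ge0 rhoE)|exact: ml].
apply: eq_integral => s _ /=; have [->|->] := h12 s.
  by rewrite (lexp0 rhoE) add0r add0e.
by rewrite (lexp0 rhoE) addr0 adde0.
Qed.

Let K (x : {nonneg R} + {nonneg R}) : R -> R :=
  match x with inl t => conv_kernel f D1 t | inr t => conv_kernel f D2 t end.
Let tm (x : {nonneg R} + {nonneg R}) : {nonneg R} :=
  match x with inl t => t | inr t => t end.
Let join (l1 l2 : seq ({nonneg R} * {nonneg R})) : seq ({nonneg R} * ({nonneg R} + {nonneg R})) :=
  [seq (p.1, inl p.2) | p <- l1] ++ [seq (p.1, inr p.2) | p <- l2].

(** Both convolutions form one family indexed by a sum type, to which [laplace_family] applies. Its
    test function splits into two with disjoint supports, hence the exponent splits. *)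
Lemma conv_disjoint_laplace l1 l2 :
  mean P (fun w => expR (- (lin (conv D1) l1 w + lin (conv D2) l2 w))) =
  mean P (fun w => expR (- lin (conv D1) l1 w)) *
  mean P (fun w => expR (- lin (conv D2) l2 w)).
Proof.
apply: (etrans _ (esym (congr2 *%R (conv_lin_laplace l1 mD1) (conv_lin_laplace l2 mD2)))).
have mK x : measurable_fun setT (K x).
  by case: x => t; exact: measurable_conv_kernel.
have K0 x s : 0 <= K x s by case: x => t; exact: conv_kernel_ge0.
have Kfin x : (\int[lam]_(s in `[0%R, (tm x)%:num]) (K x s)%:E < +oo)%E.
  by case: x => t; exact: conv_kernel_fin.
have := laplace_family kappa_gt0 kappaE rhoE mK K0 Kfin (join l1 l2).
have -> : (fun w => expR (- \sum_(p <- join l1 l2) p.1%:num * sub_integral Z (K p.2) (tm p.2) w)) =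
    (fun w => expR (- (lin (conv D1) l1 w + lin (conv D2) l2 w))).
  by apply/funext => w; rewrite /join big_cat !big_map.
move=> ->; rewrite -expRD -opprD; congr (expR (- _)).
have E : sumcut tm K (join l1 l2) =
    sumcut id (conv_kernel f D1) l1 \+ sumcut id (conv_kernel f D2) l2.
  by apply/funext => s; rewrite /sumcut /join big_cat !big_map.
have tE := testfun_sumcut mK K0 Kfin (join l1 l2).
rewrite E; rewrite E in tE; apply: sub_exponentD => //; [exact: conv_testfun..|].
move=> s; rewrite !sumcut_conv// !indicE.
have [sD1|_] := boolP (s \in D1); last by left; rewrite mul0r.
right; rewrite memNset ?mul0r// => sD2; rewrite inE in sD1.
by have : (D1 `&` D2) s by []; rewrite D12.
Qed.

Lemma conv_exponentU l :
  conv_exponent Z f (D1 `|` D2) l = conv_exponent Z f D1 l + conv_exponent Z f D2 l.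
Proof.
have mD : measurable (D1 `|` D2) by exact: measurableU.
have D0 : D1 `|` D2 `<=` Rp by move=> s [/D10|/D20].
have E : sumcut id (conv_kernel f (D1 `|` D2)) l =
    sumcut id (conv_kernel f D1) l \+ sumcut id (conv_kernel f D2) l.
  apply/funext => s; rewrite /= !sumcut_conv// -mulrDl; congr (_ * _).
  rewrite !indicE in_setU.
  have [sD1|_] := boolP (s \in D1); last by rewrite add0r.
  rewrite (memNset (A := D2)) ?addr0// => sD2; rewrite inE in sD1.
  by have : (D1 `&` D2) s by []; rewrite D12.
have tE := conv_testfun l mD.
rewrite /conv_exponent E; rewrite E in tE; apply: sub_exponentD => //; [exact: conv_testfun..|].
move=> s; rewrite !sumcut_conv// !indicE.
have [sD1|_] := boolP (s \in D1); last by left; rewrite mul0r.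
right; rewrite memNset ?mul0r// => sD2; rewrite inE in sD1.
by have : (D1 `&` D2) s by []; rewrite D12.
Qed.

Lemma conv_independent : independent2 P (sigma_process (conv D1)) (sigma_process (conv D2)).
Proof.
apply: independent2_laplace; [exact: conv_process..|exact: conv_disjoint_laplace].
Qed.

End disjoint.

Variable nu : {measure set (paths R {nonneg R}) -> \bar R}.
Hypothesis nuE : is_levy_measure P (stoch_conv Z f) nu.

Let mRp : measurable Rp. Proof. exact: measurable_itv. Qed.

Lemma nu_exponent l :
  (\int[nu]_y (1 - expR (- pairing l y))%:E = (conv_exponent Z f Rp l)%:E)%E.
Proof.
apply: levy_exponentE nuE _; rewrite stoch_conv_funE; first exact: conv_process.
exact: conv_lin_laplace.
Qed.

(** A first identification of [nu] with the image of the jumps, limited to paths seen by the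
    finitely many times of [l0], where the common exponent gives a finite weight. *)
Lemma nu_jumps l0 (F : paths R {nonneg R} -> \bar R) :
  measurable_fun setT F -> (forall y, 0 <= F y)%E ->
  (forall y, pairing l0 y = 0 -> F y = 0%E) ->
  (\int[nu]_y F y =
   \int[jumps q]_z ((jump_weight kappa Rp z)%:E * F (jump_map f z)))%E.
Proof.
move=> mF F0 Fsupp.
rewrite -(@levy_unique_supp _ _ _ _ _ _ nu (jumps q) (cst 1) (jump_weight kappa Rp) id (jump_map f)
  _ _ _ _ _ _ _ _ l0 F)//.
- by apply: eq_integral => y _; rewrite mul1e.
- exact: measurable_jump_weight.
- by move=> z; exact: jump_weight_ge0.
- exact: measurable_jump_map.
- by move=> l; under eq_integral do rewrite mul1r; rewrite nu_exponent ltry.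
- move=> l; under eq_integral do rewrite mul1r; rewrite nu_exponent.
  by rewrite (jumps_conv_exponent kappa_gt0 kappaE rhoE qE).
Qed.

Section at_point.
Variable a : {nonneg R}.

Let D := [set s : R | 0 <= s /\ f (a%:num - s) = 0].
Let Dc := [set s : R | 0 <= s] `\` D.

Lemma measurable_zeros : measurable D.
Proof.
have -> : D = Rp `&` (fun s => f (a%:num - s)) @^-1` [set 0].
  by apply/seteqP; split=> s; rewrite /D /= in_itv/= andbT.
apply: measurableI => //; rewrite -[X in measurable X]setTI.
exact: (measurable_shift f_meas).
Qed.

Let half_line : [set s : R | 0 <= s] = Rp.
Proof. by apply/seteqP; split=> s; rewrite /= in_itv/= andbT. Qed.

Lemma measurable_nonzeros : measurable Dc.
Proof. by apply: measurableD; [rewrite half_line|exact: measurable_zeros]. Qed.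

Let D_Rp : D `<=` Rp. Proof. by move=> s [s0 _]; rewrite /= in_itv/= andbT. Qed.
Let Dc_Rp : Dc `<=` Rp. Proof. by move=> s [s0 _]; rewrite /= in_itv/= andbT. Qed.
Let DDc : D `&` Dc = set0. Proof. by apply/seteqP; split=> s // [Ds [_ []]]. Qed.

Lemma conv_exponent_split l :
  conv_exponent Z f Rp l = conv_exponent Z f D l + conv_exponent Z f Dc l.
Proof.
apply: (etrans _ (conv_exponentU measurable_zeros measurable_nonzeros D_Rp Dc_Rp DDc l)).
congr (conv_exponent Z f _ l); rewrite -half_line.
apply/seteqP; split=> s; last by case=> [[]|[]].
by move=> s0; have [Ds|nDs] := pselect (D s); [left|right].
Qed.

(** The single time [a] detects all the paths concerned. For [x > 0] the path [x f(. - s)] is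
    positive at [a] exactly when [f (a - s)] is, so the indicator moves from the path to the time
    [s]. *)
Lemma levy_pos_jumps (F : paths R {nonneg R} -> \bar R) :
  measurable_fun setT F -> (forall y, 0 <= F y)%E ->
  (\int[levy_pos nu a]_y F y =
   \int[jumps q]_z ((jump_weight kappa Dc z)%:E * F (jump_map f z)))%E.
Proof.
move=> mF F0; rewrite integral_mrestr//.
pose pos := [set y : paths R {nonneg R} | 0 < (y a)%:num].
have mpos : measurable pos by exact: measurable_pos.
have mG : measurable_fun setT (fun y => (\1_pos y)%:E * F y)%E.
  by apply: emeasurable_funM => //; apply/measurable_EFinP; exact: measurable_indic.
rewrite (nu_jumps (l0 := [:: (posp 1, a)]) mG); last 2 first.
- by move=> y; rewrite mule_ge0// lee_fin.
- move=> y; rewrite /pairing big_seq1/= max_l// mul1r => ya.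
  by rewrite indicE memNset ?mul0e// /pos /= ya ltxx.
apply: eq_integral => -[s x] _; rewrite muleA -EFinM; congr (_%:E * _)%E.
rewrite /jump_weight /jump_map /=.
have [x0|x0] := boolP (0 < x); last first.
  have -> : posinv x = 0.
    rewrite /posinv indicE memNset ?mulr0//= in_itv/= andbT; exact/negP.
  by rewrite !mulr0 mul0r.
rewrite mulrAC; congr (_ * _); rewrite !indicE.
have [s0|s0] := boolP (0 <= s); last first.
  rewrite (memNset (A := Rp)); last by rewrite /= in_itv/= andbT; exact/negP.
  by rewrite mul0r (memNset (A := Dc))// => -[/= s1 _]; rewrite s1 in s0.
rewrite (mem_set (A := Rp)) ?mul1r; last by rewrite /= in_itv/= s0.
have posE : pos (jump_path f x s) = (0 < f (a%:num - s)) :> Prop.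
  by rewrite /pos /mkset /jump_path posp_num ?mulr_ge0 ?(ltW x0)// pmulr_rgt0.
congr ((nat_of_bool _)%:R); apply/idP/idP; rewrite !inE posE.
  by move=> fs; split=> // -[_ fs0]; rewrite fs0 ltxx in fs.
move=> [_ nD]; rewrite lt_neqAle f_ge0 andbT eq_sym.
by apply/eqP => fs; apply: nD; split.
Qed.

Lemma levy_pos_exponent l :
  (\int[levy_pos nu a]_y (1 - expR (- pairing l y))%:E = (conv_exponent Z f Dc l)%:E)%E.
Proof.
rewrite levy_pos_jumps; last 2 first.
- by apply/measurable_EFinP; exact: measurable_onem_expRN_pairing.
- by move=> y; rewrite lee_fin; have /andP[] := onem_expRN_itv (pairing_ge0 l y).
under eq_integral do rewrite -EFinM.
by rewrite (jumps_conv_exponent kappa_gt0 kappaE rhoE qE)//; exact: measurable_nonzeros.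
Qed.

(** Obtained by subtraction: the exponents of [nu] and of [levy_pos nu a] are known and finite,
    whereas paths vanishing at [a] are invisible to the time [a]. *)
Lemma levy_zero_exponent l :
  (\int[levy_zero nu a]_y (1 - expR (- pairing l y))%:E = (conv_exponent Z f D l)%:E)%E.
Proof.
have := nu_exponent l; rewrite conv_exponent_split.
have mG : measurable_fun setT (fun y : paths R {nonneg R} => (1 - expR (- pairing l y))%:E).
  by apply/measurable_EFinP; exact: measurable_onem_expRN_pairing.
have G0 (y : paths R {nonneg R}) : (0 <= (1 - expR (- pairing l y))%:E)%E.
  by rewrite lee_fin; have /andP[] := onem_expRN_itv (pairing_ge0 l y).
have -> : (\int[nu]_y (1 - expR (- pairing l y))%:E =
    \int[levy_zero nu a]_y (1 - expR (- pairing l y))%:E +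
    \int[levy_pos nu a]_y (1 - expR (- pairing l y))%:E)%E.
  rewrite !integral_mrestr// -ge0_integralD//.
  - apply: eq_integral => y _; rewrite !indicE.
    have [y0|y0] := boolP (0 < (y a)%:num).
      rewrite (memNset (A := [set y | _ = 0])) ?mul0e ?add0e; last first.
        by move=> /= ya; rewrite ya ltxx in y0.
      by rewrite mem_set// mul1e.
    rewrite (mem_set (A := [set y | _ = 0])) ?mul1e; last first.
      by apply/eqP; rewrite eq_le ge0 andbT leNgt.
    by rewrite memNset ?mul0e ?adde0//; exact/negP.
  - by move=> y _; rewrite mule_ge0// lee_fin.
  - apply: emeasurable_funM => //; apply/measurable_EFinP; apply: measurable_indic.
    exact: measurable_vanish.
  - by move=> y _; rewrite mule_ge0// lee_fin.
  - apply: emeasurable_funM => //; apply/measurable_EFinP; apply: measurable_indic.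
    exact: measurable_pos.
rewrite levy_pos_exponent EFinD.
(* The total is finite, which excludes an infinite value and allows cancelling. *)
by case: (\int[levy_zero nu a]_y _)%E => [r| |]//= -[] /addIr ->.
Qed.

Lemma conv_levy_decomposition : levy_decomposition P (conv D) (conv Dc) nu a.
Proof.
have mD := measurable_zeros; have mDc := measurable_nonzeros.
split; [exact: conv_process|exact: conv_process|exact: conv_independent|..].
  apply: is_levy_measure_laplace (conv_process mD) _ _ levy_zero_exponent.
    by apply: no_mass_mrestr; have [] := nuE.
  by move=> l; exact: conv_lin_laplace.
apply: is_levy_measure_laplace (conv_process mDc) _ _ levy_pos_exponent.
  by apply: no_mass_mrestr; have [] := nuE.
by move=> l; exact: conv_lin_laplace.
Qed.

Lemma levy_decomposition_laws d' (T' : measurableType d') (P' : probability T' R)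
    (X L : {nonneg R} -> T' -> R) : levy_decomposition P' X L nu a ->
  [/\ same_law P (stoch_conv Z f) P' (fun t w => X t w + L t w),
      same_law P' X P (conv D) & same_law P' L P (conv Dc)].
Proof.
move=> [pX pL XL nX nL].
have mD := measurable_zeros; have mDc := measurable_nonzeros.
have XE l : mean P' (fun w => expR (- lin X l w)) = expR (- conv_exponent Z f D l).
  by apply: EFin_inj; rewrite (levy_laplace l pX nX) levy_zero_exponent.
have LE l : mean P' (fun w => expR (- lin L l w)) = expR (- conv_exponent Z f Dc l).
  by apply: EFin_inj; rewrite (levy_laplace l pL nL) levy_pos_exponent.
split.
- rewrite stoch_conv_funE; apply: same_law_laplace; first exact: conv_process.
    move=> t; split; first by apply: measurable_funD; [have [] := pX t|have [] := pL t].
    by move=> w; rewrite addr_ge0//; [have [_] := pX t|have [_] := pL t].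
  move=> l; rewrite conv_lin_laplace// conv_exponent_split.
  have -> : (fun w => expR (- lin (fun t w => X t w + L t w) l w)) =
      (fun w => expR (- (lin X l w + lin L l w))).
    apply/funext => w; congr (expR (- _)); rewrite /lin -big_split/=.
    by apply: eq_bigr => p _; rewrite mulrDr.
  by rewrite (mean_independent2 pX pL)// XE LE -expRD -opprD.
- apply: same_law_laplace => //; first exact: conv_process.
  by move=> l; rewrite XE conv_lin_laplace.
- apply: same_law_laplace => //; first exact: conv_process.
  by move=> l; rewrite LE conv_lin_laplace.
Qed.

Lemma levy_pos_integral (F : paths R {nonneg R} -> \bar R) :
  measurable_fun setT F -> (forall y, 0 <= F y)%E ->
  (\int[levy_pos nu a]_y F y =
   \int[lam]_(s in Dc) \int[rho]_(x in `]0%R, +oo[) F (jump_path f x s))%E.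
Proof.
move=> mF F0; rewrite levy_pos_jumps//.
rewrite (jumps_integral kappa_gt0 qE measurable_nonzeros (G := fun z => F (jump_map f z)))//.
by apply: measurableT_comp => //; exact: measurable_jump_map.
Qed.

End at_point.

End decomposition.

(** * Essential covering of the half-line by translates *)

Section countable_dependence.
Context {R : realType} {E : Type} (e0 : E).

(** One sequence enumerating all [J i j] through a coding of pairs; [e0] is the value at numbers
    that code no pair. *)
Definition interleave (J : nat -> nat -> E) (n : nat) : E :=
  if choice.unpickle n is Some p then J (p : nat * nat).1 p.2 else e0.

Lemma interleaveE J i j : exists n, interleave J n = J i j.
Proof. by exists (choice.pickle (i, j)); rewrite /interleave choice.pickleK. Qed.

(** Sets determined by countably many coordinates form a sigma-algebra, since countably many
    sequences merge into one, and it contains the cylinders. *)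
Lemma measurable_depends (A : set (paths R E)) : measurable A ->
  exists J : nat -> E, forall y y' : paths R E,
    (forall n, y (J n) = y' (J n)) -> A y -> A y'.
Proof.
apply: (@smallest_sub _ (sigma_algebra setT) (@cylinders R E) [set A | exists J : nat -> E,
  forall y y' : paths R E, (forall n, y (J n) = y' (J n)) -> A y -> A y']).
  split.
  - by exists (fun=> e0).
  - move=> B [J JB]; exists J => y y' yy' [_ nBy]; split=> // By'.
    by apply: nBy; apply: JB By' => n; rewrite yy'.
  - move=> F FJ; have /choice[J JF] : forall i, exists J : nat -> E,
      forall y y' : paths R E, (forall n, y (J n) = y' (J n)) -> F i y -> F i y' by [].
    exists (interleave J) => y y' yy' [i _ Fy]; exists i => //.
    by apply: JF Fy => n; have [m <-] := interleaveE J i n.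
by move=> _ [x [B [mB ->]]]; exists (fun=> x) => y y' yy' /=; rewrite (yy' 0%N).
Qed.

End countable_dependence.

Section covering.
Context {R : realType}.
Variable f : R -> R.
Hypotheses (f_meas : measurable_fun setT f) (f_ge0 : forall u : R, 0 <= f u).
Hypothesis f_neg : forall u : R, u < 0 -> f u = 0.

Local Notation lam := (@lebesgue_measure R).
Local Notation Rp := (`[0%R, +oo[%classic : set R).

Hypothesis f_pos : (0 < \int[lam]_s (f s)%:E)%E.

Definition uncovered (C : nat -> {nonneg R}) : set (measurableTypeR R) :=
  [set s | 0 <= s /\ forall n, f ((C n)%:num - s) = 0].

Lemma measurable_uncovered C : measurable (uncovered C).
Proof.
have -> : uncovered C = Rp `&` \bigcap_n ((fun s => f ((C n)%:num - s)) @^-1` [set 0]).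
  apply/seteqP; split=> s; rewrite /uncovered /= in_itv/= andbT => -[s0 h]; split=> // n.
    by move=> _; exact: h.
  exact: (h n Logic.I).
apply: measurableI; first exact: measurable_itv.
apply: bigcapT_measurable => n; rewrite -[X in measurable X]setTI.
exact: (measurable_shift f_meas).
Qed.

(** Merging a minimising sequence of covers gives one cover whose uncovered set lies in all of
    theirs, so the infimum is attained. *)
Lemma minimal_cover (mu : {measure set (measurableTypeR R) -> \bar R}) :
  (mu setT < +oo)%E ->
  exists C, forall C', (mu (uncovered C) <= mu (uncovered C'))%E.
Proof.
move=> muT; pose S := [set mu (uncovered C) | C in setT].
have Sfin : ereal_inf S \is a fin_num.
  rewrite ge0_fin_numE; last by apply/ereal_infP => _ [C _ <-]; exact: measure_ge0.
  apply: le_lt_trans muT; apply: ge_ereal_inf; exists (mu (uncovered (fun=> posp 0))).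
    by exists (fun=> posp 0).
  by apply: le_measure; rewrite ?inE//; exact: measurable_uncovered.
have /choice[C CS] : forall n, exists C, (mu (uncovered C) < ereal_inf S + (n.+1%:R^-1)%:E)%E.
  move=> n; have [//|_ [C _ <-] h] := @lb_ereal_inf_adherent _ S n.+1%:R^-1 _ Sfin.
  by exists C.
exists (interleave (posp 0) C) => C'.
apply: (@le_trans _ _ (ereal_inf S)); last by apply: ereal_inf_lbound; exists C'.
apply/lee_addgt0Pr => e e_gt0.
have [n ne] : exists n : nat, n.+1%:R^-1 < e.
  have /archi_boundP h : 0 <= e^-1 by rewrite invr_ge0 ltW.
  exists (Num.bound e^-1); rewrite invf_plt ?posrE//.
  by apply: lt_trans h _; rewrite ltr_nat.
apply: (@le_trans _ _ (mu (uncovered (C n)))).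
  apply: le_measure; rewrite ?inE; [exact: measurable_uncovered..|].
  by move=> s [s0 sC]; split=> // j; have [m <-] := interleaveE (posp 0) C n j.
apply: le_trans (ltW (CS n)) _; rewrite leeD2l// lee_fin; exact: ltW.
Qed.

(* Adding one more point [c] to a minimal cover does not decrease the mass of
   the uncovered set [N], hence [f (c - s) = 0] for almost every [s] in [N];
   integrating over [c] then gives [mu N * \int f = 0]. *)
Lemma essential_cover : exists C : nat -> {nonneg R},
  {ae lam, forall s, 0 <= s -> exists n, 0 < f ((C n)%:num - s)}.
Proof.
(* Any positive integrable density on the half-line would do: it makes the measure finite without
   changing the null sets there. *)
pose w : R -> R := exponential_pdf 1.
have mw : measurable_fun setT w by exact: measurable_exponential_pdf.
have w0 s : 0 <= w s by exact: exponential_pdf_ge0.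
have [mu [muE muI]] := @weighted_image _ _ (measurableTypeR R) (measurableTypeR R) R lam
  w id mw w0 (@measurable_id _ _ _).
have muT : (mu setT < +oo)%E.
  by rewrite muE//= preimage_setT integral_exponential_pdf// ltry.
have [C minC] := minimal_cover muT; exists C.
pose N := uncovered C; have mN : measurable N := measurable_uncovered C.
have mfc (c : R) : measurable_fun setT (fun s : measurableTypeR R => f (c - s)).
  exact: measurable_shift.
have Nc (c : R) : mu (N `&` (fun s => f (c - s)) @^-1` ~` [set 0]) = 0%E.
  have mA : measurable ((fun s : measurableTypeR R => f (c - s)) @^-1` ~` [set 0]).
    by rewrite -[X in measurable X]setTI; apply: mfc => //; exact: measurableC.
  (* Negative [c] are no admissible times, but the integral over [c] runs over the whole line; there
     [f (c - s)] vanishes for [s >= 0]. *)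
  have [c0|c0] := ltP c 0.
    rewrite (_ : _ `&` _ = set0) ?measure0//; apply/seteqP; split=> s // [[s0 _]] /=.
    by rewrite f_neg// subr_lt0 (lt_le_trans c0).
  (* The cover [C] with the time [c] put in front. *)
  pose C' n := if n is m.+1 then C m else posp c.
  have := minC C'; rewrite -/N (measureDI mu mN mA).
  have -> : uncovered C' = N `\` (fun s => f (c - s)) @^-1` ~` [set 0].
    have cE : (posp c)%:num = c by rewrite posp_num.
    apply/seteqP; split=> s.
      move=> [s0 sC]; split; first by split=> // n; exact: (sC n.+1).
      by apply; have := sC 0%N; rewrite /C' cE.
    move=> [[s0 sC] nf]; split=> // -[|n]; last exact: sC.
    by rewrite /C' cE; apply: contrapT => h; exact: nf.
  have : mu (N `\` (fun s => f (c - s)) @^-1` ~` [set 0]) \is a fin_num.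
    rewrite ge0_fin_numE//; apply: le_lt_trans muT.
    by apply: le_measure; rewrite ?inE//; exact: measurableD.
  move=> fin; rewrite -[leRHS]adde0 leeD2lE// => h.
  by apply: le_anti; rewrite h measure_ge0.
pose g (c s : R) := (w s * \1_N s * f (c - s))%:E.
have mg : measurable_fun setT (fun z : measurableTypeR R * measurableTypeR R => g z.1 z.2).
  apply/measurable_EFinP; apply: measurable_funM; first apply: measurable_funM.
  - by apply: (measurableT_comp mw); exact: measurable_snd.
  - apply: (measurableT_comp (f := (\1_N : R -> R))); last exact: measurable_snd.
    exact: measurable_indic.
  - apply: (measurableT_comp f_meas); apply: measurable_funB; first exact: measurable_fst.
    exact: measurable_snd.
have g0 z : (0 <= g z.1 z.2)%E by rewrite lee_fin !mulr_ge0.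
(* With [s] inside, the integral vanishes by [Nc]; with [c] inside, translation invariance leaves
   [w s * \1_N s] times the integral of [f]. *)
have := @fubini_tonelli _ _ _ _ R lam lam (fun z => g z.1 z.2) mg g0.
rewrite /= [X in X = _ -> _]integral0_eq; last first.
  move=> c _; transitivity (\int[mu]_s (\1_N s * f (c - s))%:E)%E.
    rewrite muI//; last 2 first.
    - by apply/measurable_EFinP; apply: measurable_funM => //; exact: measurable_indic.
    - by move=> s; rewrite lee_fin mulr_ge0.
    by apply: eq_integral => s _; rewrite /g -EFinM mulrA.
  transitivity (\int[mu]_s `|(\1_N s * f (c - s))%:E|)%E.
    by apply: eq_integral => s _; rewrite gee0_abs// lee_fin mulr_ge0.
  apply/ae_eq_integral_abs => //.
    by apply/measurable_EFinP; apply: measurable_funM => //; exact: measurable_indic.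
  exists (N `&` (fun s => f (c - s)) @^-1` ~` [set 0]); split=> //.
    apply: measurableI => //; rewrite -[X in measurable X]setTI; apply: mfc => //.
    exact: measurableC.
  move=> s /=; rewrite not_implyE => -[_]; rewrite indicE => h; split.
    by apply: contrapT => sN; apply: h; rewrite memNset// mul0r.
  by move=> fs; apply: h; rewrite fs mulr0.
move=> /esym wN0.
have {}wN0 : (\int[lam]_s (w s * \1_N s)%:E = 0)%E.
  move: wN0; rewrite (_ : (fun y => _) = (fun s => (w s * \1_N s)%:E * \int[lam]_s (f s)%:E)%E).
    rewrite ge0_integralZr//; last 3 first.
    - by apply/measurable_EFinP; apply: measurable_funM => //; exact: measurable_indic.
    - by move=> s _; rewrite lee_fin mulr_ge0.
    - by apply: integral_ge0 => s _; rewrite lee_fin.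
    by move/eqP; rewrite mule_eq0 (gt_eqF f_pos) orbF => /eqP.
  apply/funext => s; rewrite /g.
  under eq_integral do rewrite EFinM.
  rewrite ge0_integralZl_EFin//; last 3 first.
  - by move=> c _; rewrite lee_fin.
  - apply/measurable_EFinP; apply: (measurableT_comp f_meas).
    by apply: measurable_funB.
  - by rewrite mulr_ge0.
  congr (_ * _)%E; apply: (lebesgue_integral_shift s (h := EFin \o f)).
    exact/measurable_EFinP.
  by move=> u; rewrite lee_fin.
have : (\int[lam]_s `|(w s * \1_N s)%:E| = 0)%E.
  by rewrite -[RHS]wN0; apply: eq_integral => s _; rewrite gee0_abs// lee_fin mulr_ge0.
move/ae_eq_integral_abs => /(_ measurableT)[].
  by apply/measurable_EFinP; apply: measurable_funM => //; exact: measurable_indic.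
move=> M [mM M0 subM]; exists M; split=> // s /=; rewrite not_implyE => -[s0 nC].
apply: subM => /= /(_ Logic.I) [].
rewrite indicE mem_set ?mulr1; last first.
  split=> // n; apply/eqP; rewrite eq_le f_ge0 andbT leNgt; apply/negP => h.
  by apply: nC; exists n.
(* The density is positive at [s >= 0], so an uncovered [s] contradicts the vanishing of
   [w s * \1_N s]. *)
rewrite /w exponential_pdfE// mul1r => e0.
by have := expR_gt0 (-1 * s); rewrite e0 ltxx.
Qed.

End covering.

(** * The Levy measure of the stochastic convolution *)

Section laws_of_variables.
Context {R : realType} d (T : measurableType d) (P : probability T R).

Lemma integral_law (V : T -> measurableTypeR R) (q : {measure set (measurableTypeR R) -> \bar R})
    (G : measurableTypeR R -> \bar R) :
  measurable_fun setT V ->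
  (forall A : set (measurableTypeR R), measurable A -> P (V @^-1` A) = q A) ->
  measurable_fun setT G -> (forall x, 0 <= G x)%E ->
  (\int[P]_w G (V w) = \int[q]_x G x)%E.
Proof.
move=> mV Vq mG G0.
transitivity (\int[P]_w ((cst 1%R w)%:E * G (V w)))%E.
  by apply: eq_integral => w _; rewrite mul1e.
transitivity (\int[q]_x ((cst 1%R x)%:E * G (id x)))%E; last first.
  by apply: eq_integral => w _; rewrite mul1e.
apply: (@weighted_integral_eq _ _ _ (measurableTypeR R) T (measurableTypeR R) R) => // A mA.
rewrite (eq_integral (fun w => (\1_(V @^-1` A) w)%:E)); last first.
  by move=> w _; rewrite mul1r indic_preimage.
rewrite [RHS](eq_integral (fun w => (\1_A w)%:E)); last by move=> w _; rewrite mul1r.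
have mVA : measurable (V @^-1` A) by rewrite -[X in measurable X]setTI; exact: mV.
by rewrite !integral_indic// !setIT; exact: Vq.
Qed.

Lemma integral_density (U : T -> measurableTypeR R) (w : R -> R)
    (G : measurableTypeR R -> \bar R) :
  measurable_fun setT U -> measurable_fun setT w -> (forall s, 0 <= w s) ->
  (forall A : set (measurableTypeR R), measurable A ->
     P (U @^-1` A) = \int[@lebesgue_measure R]_(s in A) (w s)%:E)%E ->
  measurable_fun setT G -> (forall x, 0 <= G x)%E ->
  (\int[P]_x G (U x) = \int[@lebesgue_measure R]_s ((w s)%:E * G s))%E.
Proof.
move=> mU mw w0 Uw mG G0.
have [mu [muE muI]] := @weighted_image _ _ (measurableTypeR R) (measurableTypeR R) R
  (@lebesgue_measure R) w id mw w0 (@measurable_id _ _ _).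
rewrite -(muI _ mG G0); apply: integral_law => // A mA.
by rewrite (muE _ mA) Uw.
Qed.

Lemma size_biased_gt0 (V : T -> R) (kappa : R)
    (rho : {measure set (measurableTypeR R) -> \bar R}) :
  measurable_fun setT V -> has_size_biased_law P V kappa rho ->
  {ae P, forall w, 0 < V w}.
Proof.
move=> mV Vlaw; exists (V @^-1` `]-oo, 0%R]); split.
- by rewrite -[X in measurable X]setTI; exact: mV.
- rewrite Vlaw// (_ : _ `&` _ = set0) ?integral_set0//.
  by apply/seteqP; split=> x //= []; rewrite !in_itv/= andbT leNgt => /negP.
- by move=> w /= /negP; rewrite -leNgt in_itv.
Qed.

End laws_of_variables.

(** * Identification of [nu] on all measurable functionals *)

Section global.
Context {R : realType} d (T : measurableType d) (P : probability T R).
Variable Z : subordinator P.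
Variables (kappa : R) (rho : {measure set (measurableTypeR R) -> \bar R}).
Hypotheses (kappa_gt0 : 0 < kappa) (kappaE : 'E_P[Z (1%:nng)%R]%E = kappa%:E).
Hypothesis rhoE : driftless_levy_measure P (Z 1%:nng) rho.
Variable q : probability (measurableTypeR R) R.
Hypothesis qE : forall G : R -> \bar R, measurable_fun setT G -> (forall x, 0 <= G x)%E ->
  (\int[q]_x ((kappa * posinv x)%:E * G x) = \int[rho]_(x in `]0%R, +oo[) G x)%E.
Variable f : R -> R.
Hypotheses (f_meas : measurable_fun setT f) (f_ge0 : forall u : R, 0 <= f u).
Hypothesis f_neg : forall u : R, u < 0 -> f u = 0.
Hypothesis I_fin : forall t : R, 0 < t -> (prim f t < +oo)%E.
Variable nu : {measure set (paths R {nonneg R}) -> \bar R}.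
Hypothesis nuE : is_levy_measure P (stoch_conv Z f) nu.
Hypothesis f_pos : exists t : R, 0 < t /\ (0 < prim f t)%E.

Local Notation lam := (@lebesgue_measure R).
Local Notation Rp := (`[0%R, +oo[%classic : set R).
Local Notation Y := (paths R {nonneg R}).

Let mRp : measurable Rp. Proof. exact: measurable_itv. Qed.

Let mwF (F : Y -> \bar R) : measurable_fun setT F ->
  measurable_fun setT (fun z => (jump_weight kappa Rp z)%:E * F (jump_map f z))%E.
Proof.
move=> mF; apply: emeasurable_funM.
  by apply/measurable_EFinP; exact: measurable_jump_weight.
by apply: measurableT_comp => //; exact: measurable_jump_map.
Qed.

Let wF0 (F : Y -> \bar R) : (forall y, 0 <= F y)%E ->
  forall z, (0 <= (jump_weight kappa Rp z)%:E * F (jump_map f z))%E.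
Proof. by move=> F0 z; rewrite mule_ge0// lee_fin jump_weight_ge0. Qed.

(** If [f] were null on the half-line, [nu] would be zero while the image of the jumps would have
    infinite mass; positivity of this integral is what the covering argument consumes. *)
Lemma integral_f_gt0 : (0 < \int[lam]_s (f s)%:E)%E.
Proof.
have [t [t0 ft]] := f_pos; apply: lt_le_trans ft _.
apply: ge0_subset_integral => //.
- exact/measurable_EFinP.
- by move=> s _; rewrite lee_fin.
Qed.

Section cover.
Variable C : nat -> {nonneg R}.
Hypothesis coverC : {ae lam, forall s, 0 <= s -> exists n, 0 < f ((C n)%:num - s)}.

(** For almost every [s] some [f (C n - s)] is positive, so for every [x > 0] the jump path is
    nonzero at [C n] and [F] vanishes on it. *)
Lemma jumps_off_cover (F : Y -> \bar R) :
  measurable_fun setT F -> (forall y, 0 <= F y)%E ->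
  (forall y n, 0 < (y (C n))%:num -> F y = 0%E) ->
  (\int[jumps q]_z ((jump_weight kappa Rp z)%:E * F (jump_map f z)) = 0)%E.
Proof.
move=> mF F0 FC; rewrite fubini_tonelli1; [|exact: mwF|exact: wF0].
pose h (z : measurableTypeR R * measurableTypeR R) :=
  ((jump_weight kappa Rp z)%:E * F (jump_map f z))%E.
pose H := fubini_F q h.
have H0 s : (0 <= H s)%E by apply: integral_ge0 => x _; exact: wF0.
transitivity (\int[lam]_s `|H s|)%E.
  by apply: eq_integral => s _; rewrite gee0_abs.
apply/ae_eq_integral_abs => //.
  by apply: measurable_fun_fubini_tonelli_F; [exact: mwF|exact: wF0].
have [M [mM M0 subM]] := coverC; exists M; split=> // s /= nH.
apply: subM => /= Cs; apply: nH => _.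
rewrite /H /fubini_F integral0_eq// => x _; rewrite /h /jump_weight /=.
have [s0|s0] := boolP (0 <= s); last first.
  by rewrite indicE memNset ?mul0r ?mul0e//= in_itv/= andbT; exact/negP.
have [x0|x0] := boolP (0 < x); last first.
  have -> : posinv x = 0.
    rewrite /posinv indicE memNset ?mulr0//= in_itv/= andbT; exact/negP.
  by rewrite !mulr0 mul0e.
have [n fn] := Cs s0; rewrite (FC _ n) ?mule0// /jump_map /jump_path posp_num ?mulr_gt0//.
by rewrite mulr_ge0// ltW.
Qed.

(** By inner regularity at the zero path, it suffices to treat a measurable [B] inside [A] that
    avoids [zero_path]. Such a [B] depends on a sequence of times [J], and each part of [B] seen by
    one [J m] is null by comparison with the jumps. *)
Lemma levy_off_cover (A : set Y) : measurable A ->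
  (forall y n, A y -> (y (C n))%:num = 0) -> nu A = 0%E.
Proof.
move=> mA AC; have [_ /(_ A mA) ->] := nuE.
apply/eqP; rewrite eq_le; apply/andP; split; last first.
  apply: ereal_sup_ubound; exists set0; last by rewrite measure0.
  by split.
apply: ge_ereal_sup => _ [B [mB BA] <-].
have [J BJ] := measurable_depends (posp 0) mB.
pose Bm m := B `&` [set y : Y | 0 < (y (J m))%:num].
have mBm m : measurable (Bm m) by apply: measurableI => //; exact: measurable_pos.
have Bm0 m : nu (Bm m) = 0%E.
  rewrite -[Bm m]setIT -integral_indic//.
  have mF : measurable_fun setT (fun y : Y => (\1_(Bm m) y : R)%:E).
    by apply/measurable_EFinP; exact: measurable_indic.
  rewrite (nu_jumps kappa_gt0 kappaE rhoE qE f_meas f_ge0 f_neg I_fin nuE (l0 := [:: (posp 1, J m)]) mF).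
  - apply: (jumps_off_cover mF) => [y|y n yn]; first by rewrite lee_fin.
    by rewrite indicE memNset// => -[/BA[Ay _] _]; rewrite (AC _ n Ay) ltxx in yn.
  - by move=> y; rewrite lee_fin.
  - move=> y; rewrite /pairing big_seq1/= max_l// mul1r => yJ.
    by rewrite indicE memNset// => -[_]; rewrite /= yJ ltxx.
(* A path of [B] vanishing along [J] agrees there with [zero_path], which would then belong to
   [B]. *)
have BE : B = \bigcup_m Bm m.
  apply/seteqP; split=> y; last by case=> m _ [].
  move=> By; apply: contrapT => nBm; have [_ nz] := BA _ By.
  have : B zero_path.
    apply: (BJ y _ _ By) => n; apply/val_inj => /=.
    apply/eqP; rewrite eq_le ge0 andbT leNgt; apply/negP => h.
    by apply: nBm; exists n => //; split.
  by move=> /BA[_]; apply.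
rewrite (_ : nu B = 0%E)//; apply: measure_negligible => //; rewrite BE.
by apply: negligible_bigcup => m; apply/(negligibleP nu (mBm m)); exact: Bm0.
Qed.

End cover.

(** A measurable [A] is cut in two: the part [U] seen by [C] is an increasing limit of parts seen by
    finitely many times, where [nu_jumps] applies, and the remainder is null for both measures. *)
Lemma nu_integral (F : Y -> \bar R) :
  measurable_fun setT F -> (forall y, 0 <= F y)%E ->
  (\int[nu]_y F y =
   \int[jumps q]_z ((jump_weight kappa Rp z)%:E * F (jump_map f z)))%E.
Proof.
move=> mF F0.
have [C coverC] := essential_cover f_meas f_ge0 f_neg integral_f_gt0.
have mw : measurable_fun setT (jump_weight kappa Rp) by exact: measurable_jump_weight.
have w0 z : 0 <= jump_weight kappa Rp z by exact: jump_weight_ge0.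
have mj := measurable_jump_map f_meas.
have [M [_ MI]] := weighted_image (jumps q) mw w0 mj.
have mI (A : set Y) : measurable A -> measurable_fun setT (fun y : Y => (\1_A y : R)%:E).
  by move=> mA; apply/measurable_EFinP; exact: measurable_indic.
have I0 (A : set Y) y : (0 <= (\1_A y : R)%:E)%E by rewrite lee_fin.
have ME A : measurable A ->
    M A = (\int[jumps q]_z ((jump_weight kappa Rp z)%:E * (\1_A (jump_map f z) : R)%:E))%E.
  move=> mA; rewrite -[A in M A]setIT -integral_indic//; apply: MI; [exact: mI|exact: I0].
rewrite -MI//; apply: eq_measure_integral => A mA _.
pose l n := [seq (posp (1 : R), C i) | i <- iota 0 n].
pose V n := [set y : Y | 0 < pairing (l n) y].
have mV n : measurable (V n).
  have -> : V n = setT `&` (fun y : Y => pairing (l n) y) @^-1` `]0, +oo[%classic.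
    by rewrite setTI; apply/seteqP; split=> y; rewrite /V /= in_itv/= andbT.
  by apply: (measurable_pairing (l n)) => //; exact: measurable_itv.
have mAV n : measurable (A `&` V n) by exact: measurableI.
have pE n (y : Y) : pairing (l n) y = \sum_(i <- iota 0 n) (y (C i))%:num.
  by rewrite /pairing /l big_map; apply: eq_bigr => i _; rewrite /= max_l// mul1r.
have ndV : nondecreasing_seq (fun n => A `&` V n).
  move=> m n mn; rewrite subsetEset => y [Ay Vy]; split=> //; move: Vy.
  rewrite /V /= !pE => /lt_le_trans; apply.
  by rewrite -(subnKC mn) iotaD big_cat/= lerDl sumr_ge0.
have AVE n : nu (A `&` V n) = M (A `&` V n).
  rewrite (ME _ (mAV n)) -[X in nu X]setIT -integral_indic//.
  apply: (nu_jumps kappa_gt0 kappaE rhoE qE f_meas f_ge0 f_neg I_fin nuE (l0 := l n) (mI _ (mAV n))).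
    by move=> y; exact: I0.
  by move=> y y0; rewrite indicE memNset// => -[_]; rewrite /V /= y0 ltxx.
pose U := \bigcup_n (A `&` V n).
have mU : measurable U by exact: bigcupT_measurable.
have UE : nu U = M U.
  have c1 := nondecreasing_cvg_mu (mu := nu) mAV mU ndV.
  have c2 := nondecreasing_cvg_mu (mu := M) mAV mU ndV.
  have : nu \o (fun n => A `&` V n) = M \o (fun n => A `&` V n).
    by apply/funext => n; exact: AVE.
  by move=> E; rewrite E in c1; exact: (cvg_unique _ c1 c2).
have UA : A `&` U = U by apply/seteqP; split=> y; [case|case=> n _ [Ay Vy]; split=> //; exists n].
have mAU : measurable (A `\` U) by exact: measurableD.
have offU y n : (A `\` U) y -> (y (C n))%:num = 0.
  move=> [Ay nU]; apply/eqP; rewrite eq_le ge0 andbT leNgt; apply/negP => h.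
  apply: nU; exists n.+1 => //; split=> //; rewrite /V /= pE -addn1 iotaD big_cat/= big_seq1 add0n.
  by rewrite ltr_wpDl// sumr_ge0.
have mD1 := measureDI nu mA mU; have mD2 := measureDI M mA mU.
rewrite UA in mD1 mD2.
apply: (etrans mD1); apply: (etrans _ (esym mD2)).
apply: (congr2 (fun u v => u + v)%E); last exact: UE.
apply: (etrans (levy_off_cover coverC mAU offU)).
apply: (etrans _ (esym (ME _ mAU))).
apply: esym; apply: (jumps_off_cover coverC (mI _ mAU) (I0 (A `\` U))).
by move=> y n yn; rewrite indicE memNset// => AUy; rewrite (offU y n AUy) ltxx in yn.
Qed.

(** For [x > 0] the jump path vanishes at [a] exactly when [f (a - s) = 0]. Detecting such paths
    takes times other than [a], hence the recourse to [nu_integral]. *)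
Lemma levy_zero_integral (a : {nonneg R}) (F : Y -> \bar R) :
  measurable_fun setT F -> (forall y, 0 <= F y)%E ->
  (\int[levy_zero nu a]_y F y =
   \int[lam]_(s in [set s | (0 <= s)%R /\ f (a%:num - s) = 0%R])
     \int[rho]_(x in `]0%R, +oo[) F (jump_path f x s))%E.
Proof.
move=> mF F0; have mD := measurable_zeros f_meas a.
rewrite -(jumps_integral kappa_gt0 qE mD (G := fun z => F (jump_map f z))); last 2 first.
- by apply: measurableT_comp => //; exact: measurable_jump_map.
- by move=> z; exact: F0.
rewrite integral_mrestr//.
pose zer := [set y : Y | (y a)%:num = 0].
have mzer : measurable zer by exact: measurable_vanish.
rewrite nu_integral; last 2 first.
- by apply: emeasurable_funM => //; apply/measurable_EFinP; exact: measurable_indic.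
- by move=> y; rewrite mule_ge0// lee_fin.
apply: eq_integral => -[s x] _; rewrite muleA -EFinM; congr (_%:E * _)%E.
rewrite /jump_weight /jump_map /=.
have [x0|x0] := boolP (0 < x); last first.
  have -> : posinv x = 0.
    rewrite /posinv indicE memNset ?mulr0//= in_itv/= andbT; exact/negP.
  by rewrite !mulr0 mul0r.
rewrite mulrAC; congr (_ * _); rewrite !indicE.
have [s0|s0] := boolP (0 <= s); last first.
  rewrite (memNset (A := Rp)); last by rewrite /= in_itv/= andbT; exact/negP.
  by rewrite mul0r (memNset (A := [set s | _]))// => -[/= s1 _]; rewrite s1 in s0.
rewrite (mem_set (A := Rp)) ?mul1r; last by rewrite /= in_itv/= s0.
have zerE : zer (jump_path f x s) = (f (a%:num - s) = 0) :> Prop.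
  rewrite /zer /mkset /jump_path posp_num ?mulr_ge0 ?(ltW x0)//.
  apply/propext; split=> [/eqP|->]; last by rewrite mulr0.
  by rewrite mulf_eq0 (gt_eqF x0) => /eqP.
congr ((nat_of_bool _)%:R); apply/idP/idP; rewrite !inE.
  move=> H; split=> //; have : zer (jump_path f x s) := H.
  by rewrite zerE.
by move=> [_ H]; suff : zer (jump_path f x s) by []; rewrite zerE.
Qed.

(** * Representation with an exponential time *)

Section exponential_representation.
Context (theta : R) d' (T' : measurableType d') (P' : probability T' R).
Variables (V U : {RV P' >-> R}).
Hypothesis theta_gt0 : 0 < theta.
Hypothesis Vlaw : has_size_biased_law P' V kappa rho.
Hypothesis qlaw : forall A, measurable A ->
  q A = (\int[rho]_(x in A `&` `]0%R, +oo[) (kappa^-1 * x)%:E)%E.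
Hypothesis Ulaw : forall A : set R, measurable A ->
  P' (U @^-1` A) = exponential_prob theta A.
Hypothesis UV : independent2 P' (sigma_rv U) (sigma_rv V).

Let mV : measurable_fun setT (V : T' -> measurableTypeR R). Proof. by have := @measurable_funPT _ _ _ _ V. Qed.
Let mU : measurable_fun setT (U : T' -> measurableTypeR R). Proof. by have := @measurable_funPT _ _ _ _ U. Qed.

(** The density [theta e^{-theta s}] of the time cancels the weight [theta^{-1} e^{theta s}],
    leaving Lebesgue measure on the half-line. The factor [posinv (V w)], almost surely the inverse
    of [V w], keeps the integrand nonnegative everywhere, as Tonelli requires. *)
Lemma exponential_representation_posinv (F : Y -> R) :
  measurable_fun setT F -> (forall y, 0 <= F y) ->
  (\int[P']_w (kappa / theta * posinv (V w) * expR (theta * U w) *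
     F (jump_path f (V w) (U w)))%:E = \int[nu]_y (F y)%:E)%E.
Proof.
move=> mF F0.
have mFE : measurable_fun setT (EFin \o F) by exact/measurable_EFinP.
have FE0 y : (0 <= (EFin \o F) y)%E by rewrite lee_fin.
have mj := measurable_jump_map f_meas.
pose H (z : measurableTypeR R * measurableTypeR R) :=
  (kappa / theta * posinv z.2 * expR (theta * z.1) * F (jump_map f z))%:E.
have mH : measurable_fun setT H.
  apply/measurable_EFinP; apply: measurable_funM; last exact: measurableT_comp mF mj.
  apply: measurable_funM.
    apply: measurable_funM => //; apply: (measurableT_comp (@measurable_posinv R)).
    exact: measurable_snd.
  have mt : measurable_fun setT (fun y : measurableTypeR R => expR (theta * y)).
    by apply: (measurableT_comp (@measurable_expR R)); exact: measurable_funM.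
  exact: (measurableT_comp mt measurable_fst).
have H0 z : (0 <= H z)%E.
  have kt : 0 <= kappa / theta by rewrite divr_ge0// ltW.
  rewrite lee_fin; apply: mulr_ge0; last exact: F0.
  by apply: mulr_ge0; [apply: mulr_ge0 => //; exact: posinv_ge0|exact: expR_ge0].
have ind (A B : set (measurableTypeR R)) : measurable A -> measurable B ->
    P' (U @^-1` A `&` V @^-1` B) = (P' (U @^-1` A) * P' (V @^-1` B))%E.
  have sT (W : T' -> R) : sigma_rv W setT.
    by exists setT => //; rewrite preimage_setT setTI.
  move=> mA mB; have := proj1 (independent2P P' (sT U) (sT V)) UV.
  by apply; [exists A|exists B] => //; rewrite setTI.
have := integral_indep mU mV ind mH H0; rewrite /H /=.
move=> ->; rewrite nu_integral//.
have VqE : forall A : set (measurableTypeR R), measurable A -> P' (V @^-1` A) = q A.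
  by move=> A mA; rewrite Vlaw// qlaw.
transitivity (\int[P']_w fubini_F q H (U w))%E.
  apply: eq_integral => w _; rewrite /fubini_F.
  apply: (integral_law (G := fun v => H (U w : R, v)) mV VqE).
    by apply: measurableT_comp => //; exact: measurable_pair1.
  by move=> v; exact: H0.
rewrite (integral_density (w := exponential_pdf theta) mU); last 5 first.
- exact: measurable_exponential_pdf.
- by move=> s; apply: exponential_pdf_ge0; exact: ltW.
- by move=> A mA; rewrite Ulaw.
- exact: measurable_fun_fubini_tonelli_F.
- by move=> s; apply: integral_ge0 => v _; exact: H0.
rewrite fubini_tonelli1; [|exact: (mwF mFE)|exact: (wF0 FE0)].
apply: eq_integral => s _; rewrite /fubini_F -ge0_integralZl_EFin//; last 2 first.
- by apply: measurableT_comp => //; exact: measurable_pair1.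
- by apply: exponential_pdf_ge0; exact: ltW.
apply: eq_integral => v _; rewrite /H -!EFinM; congr EFin.
rewrite /jump_weight /= indicE /exponential_pdf patchE.
have [sR|sR] := boolP (s \in Rp); last by rewrite !mul0r.
have e1 : expR (- theta * s) * expR (theta * s) = 1.
  by rewrite -expRD mulNr addNr expR0.
have t0 : theta * theta^-1 = 1 by rewrite divff// gt_eqF.
rewrite mul1r; move: (F _) (posinv v) e1 t0 => a b e1 t0.
rewrite [RHS](_ : _ = (theta * theta^-1) * (expR (- theta * s) * expR (theta * s)) * (kappa * b * a)).
  by ring.
by rewrite e1 t0 !mul1r.
Qed.

Let posinvE : {ae P', forall w, posinv (V w) = (V w)^-1}.
Proof.
apply: filterS (size_biased_gt0 mV Vlaw) => w w0.
by rewrite /posinv indicE mem_set ?mulr1//= in_itv/= w0.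
Qed.

Let measurable_invV : measurable_fun setT (fun w => (V w)^-1).
Proof.
(* [V] may be negative on a null event; squaring reduces to inverses of nonnegative functions. *)
have -> : (fun w => (V w)^-1) = (fun w => V w * (V w * V w)^-1).
  apply/funext => w; have [->|v0] := eqVneq (V w) 0; first by rewrite invr0 mul0r.
  by rewrite invfM mulrA divff// mul1r.
apply: measurable_funM; first exact: mV.
apply: measurable_inv_ge0; first by apply: measurable_funM; exact: mV.
by move=> w; rewrite -expr2 sqr_ge0.
Qed.

Let measurable_FVU (F : Y -> R) : measurable_fun setT F ->
  measurable_fun setT (fun w => F (jump_path f (V w) (U w))).
Proof.
move=> mF; apply: (measurableT_comp mF).
apply: (measurableT_comp (measurable_jump_map f_meas) (g := fun w => (U w, V w))).
exact: measurable_fun_pair.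
Qed.

Let measurable_expU : measurable_fun setT (fun w => expR (theta * U w)).
Proof.
by apply: (measurableT_comp (@measurable_expR R)); apply: measurable_funM => //; exact: mU.
Qed.

Let measurable_posinvV : measurable_fun setT (fun w => posinv (V w)).
Proof. exact: (measurableT_comp (@measurable_posinv R) mV). Qed.

Lemma exponential_representation (F : Y -> R) :
  measurable_fun setT F -> (forall y, 0 <= F y) ->
  (\int[nu]_y (F y)%:E =
   \int[P']_w (kappa / theta * (V w)^-1 * expR (theta * U w) *
     F (jump_path f (V w) (U w)))%:E)%E.
Proof.
move=> mF F0; rewrite -exponential_representation_posinv//.
apply: ae_eq_integral => //.
- apply/measurable_EFinP; apply: measurable_funM; last exact: measurable_FVU.
  by apply: measurable_funM => //; apply: measurable_funM.
- apply/measurable_EFinP; apply: measurable_funM; last exact: measurable_FVU.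
  by apply: measurable_funM => //; apply: measurable_funM.
- by apply: filterS posinvE => w -> _.
Qed.

Lemma exponential_representation_mean (F : Y -> R) :
  measurable_fun setT F -> (forall y, 0 <= F y) ->
  (\int[nu]_y (F y)%:E = (kappa / theta)%:E *
   'E_P'[fun w => ((V w)^-1 * expR (theta * U w) * F (jump_path f (V w) (U w)))%R])%E.
Proof.
move=> mF F0; rewrite -exponential_representation_posinv// expectationE.
rewrite [X in (_ * X)%E](_ : _ = (\int[P']_w (posinv (V w) * expR (theta * U w) *
    F (jump_path f (V w) (U w)))%:E)%E); last first.
  apply: ae_eq_integral => //.
  - apply/measurable_EFinP; apply: measurable_funM; last exact: measurable_FVU.
    exact: measurable_funM.
  - apply/measurable_EFinP; apply: measurable_funM; last exact: measurable_FVU.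
    exact: measurable_funM.
  - by apply: filterS posinvE => w -> _.
rewrite -ge0_integralZl_EFin//.
- by apply: eq_integral => w _; rewrite -EFinM !mulrA.
- by move=> w _; rewrite lee_fin; apply: mulr_ge0 => //;
  apply: mulr_ge0; [exact: posinv_ge0|exact: expR_ge0].
- apply/measurable_EFinP; apply: measurable_funM; last exact: measurable_FVU.
  exact: measurable_funM.
- by rewrite divr_ge0// ltW.
Qed.

Lemma exponential_representation_weighted (A : set Y) : measurable A ->
  nu A = weighted P' (fun w => kappa / theta * (V w)^-1 * expR (theta * U w))
    [set w | A (jump_path f (V w) (U w))].
Proof.
move=> mA; rewrite -[A in LHS]setIT -integral_indic//.
have mI : measurable_fun setT (\1_A : Y -> R) by exact: measurable_indic.
rewrite (exponential_representation mI (fun y => ler0n _ _)).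
rewrite /weighted [RHS]integral_mkcond; apply: eq_integral => w _.
rewrite /patch indicE.
have -> : (w \in [set w0 | A (jump_path f (V w0) (U w0))]) = (jump_path f (V w) (U w) \in A).
  by apply/idP/idP; rewrite !inE.
by case: ifPn => _; rewrite ?mulr1 ?mulr0.
Qed.

End exponential_representation.

End global.

(** * Size biasing *)

(** For fixed [C], both sides are finite measures in [A], with weights the indicator of [C] and the
    constant [P C]; they agree on rectangles. *)
Lemma independent_pair (R : realType) d (T : measurableType d) (P : probability T R)
    d1 d2 (S1 : measurableType d1) (S2 : measurableType d2)
    (U : T -> S1) (V : T -> S2) (C : set T) :
  measurable_fun setT U -> measurable_fun setT V -> measurable C ->
  (forall A B, measurable A -> measurable B ->
     P (U @^-1` A `&` V @^-1` B `&` C) = P (U @^-1` A `&` V @^-1` B) * P C)%E ->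
  forall A, measurable A ->
  (P ((fun w => (U w, V w)) @^-1` A `&` C) = P ((fun w => (U w, V w)) @^-1` A) * P C)%E.
Proof.
move=> mU mV mC ind A mA.
pose phi w := (U w, V w).
have mphi : measurable_fun setT phi by exact: measurable_fun_pair.
have mphiA B : measurable B -> measurable (phi @^-1` B).
  by move=> mB; rewrite -[X in measurable X]setTI; exact: mphi.
pose c : R := fine (P C).
have cE : P C = c%:E by rewrite /c fineK// fin_num_measure.
have IC B : measurable B -> (\int[P]_(w in B) (\1_C w : R)%:E = P (B `&` C))%E.
  by move=> mB; rewrite integral_indic// setIC.
have Ic B : measurable B -> (\int[P]_(w in B) (cst c w)%:E = P B * P C)%E.
  by move=> mB; rewrite (eq_integral (cst c%:E))// integral_cst// cE muleC.
have mI : measurable_fun setT (fun z : S1 * S2 => (\1_A z : R)%:E).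
  by apply/measurable_EFinP; exact: measurable_indic.
have I0 (z : S1 * S2) : (0 <= (\1_A z : R)%:E)%E by rewrite lee_fin.
have := @weighted_integral_unique _ _ _ _ T T R P P (\1_C) (cst c) phi phi
  [set A `*` B | A in measurable & B in measurable]
  (measurable_prod_measurableType S1 S2) _ _ _ _ mphi _ _ mphi _ _ _ mI I0.
have WE (W : T -> R) w :
    ((W w)%:E * (\1_A (phi w) : R)%:E)%E = ((EFin \o W) \_ (phi @^-1` A)) w.
  by rewrite /patch /= -indic_preimage indicE; case: ifPn => _; rewrite ?mule1 ?mule0.
have -> : (\int[P]_w ((\1_C w : R)%:E * (\1_A (phi w) : R)%:E) = P (phi @^-1` A `&` C))%E.
  rewrite -IC; last exact: mphiA.
  by rewrite [RHS]integral_mkcond; apply: eq_integral => w _; rewrite WE.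
have -> : (\int[P]_w ((cst c w)%:E * (\1_A (phi w) : R)%:E) = P (phi @^-1` A) * P C)%E.
  rewrite -Ic; last exact: mphiA.
  by rewrite [RHS]integral_mkcond; apply: eq_integral => w _; rewrite WE.
apply.
- move=> _ _ [A1 mA1 [B1 mB1 <-]] [A2 mA2 [B2 mB2 <-]]; rewrite -setXI.
  by exists (A1 `&` A2); [exact: measurableI|exists (B1 `&` B2); [exact: measurableI|]].
- by exists setT => //; exists setT => //; rewrite setXTT.
- exact: measurable_indic.
- by move=> w; rewrite indicE.
- exact: measurable_cst.
- by move=> w; rewrite /c fine_ge0.
- by rewrite IC// setTI; apply: le_lt_trans (probability_le1 P mC) _; rewrite ltry.
- move=> _ [A1 mA1 [B1 mB1 <-]].
  have mAB : measurable (phi @^-1` (A1 `*` B1)) by apply: mphiA; exact: measurableX.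
  by rewrite IC// Ic//; exact: ind.
Qed.

Section size_bias.
Context {R : realType} d (T : measurableType d) (P : probability T R).
Variable Z : subordinator P.
Variables (kappa : R) (rho : {measure set (measurableTypeR R) -> \bar R}).
Hypotheses (kappa_gt0 : 0 < kappa) (kappaE : 'E_P[Z (1%:nng)%R]%E = kappa%:E).
Hypothesis rhoE : driftless_levy_measure P (Z 1%:nng) rho.
Variable q : probability (measurableTypeR R) R.
Hypothesis qlaw : forall A, measurable A ->
  q A = (\int[rho]_(x in A `&` `]0%R, +oo[) (kappa^-1 * x)%:E)%E.
Hypothesis qE : forall G : R -> \bar R, measurable_fun setT G -> (forall x, 0 <= G x)%E ->
  (\int[q]_x ((kappa * posinv x)%:E * G x) = \int[rho]_(x in `]0%R, +oo[) G x)%E.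
Variable f : R -> R.
Hypotheses (f_meas : measurable_fun setT f) (f_ge0 : forall u : R, 0 <= f u).
Hypothesis f_neg : forall u : R, u < 0 -> f u = 0.
Hypothesis I_fin : forall t : R, 0 < t -> (prim f t < +oo)%E.

Local Notation lam := (@lebesgue_measure R).
Local Notation Rp := (`[0%R, +oo[%classic : set R).
Local Notation Y := (paths R {nonneg R}).
Local Notation psi := (stoch_conv Z f).

Let mRp : measurable Rp. Proof. exact: measurable_itv. Qed.

Lemma stoch_conv_process : nonneg_process psi.
Proof. by rewrite stoch_conv_funE; exact: conv_process. Qed.

Let mpsi t : measurable_fun setT (psi t). Proof. by have [] := stoch_conv_process t. Qed.
Let psi0 t w : 0 <= psi t w. Proof. by have [_] := stoch_conv_process t. Qed.

Definition psi_laplace l : R := mean P (fun w => expR (- lin psi l w)).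

Lemma psi_laplaceE l : psi_laplace l = expR (- conv_exponent Z f Rp l).
Proof. by rewrite /psi_laplace stoch_conv_funE (conv_lin_laplace kappa_gt0 kappaE rhoE). Qed.

Let mex (X : T -> R) : measurable_fun setT X -> measurable_fun setT (fun w => expR (- X w)).
Proof. by move=> mX; apply: measurableT_comp => //; apply: measurableT_comp. Qed.

Let mlin l : measurable_fun setT (lin psi l). Proof. exact: measurable_lin. Qed.

Let mj := measurable_jump_map f_meas.

Let mjl l : measurable_fun setT (fun z => expR (- pairing l (jump_map f z))).
Proof.
apply: measurableT_comp => //; apply: measurableT_comp => //.
exact: measurableT_comp (measurable_pairing l) mj.
Qed.

Let mw : measurable_fun setT (jump_weight kappa Rp). Proof. exact: measurable_jump_weight. Qed.

Let w0 z : 0 <= jump_weight kappa Rp z. Proof. exact: jump_weight_ge0. Qed.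

(** [e^{-l} (1 - e^{-b y(a)})] is the difference of the integrands of the two exponents; it is
    proved in additive form and then finite terms are cancelled. *)
Lemma jumps_exponent_diff l (a : {nonneg R}) (b : R) : 0 < b ->
  (\int[jumps q]_z (jump_weight kappa Rp z * expR (- pairing l (jump_map f z)) *
     (1 - expR (- (b * (jump_map f z a)%:num))))%:E =
   (conv_exponent Z f Rp ((posp b, a) :: l) - conv_exponent Z f Rp l)%:E)%E.
Proof.
move=> b0; pose l' := (posp b, a) :: l.
have lE z : pairing l' (jump_map f z) = b * (jump_map f z a)%:num + pairing l (jump_map f z).
  by rewrite pairing_cons posp_num// ltW.
have e1 := jumps_conv_exponent kappa_gt0 kappaE rhoE qE f_meas f_ge0 f_neg I_fin l mRp
  (@subset_refl _ Rp).
have e2 := jumps_conv_exponent kappa_gt0 kappaE rhoE qE f_meas f_ge0 f_neg I_fin l' mRp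
  (@subset_refl _ Rp).
pose D := fun z => (jump_weight kappa Rp z * expR (- pairing l (jump_map f z)) *
     (1 - expR (- (b * (jump_map f z a)%:num)))).
have D0 z : 0 <= D z.
  apply: mulr_ge0; first by apply: mulr_ge0; [exact: w0|exact: expR_ge0].
  have h : 0 <= b * (jump_map f z a)%:num by apply: mulr_ge0 => //; exact: ltW.
  by have /andP[] := onem_expRN_itv h.
have mD : measurable_fun setT D.
  apply: measurable_funM; first exact: measurable_funM.
  apply: measurable_funB => //; apply: measurableT_comp => //; apply: measurableT_comp => //.
  apply: measurable_funM => //.
  exact: (measurableT_comp (measurable_coord a) mj).
have E : (\int[jumps q]_z (D z)%:E + (conv_exponent Z f Rp l)%:E =
    (conv_exponent Z f Rp l')%:E)%E.
  apply: (etrans _ e2).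
  apply: (etrans (congr2 (fun u v => u + v)%E (erefl _) (esym e1))).
  rewrite -ge0_integralD//.
  - apply: eq_integral => z _; rewrite -EFinD lE opprD expRD /D; congr EFin.
    by move: (jump_weight _ _ _) (expR _) (expR _) => x y v; ring.
  - by move=> z _; rewrite lee_fin.
  - exact/measurable_EFinP.
  - move=> z _; rewrite lee_fin; apply: mulr_ge0; first exact: w0.
    by have /andP[] := onem_expRN_itv (pairing_ge0 l (jump_map f z)).
  - by apply/measurable_EFinP; apply: measurable_funM => //; apply: measurable_funB.
have aux (I : \bar R) (u v : R) : (I + v%:E = u%:E -> I = (u - v)%:E)%E.
  by case: I => [r| |]//= -[<-]; rewrite addrK.
exact: aux E.
Qed.

(** The Laplace functional is the exponential of minus the exponent, so its derivative is itself
    times that of the exponent, which integrates [y(a) e^{-l}] over the jumps. *)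
Lemma psi_size_bias (a : {nonneg R}) l :
  (\int[P]_w (expR (- lin psi l w) * psi a w)%:E =
   (psi_laplace l)%:E * \int[jumps q]_z
     (jump_weight kappa Rp z * expR (- pairing l (jump_map f z)) * (jump_map f z a)%:num)%:E)%E.
Proof.
apply: (@laplace_derivative _ _ _ _ _ _ _ _ _ _ _ _
  (fun b => conv_exponent Z f Rp ((posp b, a) :: l) - conv_exponent Z f Rp l)).
- exact: mex.
- by move=> w; exact: expR_ge0.
- exact: mpsi.
- exact: psi0.
- exact: measurable_funM.
- by move=> z; apply: mulr_ge0; [exact: w0|exact: expR_ge0].
- exact: (measurableT_comp (measurable_coord a) mj).
- by [].
- by rewrite psi_laplaceE expR_ge0.
- by move=> b b0; exact: jumps_exponent_diff.
- move=> b b0; have pE : (posp b)%:num = b by rewrite posp_num// ltW.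
  have lE w : lin psi ((posp b, a) :: l) w = b * psi a w + lin psi l w.
    by rewrite /lin big_cons pE.
  under eq_integral do rewrite mulrBr mulr1 -expRD -opprD [lin _ _ _ + _]addrC -lE EFinB.
  have ie l' : P.-integrable setT (EFin \o (fun w => expR (- lin psi l' w))).
    apply: ge0_integrable; [exact: mex|by move=> w; exact: expR_ge0|].
    by rewrite (lin_exp_mean P l' stoch_conv_process) ltry.
  rewrite (integralB measurableT (ie _) (ie _)).
  rewrite (lin_exp_mean P l stoch_conv_process).
  rewrite (lin_exp_mean P ((posp b, a) :: l) stoch_conv_process) -EFinB; congr EFin.
  have aux (u v x y : R) : u = expR (- x) -> v = expR (- y) ->
      u - v = u * (1 - expR (- (y - x))).
    by move=> -> ->; rewrite mulrBr mulr1 -expRD; congr (_ - expR _); ring.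
  exact: aux (psi_laplaceE l) (psi_laplaceE ((posp b, a) :: l)).
Qed.

Section at_point.
Variables (a : {nonneg R}) (U V : {RV P >-> R}).
Hypotheses (a_gt0 : 0 < a%:num) (Ia_gt0 : (0 < prim f a%:num)%E).
Hypothesis Ulaw : forall A : set R, measurable A ->
  P (U @^-1` A) = (\int[lam]_(s in A `&` `[0%R, a%:num])
    (f (a%:num - s) / fine (prim f a%:num))%:E)%E.
Hypothesis Vlaw : has_size_biased_law P V kappa rho.
Hypothesis ind : independent3 P (sigma_rv U) (sigma_rv V) (sigma_process psi).

Local Notation Ia := (fine (prim f a%:num)).

Let Ia0 : 0 < Ia.
Proof. by rewrite fine_gt0// Ia_gt0 (I_fin a_gt0). Qed.

Let mV : measurable_fun setT (V : T -> measurableTypeR R).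
Proof. by have := @measurable_funPT _ _ _ _ V. Qed.
Let mU : measurable_fun setT (U : T -> measurableTypeR R).
Proof. by have := @measurable_funPT _ _ _ _ U. Qed.

Let UV w : measurableTypeR R * measurableTypeR R := (U w, V w).

Let mUV : measurable_fun setT UV. Proof. exact: measurable_fun_pair. Qed.

Let mpath : measurable_fun setT (path_of psi). Proof. exact: measurable_path_of. Qed.

Let rvT (W : T -> R) : sigma_rv W setT.
Proof. by exists setT => //; rewrite preimage_setT setTI. Qed.

Let rvI (W : T -> R) (A : set R) : measurable A -> sigma_rv W (W @^-1` A).
Proof. by move=> mA; exists A => //; rewrite setTI. Qed.

Let spI (C : set Y) : measurable C -> sigma_process psi (path_of psi @^-1` C).
Proof. by move=> mC; rewrite sigma_process_path_of//; exists C => //; rewrite setTI. Qed.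

Let spT : sigma_process psi setT.
Proof. by rewrite -(preimage_setT (path_of psi)); exact: spI. Qed.

Lemma UV_independent (A B : set (measurableTypeR R)) : measurable A -> measurable B ->
  (P (U @^-1` A `&` V @^-1` B) = P (U @^-1` A) * P (V @^-1` B))%E.
Proof.
move=> mA mB; have := independent3E ind (rvI U mA) (rvI V mB) spT.
by rewrite setIT probability_setT mule1.
Qed.

Lemma UV_psi_independent (A : set (measurableTypeR R * measurableTypeR R)) (C : set Y) :
  measurable A -> measurable C ->
  (P (UV @^-1` A `&` path_of psi @^-1` C) = P (UV @^-1` A) * P (path_of psi @^-1` C))%E.
Proof.
move=> mA mC; apply: (independent_pair mU mV) => //.
  by rewrite -[X in measurable X]setTI; exact: mpath.
move=> A1 B1 mA1 mB1; rewrite UV_independent//.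
exact: (independent3E ind (rvI U mA1) (rvI V mB1) (spI mC)).
Qed.

(** [jump_path] clips negative values while [V f(t - U)] is not clipped. The weight [pos (V w)],
    almost surely [1], confines the argument to [V > 0], where both agree. *)
Let pos (v : R) : R := \1_(`]0%R, +oo[%classic : set R) v.

Let mpos : measurable_fun setT pos. Proof. exact: measurable_indic. Qed.

(** The law of the jump path is the image of the jumps weighted by [y(a) / (kappa I(a))]: in the
    weight [(kappa / x) x f(a - s)] the factor [x] cancels, and what is left is the joint density of
    [U] and [V]. *)
Lemma jump_laplace l :
  (\int[P]_w (pos (V w) * expR (- pairing l (jump_map f (UV w))))%:E =
   ((kappa * Ia)^-1)%:E * \int[jumps q]_z
     (jump_weight kappa Rp z * expR (- pairing l (jump_map f z)) * (jump_map f z a)%:num)%:E)%E.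
Proof.
pose H (z : measurableTypeR R * measurableTypeR R) :=
  (pos z.2 * expR (- pairing l (jump_map f z)))%:E.
have mH : measurable_fun setT H.
  apply/measurable_EFinP; apply: measurable_funM => //.
  exact: (measurableT_comp mpos measurable_snd).
have pos0 v : 0 <= pos v by rewrite /pos.
have H0 z : (0 <= H z)%E by rewrite lee_fin; apply: mulr_ge0 => //; exact: expR_ge0.
apply: (etrans (integral_indep mU mV UV_independent mH H0)).
have VqE : forall A : set (measurableTypeR R), measurable A -> P (V @^-1` A) = q A.
  by move=> A mA; rewrite Vlaw// qlaw.
transitivity (\int[P]_w fubini_F q H (U w))%E.
  apply: eq_integral => w _; rewrite /fubini_F.
  apply: (integral_law (G := fun v => H (U w : R, v)) mV VqE).
    by apply: measurableT_comp => //; exact: measurable_pair1.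
  by move=> v; exact: H0.
(* Written on the whole half-line: beyond [a] the density vanishes because [f] does on negative
   numbers. *)
pose dens s := Ia^-1 * (\1_Rp s * f (a%:num - s)).
have mdens : measurable_fun setT dens.
  apply: measurable_funM => //; apply: measurable_funM; first exact: measurable_indic.
  exact: measurable_shift.
have dens0 s : 0 <= dens s.
  apply: mulr_ge0; first by rewrite invr_ge0 ltW.
  by apply: mulr_ge0.
rewrite (integral_density (w := dens) mU mdens dens0); last 3 first.
- move=> A mA; rewrite Ulaw// [LHS]integral_mkcond [RHS]integral_mkcond.
  apply: eq_integral => s _; rewrite /patch in_setI /dens indicE.
  have [sA|//] := boolP (s \in A).
  rewrite /=; have [s0|s0] := ltP s 0.
    rewrite !memNset ?mul0r ?mulr0//= in_itv/= ?andbT ?leNgt ?s0//.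
  have sR : s \in Rp by rewrite inE/= in_itv/= s0.
  rewrite sR mul1r; case: ifPn => [_|]; first by rewrite mulrC.
  rewrite notin_setE/= in_itv/= s0/= => /negP; rewrite -ltNge => sa.
  by rewrite f_neg ?mulr0// subr_lt0.
- exact: measurable_fun_fubini_tonelli_F.
- by move=> s; apply: integral_ge0 => v _; exact: H0.
have kI0 : 0 <= (kappa * Ia)^-1 by rewrite invr_ge0 mulr_ge0// ltW.
have mR : measurable_fun setT (fun z => (jump_weight kappa Rp z *
    expR (- pairing l (jump_map f z)) * (jump_map f z a)%:num)%:E).
  apply/measurable_EFinP; apply: measurable_funM; first exact: measurable_funM.
  exact: (measurableT_comp (measurable_coord a) mj).
have R0 z : (0 <= (jump_weight kappa Rp z *
    expR (- pairing l (jump_map f z)) * (jump_map f z a)%:num)%:E)%E.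
  rewrite lee_fin; apply: mulr_ge0 => //.
  by apply: mulr_ge0; [exact: w0|exact: expR_ge0].
rewrite -ge0_integralZl_EFin//.
rewrite fubini_tonelli1; last 2 first.
- exact: emeasurable_funM.
- by move=> z; rewrite mule_ge0.
apply: eq_integral => s _; rewrite /fubini_F -ge0_integralZl_EFin//; last first.
  by apply: measurableT_comp => //; exact: measurable_pair1.
apply: eq_integral => v _; rewrite /H -!EFinM; congr EFin.
rewrite /jump_weight /dens /posinv -/(pos v) /=.
have [v0|v0] := boolP (0 < v); last first.
  have -> : pos v = 0.
    rewrite /pos indicE memNset//= in_itv/= andbT; exact/negP.
  by rewrite !(mulr0, mul0r).
have -> : pos v = 1 by rewrite /pos indicE mem_set//= in_itv/= v0.
rewrite /jump_map /jump_path posp_num/= ?mulr_ge0 ?(ltW v0)//.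
have vv : v^-1 * v = 1 by rewrite mulVf// gt_eqF.
have kk : kappa^-1 * kappa = 1 by rewrite mulVf// gt_eqF.
rewrite mulr1 mul1r invfM.
move: (expR _) (f _) (\1_Rp s) (Ia^-1) (v^-1) (kappa^-1) vv kk => e x o I v' k' vv kk.
rewrite [RHS](_ : _ = (v' * v) * (k' * kappa) * (I * (o * x) * e)).
  by rewrite vv kk !mul1r.
by ring.
Qed.

(** By independence, the Laplace functional of the sum is the product of those of [psi] and of the
    jump; [jump_laplace] and [psi_size_bias] turn this product into the size-biased functional of
    [psi]. *)
Lemma psi_plus_jump_law :
  same_law P (fun t w => psi t w + V w * f (t%:num - U w))
    (weighted P (fun w => psi a w / (kappa * Ia))) psi.
Proof.
move=> n t B mB.
pose X (s : {nonneg R}) w := psi s w + V w * f (s%:num - U w).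
(* The clipped version is nonnegative everywhere, as the comparison of laws requires; it equals [X]
   when [V > 0]. *)
pose X' (s : {nonneg R}) w := psi s w + (jump_map f (UV w) s)%:num.
have mVf s : measurable_fun setT (fun w => V w * f (s - U w)).
  by apply: measurable_funM; [exact: mV|exact: (measurableT_comp (measurable_shift f_meas s) mU)].
have mX s : measurable_fun setT (X s) by exact: measurable_funD.
have pX' : nonneg_process X'.
  move=> s; split; last by move=> w; apply: addr_ge0; [exact: psi0|exact: ge0].
  apply: measurable_funD => //.
  exact: (measurableT_comp (measurable_coord s) (measurableT_comp mj mUV)).
pose W1 w := pos (V w).
have mW1 : measurable_fun setT W1 by exact: (measurableT_comp mpos mV).
have W10 w : 0 <= W1 w by rewrite /W1 /pos.
have W11 w : W1 w <= 1 by rewrite /W1 /pos indicE; case: (_ \in _).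
pose W2 w := psi a w / (kappa * Ia).
have kI : 0 < kappa * Ia by exact: mulr_gt0.
have mW2 : measurable_fun setT W2 by exact: measurable_funM.
have W20 w : 0 <= W2 w by apply: divr_ge0; [exact: psi0|exact: ltW].
have W1fin : (\int[P]_w (W1 w)%:E < +oo)%E.
  apply: (@le_lt_trans _ _ (\int[P]_w (cst 1 w))%E).
    apply: ge0_le_integral => //; first by move=> w _; rewrite lee_fin.
      exact/measurable_EFinP.
    by move=> w _; rewrite lee_fin.
  by rewrite integral_cst// mul1e /= probability_setT ltry.
have V0 := size_biased_gt0 mV Vlaw.
have L l : (\int[P]_w (W1 w * expR (- lin X' l w))%:E =
            \int[P]_w (W2 w * expR (- lin psi l w))%:E)%E.
  transitivity ((\int[P]_w (W1 w * expR (- pairing l (jump_map f (UV w))))%:E) *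
      (psi_laplace l)%:E)%E.
    rewrite -(lin_exp_mean P l stoch_conv_process).
    pose G (z : measurableTypeR R * measurableTypeR R) := pos z.2 * expR (- pairing l (jump_map f z)).
    have mG : measurable_fun setT G.
      by apply: measurable_funM => //; exact: (measurableT_comp mpos measurable_snd).
    have G0 z : 0 <= G z by apply: mulr_ge0; [rewrite /pos|exact: expR_ge0].
    have mK : measurable_fun [set: Y] (fun y : Y => expR (- pairing l y)).
      by apply: measurableT_comp => //; apply: measurableT_comp => //; exact: measurable_pairing.
    have K0 (y : Y) : 0 <= expR (- pairing l y) by exact: expR_ge0.
    have := integral_indepM mUV mpath UV_psi_independent mG G0 mK K0.
    move=> H; apply: (etrans _ (etrans H _)).
      apply: eq_integral => w _; congr EFin; rewrite /G /W1.
      have -> : pairing l (path_of psi w) = lin psi l w by exact: pairing_path_of.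
      rewrite -mulrA -expRD -opprD; congr (_ * expR (- _)).
      by rewrite [RHS]addrC /lin /pairing -big_split/=; apply: eq_bigr => p _; exact: mulrDr.
    apply: (congr2 (fun u v => u * v)%E (erefl _)); apply: eq_integral => w _; congr EFin.
    by congr (expR (- _)); exact: pairing_path_of.
  rewrite jump_laplace.
  transitivity (\int[P]_w (((kappa * Ia)^-1)%:E * (expR (- lin psi l w) * psi a w)%:E))%E; last first.
    apply: eq_integral => w _; rewrite -EFinM /W2; congr EFin.
    by move: (psi a w) (expR _) ((kappa * Ia)^-1) => x y k; ring.
  rewrite ge0_integralZl_EFin; last 4 first.
  - exact: measurableT.
  - by move=> w _; rewrite lee_fin; apply: mulr_ge0; [exact: expR_ge0|exact: psi0].
  - by apply/measurable_EFinP; apply: measurable_funM; [exact: mex|exact: mpsi].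
  - by rewrite invr_ge0; exact: ltW.
  by rewrite psi_size_bias -muleA; congr (_ * _)%E; rewrite muleC.
have E := weighted_same_law mW1 W10 pX' mW2 W20 stoch_conv_process W1fin L t mB.
apply: (etrans _ E).
have mS (A : {nonneg R} -> T -> R) : (forall s, measurable_fun setT (A s)) ->
    measurable [set w | B [tuple A (tnth t i) w | i < n]].
  move=> mA; have mt : measurable_fun setT (fun w => [tuple A (tnth t i) w | i < n]).
    apply/measurable_fun_tnthP => i.
    rewrite (_ : _ \o _ = A (tnth t i)); first exact: mA.
    by apply/funext => w /=; rewrite tnth_mktuple.
  by rewrite -[X in measurable X]setTI; exact: mt.
have mS1 := mS X mX; have mS2 := mS X' (fun s => (pX' s).1).
rewrite -[X in P X]setIT -integral_indic// [RHS]integral_mkcond.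
apply: ae_eq_integral => //.
- by apply/measurable_EFinP; exact: measurable_indic.
- apply/(measurable_restrictT _ mS2); apply: measurable_funTS; exact/measurable_EFinP.
- apply: filterS V0 => w w0' _; rewrite /patch indicE.
  have W1E : W1 w = 1 by rewrite /W1 /pos indicE mem_set//= in_itv/= w0'.
  have XE s : X s w = X' s w.
    by rewrite /X /X' /jump_map /jump_path posp_num// mulr_ge0// ltW.
  have -> : (w \in [set w | B [tuple X (tnth t i) w | i < n]]) =
      (w \in [set w | B [tuple X' (tnth t i) w | i < n]]).
    by apply/idP/idP; rewrite !inE /=; (rewrite (_ : [tuple X _ w | i < n] =
      [tuple X' (tnth t i) w | i < n]); [by []|by apply: eq_from_tnth => i; rewrite !tnth_mktuple]).
  by case: ifPn; rewrite /= ?W1E.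
Qed.

End at_point.

End size_bias.

Theorem mainTheorem3 (R : realType) (d : measure_display)
    (T : measurableType d) (P : probability T R)
    (Z : subordinator P) (kappa : R)
    (rho : {measure set (measurableTypeR R) -> \bar R}) (f : R -> R)
    (nu : {measure set (paths R {nonneg R}) -> \bar R})
    (kappa_gt0 : 0 < kappa) (kappaE : 'E_P[Z (1%:nng)%R]%E = kappa%:E)
    (rhoE : driftless_levy_measure P (Z 1%:nng) rho)
    (f_meas : measurable_fun setT f) (f_ge0 : forall u : R, 0 <= f u)
    (f_neg : forall u : R, u < 0 -> f u = 0)
    (I_fin : forall t : R, 0 < t -> (prim f t < +oo)%E)
    (nuE : is_levy_measure P (stoch_conv Z f) nu) :
  let psi := stoch_conv Z f in
  (* (a3) *)
  [/\ forall (a : {nonneg R}) (U V : {RV P >-> R}),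
        0 < a%:num -> (0 < prim f a%:num)%E ->
        (forall A : set R, measurable A ->
           P (U @^-1` A) =
           (\int[lebesgue_measure]_(s in A `&` `[0%R, a%:num])
              (f (a%:num - s) / fine (prim f a%:num))%:E)%E) ->
        has_size_biased_law P V kappa rho ->
        independent3 P (sigma_rv U) (sigma_rv V) (sigma_process psi) ->
        same_law P (fun t w => psi t w + V w * f (t%:num - U w))
          (weighted P (fun w => psi a w / (kappa * fine (prim f a%:num)))) psi,
  (* (b3) *)
      forall (theta : R) (d' : measure_display) (T' : measurableType d')
        (P' : probability T' R) (V Y : {RV P' >-> R}),
        (exists t : R, 0 < t /\ (0 < prim f t)%E) ->
        0 < theta ->
        (\int[lebesgue_measure]_(s in `[0%R, +oo[)
           (expR (- (theta * s)) * f s)%:E < +oo)%E ->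
        has_size_biased_law P' V kappa rho ->
        (forall A : set R, measurable A ->
           P' (Y @^-1` A) = exponential_prob theta A) ->
        independent2 P' (sigma_rv Y) (sigma_rv V) ->
        (forall F : paths R {nonneg R} -> R,
           measurable_fun setT F -> (forall y, 0 <= F y) ->
           (\int[nu]_y (F y)%:E =
            (kappa / theta)%:E *
            'E_P'[fun w => ((V w)^-1 * expR (theta * Y w) *
                            F (jump_path f (V w) (Y w)))%R])%E) /\
        (forall A : set (paths R {nonneg R}), measurable A ->
           nu A =
           weighted P' (fun w => kappa / theta * (V w)^-1 * expR (theta * Y w))
             [set w | A (jump_path f (V w) (Y w))]) &
  (* (c3) *)
      forall a : {nonneg R}, 0 < a%:num ->
        let D := [set s : R | 0 <= s /\ f (a%:num - s) = 0] in
        let Dc := [set s : R | 0 <= s] `\` D in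
        [/\ levy_decomposition P (stoch_conv_on Z f D) (stoch_conv_on Z f Dc)
              nu a,
            forall (d' : measure_display) (T' : measurableType d')
              (P' : probability T' R) (X L : {nonneg R} -> T' -> R),
              levy_decomposition P' X L nu a ->
              [/\ same_law P psi P' (fun t w => X t w + L t w),
                  same_law P' X P (stoch_conv_on Z f D) &
                  same_law P' L P (stoch_conv_on Z f Dc)],
            (exists t : R, 0 < t /\ (0 < prim f t)%E) ->
            forall F : paths R {nonneg R} -> R,
              measurable_fun setT F -> (forall y, 0 <= F y) ->
              (\int[levy_zero nu a]_y (F y)%:E =
               \int[lebesgue_measure]_(s in D)
                 \int[rho]_(x in `]0%R, +oo[) (F (jump_path f x s))%:E)%E &
            forall F : paths R {nonneg R} -> R,
              measurable_fun setT F -> (forall y, 0 <= F y) ->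
              (\int[levy_pos nu a]_y (F y)%:E =
               \int[lebesgue_measure]_(s in Dc)
                 \int[rho]_(x in `]0%R, +oo[) (F (jump_path f x s))%:E)%E]].
Proof.
move=> psi.
have [q [qlaw qE]] := size_biased_probability kappa_gt0 (levy_mean kappaE rhoE).
split.
- move=> a U V a0 Ia Ulaw Vlaw ind.
  exact: (psi_plus_jump_law kappa_gt0 kappaE rhoE qlaw qE f_meas f_ge0 f_neg I_fin
    a0 Ia Ulaw Vlaw ind).
- move=> theta d' T' P' V Y f_pos theta0 _ Vlaw Ylaw YV; split.
    move=> F mF F0; exact: (exponential_representation_mean kappa_gt0 kappaE rhoE qE f_meas
      f_ge0 f_neg I_fin nuE f_pos theta0 Vlaw qlaw Ylaw YV mF F0).
  move=> A mA; exact: (exponential_representation_weighted kappa_gt0 kappaE rhoE qE f_meas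
    f_ge0 f_neg I_fin nuE f_pos theta0 Vlaw qlaw Ylaw YV mA).
move=> a a0 D Dc; split.
- exact: (conv_levy_decomposition kappa_gt0 kappaE rhoE qE f_meas f_ge0 f_neg I_fin nuE a).
- move=> d' T' P' X L XL.
  exact: (levy_decomposition_laws kappa_gt0 kappaE rhoE qE f_meas f_ge0 f_neg I_fin nuE XL).
- move=> f_pos F mF F0.
  apply: (levy_zero_integral kappa_gt0 kappaE rhoE qE f_meas f_ge0 f_neg I_fin nuE f_pos a
    (F := EFin \o F)) => [|y]; first exact/measurable_EFinP.
  by rewrite lee_fin.
- move=> F mF F0.
  apply: (levy_pos_integral kappa_gt0 kappaE rhoE qE f_meas f_ge0 f_neg I_fin nuE a
    (F := EFin \o F)) => [|y]; first exact/measurable_EFinP.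
  by rewrite lee_fin.
Qed.
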